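(* Let $m\ge 2$ and $d\ge 2$, and write $t_i:=t_i^{(d)}$. Then \[\mathcal{C}^{(d)}=\mathcal{D}_0^+\mathcal{C}^{(d)}\oplus \bigoplus_{s=0}^{d-1}\langle t_1^s\rangle_{\mathrm{GL}_m(\mathbb{C})}\oplus\bigoplus_{s=1}^{d-1}\langle t_1^{s-1}[t_1,t_2]\rangle_{\mathrm{GL}_m(\mathbb{C})}.\] In particular, $\mathcal{C}^{(d)}$ is minimally generated as a $\mathcal{D}_0$-module by the subspace \[\bigoplus_{s=0}^{d-1}\langle t_1^s\rangle_{\mathrm{GL}_m(\mathbb{C})}\oplus\bigoplus_{s=1}^{d-1}\langle t_1^{s-1}[t_1,t_2]\rangle_{\mathrm{GL}_m(\mathbb{C})},\] where $\langle t_1^s\rangle_{\mathrm{GL}_m(\mathbb{C})}$ is an irreducible $\mathrm{GL}_m(\mathbb{C})$-submodule of $\mathcal{C}^{(d)}$ with highest weight $(s,0,\dots,0)$, and $\langle t_1^{s-1}[t_1,t_2]\rangle_{\mathrm{GL}_m(\mathbb{C})}$ is an irreducible $\mathrm{GL}_m(\mathbb{C})$-submodule of $\mathcal{C}^{(d)}$ with highest weight $(s,1,0,\dots,0)$.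
   Context: $\mathfrak{sl}_2(\mathbb{C})$ is the Lie algebra of traceless $2\times 2$ complex matrices, on which $\mathrm{SL}_2(\mathbb{C})$ acts by $\mathrm{Ad}(g)(X)=gXg^{-1}$; $\mathrm{SL}_2(\mathbb{C})$ acts on $\mathfrak{sl}_2(\mathbb{C})^{\oplus m}$ (direct sum of $m$ copies) by $\mathrm{Ad}^{\oplus m}$. $\Psi^{(d)}:\mathrm{SL}_2(\mathbb{C})\to\mathrm{GL}(\mathbb{C}^d)$ is the (unique up to isomorphism) $d$-dimensional irreducible representation of the complex Lie group $\mathrm{SL}_2(\mathbb{C})$, and $\rho^{(d)}:\mathfrak{sl}_2(\mathbb{C})\to\mathbb{C}^{d\times d}$ is its tangent representation (differential at the identity). $\mathrm{SL}_2(\mathbb{C})$ acts on $\mathbb{C}^{d\times d}$ by $M\mapsto\Psi^{(d)}(g)M\Psi^{(d)}(g)^{-1}$. $\mathcal{C}^{(d)}$ is the associative unital $\mathbb{C}$-algebra (pointwise operations) of all $\mathrm{SL}_2(\mathbb{C})$-equivariant polynomial maps $\mathfrak{sl}_2(\mathbb{C})^{\oplus m}\to\mathbb{C}^{d\times d}$. $t_i^{(d)}\in\mathcal{C}^{(d)}$ is the map $(X_1,\dots,X_m)\mapsto\rho^{(d)}(X_i)$; $[t_1,t_2]=t_1t_2-t_2t_1$; $t_1^0=I_d$ (constant map to the identity matrix). $\mathcal{D}_0=\mathbb{C}[\mathfrak{sl}_2(\mathbb{C})^{\oplus m}]^{\mathrm{SL}_2(\mathbb{C})}$ is the algebra of $\mathrm{Ad}^{\oplus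 m}$-invariant polynomial functions; it is identified with the central subalgebra $\mathcal{D}_0I_d$ of $\mathcal{C}^{(d)}$ via $f\mapsto fI_d$, making $\mathcal{C}^{(d)}$ a $\mathcal{D}_0$-module. $\mathcal{D}_0$ and $\mathcal{C}^{(d)}$ are graded by the standard polynomial degree on $\mathfrak{sl}_2(\mathbb{C})^{\oplus m}$, and $\mathcal{D}_0^+$ is the ideal of $\mathcal{D}_0$ spanned by the homogeneous elements of positive degree. A set of homogeneous elements minimally generates the $\mathcal{D}_0$-module $\mathcal{C}^{(d)}$ if and only if it is a $\mathbb{C}$-vector space basis of a direct complement of $\mathcal{D}_0^+\mathcal{C}^{(d)}$ in $\mathcal{C}^{(d)}$; ''minimally generated by a (graded) subspace'' means that a homogeneous vector space basis of the subspace is such a minimal generating set. $\mathrm{GL}_m(\mathbb{C})$ acts from the right on $\mathfrak{sl}_2(\mathbb{C})^{\oplus m}$ by $(X_1,\dots,X_m)\cdot g=(\sum_{i=1}^m g_{i1}X_i,\dots,\sum_{i=1}^m g_{im}X_i)$ for $g=(g_{ij})$, and hence on $\mathcal{C}^{(d)}$ by algebra automorphisms: $(gF)(X)=F(X\cdot g)$. $\langle F\rangle_{\mathrm{GL}_m(\mathbb{C})}$ denotes the $\mathrm{GL}_m(\mathbb{C})$-submodule generated by $F$. Isomorphism classes of irreducible polynomial $\mathrm{GL}_m(\mathbb{C})$-modules are labeled by their highest weights $\lambda=(\lambda_1,\dots,\lambda_m)$, $\lambda_1\ge\dots\ge\lambda_m\ge 0$ integers (highest weight vectors being fixed by the unipotent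 upper triangular matrices, with $\mathrm{diag}(z_1,\dots,z_m)$ acting by $z_1^{\lambda_1}\cdots z_m^{\lambda_m}$). *)

(* Defs.v *)
From HB Require Import structures.
From mathcomp Require Import all_boot all_order all_algebra.
From mathcomp Require Import boolp classical_sets functions reals.
From mathcomp Require Import topology normedtype derive.
From mathcomp Require Import complex.
From mathcomp Require mpoly.
Import -(notations) mpoly.

Set Implicit Arguments.
Unset Strict Implicit.
Unset Printing Implicit Defensive.

Import Order.TTheory GRing.Theory Num.Theory.
Import numFieldNormedType.Exports.

Local Open Scope classical_set_scope.
Local Open Scope ring_scope.

Definition is_subspace (C : fieldType) (E : lmodType C) (W : set E) : Prop :=
  W 0 /\ forall (a : C) (x y : E), W x -> W y -> W (a *: x + y).

Definition lspan (C : fieldType) (E : lmodType C) (B : set E) : set E :=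
  smallest (@is_subspace C E) B.

Definition lin_indep (C : fieldType) (E : lmodType C) (B : set E) : Prop :=
  forall (n : nat) (b : 'I_n -> E) (c : 'I_n -> C),
    injective b -> (forall k, B (b k)) ->
    \sum_k c k *: b k = 0 -> forall k, c k = 0.

Definition is_basis (C : fieldType) (E : lmodType C) (W B : set E) : Prop :=
  lin_indep B /\ lspan B = W.

Definition sum_sets (E : zmodType) (I : finType) (U : I -> set E) : set E :=
  [set x | exists2 u : I -> E, forall i, U i (u i) & x = \sum_i u i].

(* The second clause expresses directness only when the [U i] are subspaces. *)
Definition is_direct_sum (E : zmodType) (I : finType) (W : set E)
    (U : I -> set E) : Prop :=
  W = sum_sets U /\
  forall u : I -> E, (forall i, U i (u i)) ->
    \sum_i u i = 0 -> forall i, u i = 0.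

Definition traceless (C : numClosedFieldType) : {pred 'M[C]_2} :=
  fun X => \tr X == 0.

Lemma traceless_submod_closed (C : numClosedFieldType) :
  submod_closed (@traceless C).
Proof.
split=> [|a X Y]; rewrite !unfold_in ?mxtrace0 // => /eqP hX /eqP hY.
by rewrite mxtraceD mxtraceZ hX hY mulr0 addr0.
Qed.

HB.instance Definition _ (C : numClosedFieldType) :=
  GRing.isSubmodClosed.Build C 'M[C]_2 (@traceless C)
    (@traceless_submod_closed C).

Record sl2 (C : numClosedFieldType) : Type :=
  Sl2 { sl2_mx :> 'M[C]_2; _ : sl2_mx \in @traceless C }.

HB.instance Definition _ (C : numClosedFieldType) :=
  [isSub for @sl2_mx C].
HB.instance Definition _ (C : numClosedFieldType) :=
  [Choice of sl2 C by <:].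
HB.instance Definition _ (C : numClosedFieldType) :=
  [SubChoice_isSubLmodule of sl2 C by <:].

Definition SL2 (C : numClosedFieldType) : set 'M[C]_2 :=
  [set g | \det g = 1].

(* [insubd] only retypes the conjugate as an element of [sl2 C]; its default
   value is never used when [g] is invertible, see [Ad_mxE]. *)
Definition Ad (C : numClosedFieldType) (g : 'M[C]_2) (X : sl2 C) : sl2 C :=
  insubd X (g *m X *m invmx g).

Lemma Ad_mxE (C : numClosedFieldType) (g : 'M[C]_2) (X : sl2 C) :
  g \in unitmx -> Ad g X = g *m X *m invmx g :> 'M[C]_2.
Proof.
move=> gU; rewrite /Ad insubdK //; change (\tr (g *m X *m invmx g) == 0).
by rewrite mxtrace_mulC mulmxA mulVmx // mul1mx; case: X.
Qed.

(* SL_2 is a closed complex submanifold of the space of 2 x 2 matrices, so a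
   map on it is holomorphic near [g0] iff it is the restriction of a map that
   is complex differentiable on a neighbourhood of [g0] in that space.  Only
   the values of [Psi] on SL_2 matter. *)
Definition holomorphic_extension (C : numClosedFieldType) (d : nat)
    (Psi : 'M[C]_2 -> 'M[C]_d) (g0 : 'M[C]_2) (F : 'M[C]_2 -> 'M[C]_d) : Prop :=
  \forall g \near g0, differentiable F g /\ (SL2 g -> F g = Psi g).

Definition is_holomorphic_rep (C : numClosedFieldType) (d : nat)
    (Psi : 'M[C]_2 -> 'M[C]_d) : Prop :=
  [/\ Psi 1%:M = 1%:M,
      forall g h, SL2 g -> SL2 h -> Psi (g *m h) = Psi g *m Psi h &
      forall g0, SL2 g0 -> exists F, holomorphic_extension Psi g0 F].

Definition is_irreducible_rep (C : numClosedFieldType) (d : nat)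
    (Psi : 'M[C]_2 -> 'M[C]_d) : Prop :=
  (0 < d)%N /\
  forall U : {vspace 'cV[C]_d},
    (forall g v, SL2 g -> v \in U -> Psi g *m v \in U) ->
    U = 0%VS \/ U = fullv.

(* The tangent space of SL_2 at the identity is sl_2, and the differential of
   [Psi] there is the restriction to it of that of any holomorphic extension. *)
Definition is_tangent_rep (C : numClosedFieldType) (d : nat)
    (Psi : 'M[C]_2 -> 'M[C]_d) (rho : sl2 C -> 'M[C]_d) : Prop :=
  exists2 F, holomorphic_extension Psi 1%:M F &
    forall X : sl2 C, rho X = 'd F (1%:M : 'M[C]_2) (X : 'M[C]_2).

Definition coords (C : numClosedFieldType) (m : nat) (X : 'I_m -> sl2 C) :
    'I_#|{: 'I_m * 'I_2 * 'I_2}| -> C :=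
  fun l => let: (k, i, j) := enum_val l in (X k : 'M[C]_2) i j.

(* Polynomials (resp. forms) on the subspace of m-tuples of traceless matrices
   are the restrictions of polynomials (resp. forms) in all 4m entries. *)
Definition poly_fun (C : numClosedFieldType) (m : nat)
    (f : ('I_m -> sl2 C) -> C) : Prop :=
  exists p : mpoly.mpoly #|{: 'I_m * 'I_2 * 'I_2}| C,
    forall X, f X = mpoly.meval (coords X) p.

Definition homog_fun (C : numClosedFieldType) (m n : nat)
    (f : ('I_m -> sl2 C) -> C) : Prop :=
  exists2 p : mpoly.mpoly #|{: 'I_m * 'I_2 * 'I_2}| C,
    p \is mpoly.ishomog1 n mpoly.mdeg &
    forall X, f X = mpoly.meval (coords X) p.

Definition poly_map (C : numClosedFieldType) (m d : nat)
    (F : ('I_m -> sl2 C) -> 'M[C]_d) : Prop :=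
  forall i j, poly_fun (fun X => F X i j).

Definition homog_map (C : numClosedFieldType) (m d n : nat)
    (F : ('I_m -> sl2 C) -> 'M[C]_d) : Prop :=
  forall i j, homog_fun n (fun X => F X i j).

Definition invariants (C : numClosedFieldType) (m : nat) :
    set (('I_m -> sl2 C) -> C^o) :=
  [set f | poly_fun f /\
     forall g X, SL2 g -> f (fun k => Ad g (X k)) = f X].

Definition pos_invariants (C : numClosedFieldType) (m : nat) :
    set (('I_m -> sl2 C) -> C^o) :=
  lspan [set f | invariants f /\ exists2 n, (0 < n)%N & homog_fun n f].

Definition covariants (C : numClosedFieldType) (m d : nat)
    (Psi : 'M[C]_2 -> 'M[C]_d) : set (('I_m -> sl2 C) -> 'M[C]_d) :=
  [set F | poly_map F /\
     forall g X, SL2 g ->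
       F (fun k => Ad g (X k)) = Psi g *m F X *m invmx (Psi g)].

Definition inv_scale (C : numClosedFieldType) (m d : nat)
    (f : ('I_m -> sl2 C) -> C^o) (F : ('I_m -> sl2 C) -> 'M[C]_d) :
    ('I_m -> sl2 C) -> 'M[C]_d :=
  fun X => f X *: F X.

Definition pos_covariants (C : numClosedFieldType) (m d : nat)
    (Psi : 'M[C]_2 -> 'M[C]_d) : set (('I_m -> sl2 C) -> 'M[C]_d) :=
  lspan [set inv_scale f F | f in @pos_invariants C m & F in covariants Psi].

Definition is_inv_submodule (C : numClosedFieldType) (m d : nat)
    (W : set (('I_m -> sl2 C) -> 'M[C]_d)) : Prop :=
  [/\ W 0, forall F G, W F -> W G -> W (F + G) &
      forall f F, invariants f -> W F -> W (inv_scale f F)].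

Definition inv_span (C : numClosedFieldType) (m d : nat)
    (B : set (('I_m -> sl2 C) -> 'M[C]_d)) :
    set (('I_m -> sl2 C) -> 'M[C]_d) :=
  smallest (@is_inv_submodule C m d) B.

Definition minimally_generates (C : numClosedFieldType) (m d : nat)
    (Psi : 'M[C]_2 -> 'M[C]_d) (B : set (('I_m -> sl2 C) -> 'M[C]_d)) : Prop :=
  inv_span B = covariants Psi /\
  forall B', B' `<=` B -> inv_span B' = covariants Psi -> B' = B.

Definition is_homog_basis (C : numClosedFieldType) (m d : nat)
    (W B : set (('I_m -> sl2 C) -> 'M[C]_d)) : Prop :=
  is_basis W B /\ forall F, B F -> exists n, homog_map n F.

(* The first conjunct says that [W] is graded and keeps the second one from
   being vacuous. *)
Definition minimally_generated_by (C : numClosedFieldType) (m d : nat)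
    (Psi : 'M[C]_2 -> 'M[C]_d) (W : set (('I_m -> sl2 C) -> 'M[C]_d)) : Prop :=
  (exists B, is_homog_basis W B) /\
  forall B, is_homog_basis W B -> minimally_generates Psi B.

Definition right_mul (C : numClosedFieldType) (m : nat)
    (X : 'I_m -> sl2 C) (g : 'M[C]_m) : 'I_m -> sl2 C :=
  fun j => \sum_i g i j *: X i.

Definition gl_act (C : numClosedFieldType) (m d : nat) (g : 'M[C]_m)
    (F : ('I_m -> sl2 C) -> 'M[C]_d) : ('I_m -> sl2 C) -> 'M[C]_d :=
  fun X => F (right_mul X g).

Definition is_gl_submodule (C : numClosedFieldType) (m d : nat)
    (W : set (('I_m -> sl2 C) -> 'M[C]_d)) : Prop :=
  is_subspace W /\
  forall (g : 'M[C]_m) F, g \in unitmx -> W F -> W (gl_act g F).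

Definition gl_gen (C : numClosedFieldType) (m d : nat)
    (F : ('I_m -> sl2 C) -> 'M[C]_d) : set (('I_m -> sl2 C) -> 'M[C]_d) :=
  smallest (@is_gl_submodule C m d) [set F].

Definition is_gl_irreducible (C : numClosedFieldType) (m d : nat)
    (W : set (('I_m -> sl2 C) -> 'M[C]_d)) : Prop :=
  [/\ is_gl_submodule W, W <> [set 0] &
      forall U, is_gl_submodule U -> U `<=` W -> U = [set 0] \/ U = W].

Definition upper_unipotent (C : numClosedFieldType) (m : nat)
    (g : 'M[C]_m) : Prop :=
  forall i j : 'I_m, (j <= i)%N -> g i j = (i == j)%:R.

(* [lam] is padded with zeros to length [m]. *)
Definition has_highest_weight (C : numClosedFieldType) (m d : nat)
    (W : set (('I_m -> sl2 C) -> 'M[C]_d)) (lam : seq nat) : Prop :=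
  exists F, [/\ W F, F <> 0,
    forall g, upper_unipotent g -> gl_act g F = F &
    forall z : 'rV[C]_m, (forall i, z 0 i != 0) ->
      gl_act (diag_mx z) F = (\prod_(i < m) z 0 i ^+ nth 0%N lam i) *: F].

Definition is_irreducible_of_weight (C : numClosedFieldType) (m d : nat)
    (Psi : 'M[C]_2 -> 'M[C]_d) (W : set (('I_m -> sl2 C) -> 'M[C]_d))
    (lam : seq nat) : Prop :=
  [/\ W `<=` covariants Psi, is_gl_irreducible W & has_highest_weight W lam].

Definition tmap (C : numClosedFieldType) (m d : nat)
    (rho : sl2 C -> 'M[C]_d) (i : 'I_m) : ('I_m -> sl2 C) -> 'M[C]_d :=
  fun X => rho (X i).

(* Products and powers are those of the ring of functions with values in
   ['M[C]_d], i.e. pointwise matrix products, with [t ^+ 0] the constant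
   identity matrix. *)
Definition tpow (C : numClosedFieldType) (m d : nat)
    (t1 : ('I_m -> sl2 C) -> 'M[C]_d) (s : nat) : ('I_m -> sl2 C) -> 'M[C]_d :=
  t1 ^+ s.

Definition tcomm (C : numClosedFieldType) (m d : nat)
    (t1 t2 : ('I_m -> sl2 C) -> 'M[C]_d) (s : nat) :
    ('I_m -> sl2 C) -> 'M[C]_d :=
  t1 ^+ s.-1 * (t1 * t2 - t2 * t1).

(* The summands <t1^(s-1)[t1,t2]>, 1 <= s <= d-1, are indexed by k = s-1. *)
Definition gen_summand (C : numClosedFieldType) (m d : nat)
    (t1 t2 : ('I_m -> sl2 C) -> 'M[C]_d) (x : 'I_d + 'I_d.-1) :
    set (('I_m -> sl2 C) -> 'M[C]_d) :=
  match x with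
  | inl s => gl_gen (tpow t1 s)
  | inr k => gl_gen (tcomm t1 t2 k.+1)
  end.

Definition all_summands (C : numClosedFieldType) (m d : nat)
    (Psi : 'M[C]_2 -> 'M[C]_d) (t1 t2 : ('I_m -> sl2 C) -> 'M[C]_d)
    (x : option ('I_d + 'I_d.-1)) : set (('I_m -> sl2 C) -> 'M[C]_d) :=
  if x is Some y then gen_summand t1 t2 y else pos_covariants Psi.

(* Main.v *)
Require Import Defs.
From mathcomp Require Import all_boot all_order all_algebra.
From mathcomp Require Import boolp classical_sets functions reals.
From mathcomp Require Import topology normedtype derive realfun.
From mathcomp Require Import complex.
From mathcomp Require Import ring zify.
From mathcomp Require mpoly.
Import -(notations) mpoly.

Set Implicit Arguments.
Unset Strict Implicit.
Unset Printing Implicit Defensive.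

Import Order.TTheory GRing.Theory Num.Theory.
Import numFieldNormedType.Exports.

Local Open Scope classical_set_scope.
Local Open Scope ring_scope.

(** Let [N(v)] be the nilpotent traceless matrix [v v^T J] attached to a vector
    [v] of [C^2] ([nilp]).  The symbol of order [k] of a map [F] from tuples of
    traceless matrices to [d x d] matrices is the function
    [(X, v) |-> tr (F(X) rho(N(v))^k)] ([symb]).  The whole proof compares
    covariants through their symbols of orders [0, ..., d - 1].

    Representation theory.  The derivative [rho] of [Psi] is a representation
    of the Lie algebra without invariant subspaces, hence it is conjugate to
    the explicit one with weights [d - 1, d - 3, ..., 1 - d] ([rho_std]).  Two
    consequences are used.  The powers of the matrices [rho(N(v))] of exponent
    less than [d] span all matrices ([nilp_powers_span]), so that a map is
    determined by its symbols.  The trace of a product of [j <= k] matrices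
    [rho(w)] against [rho(N(v))^k] is zero if [j < k], and a nonzero multiple of
    the product of the numbers [tr (w N(v))] if [j = k < d] ([trace_rho]).

    Generation.  The symbol of order [k] of a covariant is an invariant of [m]
    traceless matrices and a vector, of degree [2 k] in the vector.  Put
    [tau_c = tr (X_c N(v))] and [sigma_{c,e} = tr ([X_c, X_e] N(v))], where [X_c]
    is the combination of the [X_i] with coefficients [c].  Such invariants are
    combinations, with coefficients in the invariants of the matrices, of
    products of [k] factors [tau], one of which may be replaced by a factor
    [sigma] ([invariant_cov_span]); this comes from a Casimir identity
    ([casimir]), by induction on the degrees.  By polarisation, and by the
    Pluecker relation between [tau] and [sigma], the products [tau_c^k] and
    [tau_c^(k-1) sigma_{c,e}] suffice; up to nonzero scalars they are the
    symbols of order [k] of [rho(X_c)^k] and [rho(X_c)^(k-1) rho([X_c, X_e])],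
    all symbols of higher order of which vanish.  Subtracting the symbols one
    after the other from the highest order downwards, one finds that these maps
    generate the module of covariants ([covariants_inv_span]).

    The summands.  The [GL_m]-module generated by [t_1^s] is the span of the
    maps [rho(X_c)^s], and that generated by [t_1^s [t_1, t_2]] is the span of
    the maps [rho(X_c)^s rho([X_c, X_e])].  Limits of the action of invertible
    matrices give the action of singular ones; a suitable one of rank at most
    two maps a given nonzero element to a nonzero multiple of the generator, up
    to terms that disappear in a limit.  Hence both modules are irreducible
    ([gl_gen_fam_irreducible]).

    Directness.  There is no nonzero invariant of degree one, so the symbol of
    order [k] of an element of [D_0^+ C] vanishes at [X = 0] to order [k + 2].
    In a relation between the summands and [D_0^+ C], let [k] be the highest
    order of a summand that is involved.  In the symbols of order [k] only two
    summands contribute, generated by [t_1^k] and [t_1^(k-1) [t_1, t_2]], whose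
    symbols are homogeneous in [X] of degrees [k] and [k + 1]; hence these
    symbols are zero, and by irreducibility they determine the elements.  This
    gives the directness of the sum ([summands_direct]).  Since every invariant
    is a constant plus an element of [D_0^+], a submodule of the covariants is
    modulo [D_0^+ C] the linear span of its generators ([inv_span_split]); this
    gives both the decomposition and the minimality of homogeneous bases. *)

(** * Interpolation and polarisation *)

Lemma is_subspace_sum (C : fieldType) (E : lmodType C) (U : set E)
    (I : Type) (r : seq I) (P : pred I) (f : I -> E) :
  is_subspace U -> (forall i, P i -> U (f i)) -> U (\sum_(i <- r | P i) f i).
Proof.
move=> [U0 UD] Uf; elim/big_ind: _ => // x y Ux Uy.
by rewrite -[x]scale1r; apply: UD.
Qed.

Lemma is_subspaceZ (C : fieldType) (E : lmodType C) (U : set E) a x :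
  is_subspace U -> U x -> U (a *: x).
Proof. by move=> [U0 UD] Ux; rewrite -[_ *: _]addr0; apply: UD. Qed.

Lemma is_subspaceD (C : fieldType) (E : lmodType C) (U : set E) x y :
  is_subspace U -> U x -> U y -> U (x + y).
Proof. by move=> [U0 UD] Ux Uy; rewrite -[x]scale1r; apply: UD. Qed.

Lemma is_subspaceN (C : fieldType) (E : lmodType C) (U : set E) x :
  is_subspace U -> U x -> U (- x).
Proof. by move=> hU Ux; rewrite -scaleN1r; apply: is_subspaceZ. Qed.

Lemma is_subspaceB (C : fieldType) (E : lmodType C) (U : set E) x y :
  is_subspace U -> U x -> U y -> U (x - y).
Proof. by move=> hU Ux Uy; apply: is_subspaceD => //; apply: is_subspaceN. Qed.

(** The coefficient functionals on polynomials of size at most [N] are linear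
    combinations of evaluations at points that avoid a given finite set. *)
Lemma coef_eval_weights (C : numFieldType) (N k : nat) (bad : seq C) :
  exists z w : 'I_N -> C, (forall j, z j \notin bad) /\
    forall e, (e < N)%N -> \sum_j w j * z j ^+ e = (e == k)%:R.
Proof.
pose s := [seq x <- [seq i%:R | i <- iota 0 (N + size bad)] | x \notin bad] : seq C.
have us : uniq s.
  rewrite filter_uniq // map_inj_uniq ?iota_uniq // => i j /eqP.
  by rewrite eqr_nat => /eqP.
have ss : (N <= size s)%N.
  rewrite -(leq_add2r (size bad)) -[X in (X <= _)%N](size_iota 0).
  rewrite -(size_map (fun i => i%:R : C)) /s -(count_predC (mem bad)).
  rewrite addnC leq_add // ?size_filter // -size_filter.
  apply: uniq_leq_size; last by move=> x; rewrite mem_filter => /andP[].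
  rewrite filter_uniq // map_inj_uniq ?iota_uniq // => i j /eqP.
  by rewrite eqr_nat => /eqP.
(* The weights are the entries of an inverse Vandermonde matrix. *)
pose z (j : 'I_N) := nth 0 s j.
have zs j : z j \in s by rewrite mem_nth // (leq_trans (ltn_ord j)).
pose V := Vandermonde N (\row_j z j).
have Vu : V \in unitmx.
  rewrite unitmxE unitfE det_Vandermonde; apply/prodf_neq0 => i _.
  apply/prodf_neq0 => j ij; rewrite !mxE subr_eq0 nth_uniq //.
  - by rewrite neq_ltn ij orbT.
  - exact: leq_trans (ltn_ord j) ss.
  - exact: leq_trans (ltn_ord i) ss.
have [kN|Nk] := ltnP k N; last first.
  exists z, (fun=> 0); split=> [j|e eN].
    by have := zs j; rewrite mem_filter => /andP[].
  rewrite big1 ?(ltn_eqF (leq_trans eN Nk)) // => j _; exact: mul0r.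
exists z, (fun j => invmx V j (Ordinal kN)); split=> [j|e eN].
  by have := zs j; rewrite mem_filter => /andP[].
have := congr1 (fun M : 'M_N => M (Ordinal eN) (Ordinal kN)) (mulmxV Vu).
rewrite !mxE => <-; apply: eq_bigr => j _.
by rewrite !mxE mulrC.
Qed.

Lemma subspace_coef (C : numFieldType) (E : lmodType C) (U : set E)
    (N : nat) (A : 'I_N -> E) (bad : seq C) :
  is_subspace U -> (forall z, z \notin bad -> U (\sum_(e < N) z ^+ e *: A e)) ->
  forall e, U (A e).
Proof.
move=> hU UA k; have [z [w [zbad hw]]] := coef_eval_weights N k bad.
suff -> : A k = \sum_j w j *: \sum_(e < N) z j ^+ e *: A e.
  by apply: is_subspace_sum => // j _; apply: is_subspaceZ => //; apply: UA.
under eq_bigr do rewrite scaler_sumr.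
rewrite exchange_big /= (bigD1 k) //= [X in _ + X]big1 => [|e ek].
  under eq_bigr do rewrite scalerA.
  by rewrite -scaler_suml hw // eqxx scale1r addr0.
under eq_bigr do rewrite scalerA.
rewrite -scaler_suml hw // (_ : (e == k :> nat) = false) ?scale0r //.
exact: negbTE.
Qed.

Lemma subspace_coef_poly (C : numFieldType) (T : Type) (U : set (T -> C^o))
    (N : nat) (P : T -> {poly C}) (bad : seq C) :
  is_subspace U -> (forall t, size (P t) <= N)%N ->
  (forall z, z \notin bad -> U (fun t => (P t).[z])) ->
  forall k, U (fun t => (P t)`_k).
Proof.
move=> hU sP UP k; have [kN|Nk] := ltnP k N; last first.
  rewrite (_ : (fun _ => _) = 0); first by case: hU.
  by apply/funext => t; rewrite nth_default // (leq_trans (sP t)).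
pose A (e : 'I_N) : T -> C^o := fun t => (P t)`_e.
apply: (@subspace_coef C (T -> C^o) U N A bad hU _ (Ordinal kN)) => z /UP.
congr U; apply/funext => t; rewrite (horner_coef_wide _ (sP t)) fct_sumE.
by apply: eq_bigr => i _; rewrite mulrC.
Qed.

Lemma fct_lcombE (C : pzRingType) (T : Type) (a : C) (x y : T -> C^o) t :
  (a *: x + y) t = a * x t + y t.
Proof. by []. Qed.

Lemma fct_lcombBE (C : pzRingType) (T : Type) (a : C) (x y : T -> C^o) t :
  (a *: x - y) t = a * x t - y t.
Proof. by []. Qed.

Lemma size_linear_poly (C : nzRingType) (a b : C) :
  (size (a%:P + b *: 'X)%R <= 2)%N.
Proof.
rewrite (leq_trans (size_polyD _ _)) // geq_max; apply/andP; split.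
  by rewrite (leq_trans (size_polyC_leq1 _)).
by rewrite (leq_trans (size_scale_leq _ _)) // size_polyX.
Qed.

Lemma size_linear_poly_exp (C : nzRingType) (a b : C) n :
  (size ((a%:P + b *: 'X) ^+ n)%R <= n.+1)%N.
Proof.
rewrite (leq_trans (size_poly_exp_leq _ _)) // ltnS -{2}[n]mul1n leq_mul //.
by have := size_linear_poly a b; case: (size _) => [|[|[]]].
Qed.

Lemma coef1_deriv (C : nzRingType) (p : {poly C}) : p`_1 = p^`().[0].
Proof. by rewrite horner_coef0 coef_deriv. Qed.

Lemma deriv_linear_poly (C : nzRingType) (a b : C) :
  (a%:P + b *: 'X)^`() = b%:P.
Proof. by rewrite derivD derivC add0r derivZ derivX alg_polyC. Qed.

(** Polarisation: a subspace of functions that contains the [s]-th powers of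
    all members of a linear family contains all products of [s] members. *)
Lemma polarize_powers (C : numFieldType) (V : lmodType C) (T : Type)
    (tau : V -> T -> C) (U : set (T -> C^o)) (s : nat) :
  (forall a x y t, tau (a *: x + y) t = a * tau x t + tau y t) ->
  is_subspace U -> (forall c, U (fun t => tau c t ^+ s)) ->
  forall cs, size cs = s -> U (fun t => \prod_(c <- cs) tau c t).
Proof.
move=> tauL hU Us.
(* The factors are introduced one at a time, as derivatives of powers. *)
suff H cs j c : (size cs + j)%N = s ->
    U (fun t => tau c t ^+ j * \prod_(c <- cs) tau c t).
  move=> cs scs; have := H cs 0%N 0; rewrite addn0 => /(_ scs).
  by congr U; apply/funext => t; rewrite expr0 mul1r.
elim: cs j c => [|d cs IH] j c /= sj.
  rewrite add0n in sj; rewrite sj; have := Us c; congr U; apply/funext => t.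
  by rewrite big_nil mulr1.
have {}IH c' : U (fun t => tau c' t ^+ j.+1 * \prod_(c <- cs) tau c t).
  by apply: IH; rewrite addnS -addSn.
pose P t := ((tau c t)%:P + tau d t *: 'X) ^+ j.+1
   * (\prod_(c <- cs) tau c t)%:P.
have sP t : (size (P t) <= j.+2)%N.
  rewrite (leq_trans (size_polyMleq _ _)) // -ltnS.
  have := size_linear_poly_exp (tau c t) (tau d t) j.+1.
  have := size_polyC_leq1 (\prod_(c <- cs) tau c t).
  move=> h1 h2; have := leq_add h2 h1; rewrite addn1.
  by case: (_ + _)%N => [|n].
have UP z : z \notin [::] -> U (fun t => (P t).[z]).
  move=> _; have := IH (z *: d + c); congr U; apply/funext => t.
  by rewrite /P !hornerE tauL mulrC addrC mulrC [z * _]mulrC.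
have := subspace_coef_poly hU sP UP 1%N => /(is_subspaceZ (j.+1%:R^-1) hU).
congr U; apply/funext => t; rewrite /GRing.scale /= coef1_deriv /P.
rewrite derivM derivC mulr0 addr0 deriv_exp deriv_linear_poly /= big_cons.
rewrite !hornerE hornerMn !hornerE /= ?mulr0 ?addr0.
have : j.+1%:R != 0 :> C by rewrite pnatr_eq0.
set p := \prod_(_ <- _) _; rewrite mulrnAl [in LHS]/GRing.scale /=.
set k := j.+1%:R => k0; rewrite -mulr_natl -/k mulKf //.
by rewrite [tau c t ^+ j * _]mulrC.
Qed.

(** The polarisation principle for products [tau_c ^ s * sigma_{c,e}] with
    [sigma] alternating bilinear, when [tau] and [sigma] satisfy the Pluecker
    relation. *)
Lemma polarize_wedge (C : numFieldType) (V : lmodType C) (T : Type)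
    (tau : V -> T -> C) (sigma : V -> V -> T -> C) (U : set (T -> C^o))
    (s : nat) :
  (forall a x y t, tau (a *: x + y) t = a * tau x t + tau y t) ->
  (forall a x y z t, sigma (a *: x + y) z t = a * sigma x z t + sigma y z t) ->
  (forall x y t, sigma x y t = - sigma y x t) ->
  (forall x y z t, tau x t * sigma y z t + tau y t * sigma z x t
     + tau z t * sigma x y t = 0) ->
  is_subspace U ->
  (forall c e, U (fun t => tau c t ^+ s * sigma c e t)) ->
  forall cs d e, size cs = s ->
    U (fun t => \prod_(c <- cs) tau c t * sigma d e t).
Proof.
move=> tauL sigL sigA pl hU Us.
suff H c d e : U (fun t => tau c t ^+ s * sigma d e t).
  move=> cs d e; pose U' : set (T -> C^o) := [set f | U (fun t => f t * sigma d e t)].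
  apply: (@polarize_powers C V T tau U' s tauL) => [|c]; last exact: H.
  split=> [|a x y Ux Uy]; rewrite /U' /=.
    rewrite (_ : (fun _ => _) = 0); first by case: hU.
    by apply/funext => t; rewrite mul0r.
  have := hU.2 a _ _ Ux Uy; congr U; apply/funext => t.
  by rewrite !fct_lcombE mulrDl mulrA.
case: s Us => [|k] Us.
  have := Us d e; congr U; apply/funext => t; by rewrite !expr0.
(* Derivative of [tau_{c'} ^ k.+1 * sigma_{c',e'}] in the direction [x]. *)
have H1 x c' e' : U (fun t => k.+1%:R * tau c' t ^+ k * tau x t * sigma c' e' t
                       + tau c' t ^+ k.+1 * sigma x e' t).
  pose P t := ((tau c' t)%:P + tau x t *: 'X) ^+ k.+1
     * ((sigma c' e' t)%:P + sigma x e' t *: 'X).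
  have sP t : (size (P t) <= k.+3)%N.
    rewrite (leq_trans (size_polyMleq _ _)) // -ltnS.
    have h1 := size_linear_poly_exp (tau c' t) (tau x t) k.+1.
    have h2 := size_linear_poly (sigma c' e' t) (sigma x e' t).
    by have := leq_add h1 h2; rewrite addn2; case: (_ + _)%N.
  have UP z : z \notin [::] -> U (fun t => (P t).[z]).
    move=> _; have := Us (z *: x + c') e'; congr U; apply/funext => t.
    rewrite /P tauL sigL !hornerE /= ![z * _]mulrC.
    by rewrite [_ * z + tau c' t]addrC [_ * z + sigma c' e' t]addrC.
  have := subspace_coef_poly hU sP UP 1%N.
  congr U; apply/funext => t; rewrite coef1_deriv /P.
  rewrite derivM deriv_exp !deriv_linear_poly /=.
  rewrite !hornerE hornerMn !hornerE /= ?mulr0 ?addr0.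
  by rewrite -mulr_natl; ring.
pose A x y := (fun t => tau c t ^+ k * tau x t * sigma c y t) : T -> C^o.
have H2 x y : U (k.+2%:R *: A x y - A y x).
  have := H1 x c y; congr U; apply/funext => t.
  rewrite fct_lcombBE /A.
  have := pl c y x t; rewrite (sigA x c) => h.
  have -> : tau c t ^+ k.+1 * sigma x y t =
     tau c t ^+ k * (tau x t * sigma c y t - tau y t * sigma c x t).
    rewrite exprS (sigA x); apply/eqP; rewrite -subr_eq0; apply/eqP.
    transitivity (- tau c t ^+ k * 0); last by rewrite mulr0.
    by rewrite -h; ring.
  by rewrite -[k.+2]addn1 -[k.+1]addn1 !natrD; ring.
(* The relations [H2 x y] and [H2 y x] have determinant [(k + 2)^2 - 1]. *)
have UA x y : U (A x y).
  have k0 : (k.+2%:R ^+ 2 - 1 : C) != 0.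
    rewrite subr_eq0 -natrX -[1]/(1%:R) eqr_nat; by case: (k).
  have := is_subspaceD hU (is_subspaceZ k.+2%:R hU (H2 x y)) (H2 y x).
  move=> /(is_subspaceZ (k.+2%:R ^+ 2 - 1)^-1 hU); congr U.
  rewrite scalerBr scalerA addrA -[_ - _ + _]addrA.
  rewrite [- _ + _]addrC subrr addr0 -expr2.
  rewrite (_ : _ - A x y = (k.+2%:R ^+ 2 - 1) *: A x y).
    by rewrite scalerA mulVf // scale1r.
  by rewrite scalerBl scale1r.
have := is_subspaceB hU (UA d e) (UA e d); congr U; apply/funext => t.
rewrite -[RHS]mul1r -[A d e]scale1r fct_lcombBE /A !mul1r.
have := pl c d e t; rewrite (sigA e c) => h.
apply/eqP; rewrite -subr_eq0; apply/eqP.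
transitivity (- tau c t ^+ k * 0); last by rewrite mulr0.
by rewrite -h exprS; ring.
Qed.

(** * Evaluation of multivariate polynomials *)

Lemma mpoly_ring_ind (n : nat) (R : comNzRingType) (Q : mpoly.mpoly n R -> Prop) :
  (forall c, Q (mpolyC n c)) -> (forall i, Q (mpolyX R (mnm1 i))) ->
  (forall p q, Q p -> Q q -> Q (p + q)) ->
  (forall p q, Q p -> Q q -> Q (p * q)) -> forall p, Q p.
Proof.
move=> QC QX QD QM; elim/mpolyind => [|c m p _ _ Qp].
  by rewrite -mpolyC0.
apply: (QD) => //; rewrite -mul_mpolyC; apply: (QM) => //.
rewrite mpolyXE_id; elim/big_rec: _ => [|i q _ Qq]; first by rewrite -mpolyC1.
apply: (QM) => //; elim: (m i) => [|k IH]; first by rewrite expr0 -mpolyC1.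
by rewrite exprS; apply: (QM).
Qed.

Lemma mderivXU (n : nat) (R : comNzRingType) (i j : 'I_n) :
  mderiv i (mpolyX R (mnm1 j)) = (i == j)%:R.
Proof.
rewrite mderivX mnm1E eq_sym; have [->|_] := eqVneq i j; last by rewrite scale0r.
rewrite scale1r (_ : mnm_sub _ _ = mnm0) ?mpolyX0 //.
by apply/mnmP => k; rewrite mnmBE subnn mnm0E.
Qed.

Lemma horner_mmap (n : nat) (C : comNzRingType) (g : 'I_n -> {poly C}) p z :
  (mmap polyC g p).[z] = meval (fun i => (g i).[z]) p.
Proof.
elim/mpoly_ring_ind: p => [c|i|p q Hp Hq|p q Hp Hq].
- by rewrite mmapC mevalC hornerC.
- by rewrite mmapX mmap1U mevalXU.
- by rewrite mmapD mevalD hornerD Hp Hq.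
- by rewrite rmorphM mevalM hornerM Hp Hq.
Qed.

Lemma deriv_mmap (n : nat) (C : comNzRingType) (g : 'I_n -> {poly C}) p :
  (mmap polyC g p)^`() = \sum_i (g i)^`() * mmap polyC g (mderiv i p).
Proof.
elim/mpoly_ring_ind: p => [c|i|p q Hp Hq|p q Hp Hq].
- rewrite mmapC derivC big1 // => i _.
  by rewrite mderivC mmap0 mulr0.
- rewrite mmapX mmap1U (bigD1 i) //= big1 => [|j ji].
    by rewrite mderivXU eqxx rmorph1 mulr1 addr0.
  by rewrite mderivXU (negbTE ji) mmap0 mulr0.
- rewrite mmapD derivD Hp Hq -big_split; apply: eq_bigr => i _.
  by rewrite mderivD mmapD mulrDr.
- rewrite rmorphM derivM Hp Hq mulr_suml mulr_sumr -big_split.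
  apply: eq_bigr => i _ /=; rewrite mderivM mmapD !rmorphM /=; ring.
Qed.

Lemma horner_inj (C : numFieldType) (p q : {poly C}) :
  (forall z, p.[z] = q.[z]) -> p = q.
Proof.
move=> h; apply/eqP; rewrite -subr_eq0; apply/eqP.
have h0 z : (p - q).[z] = 0 by rewrite hornerD hornerN h subrr.
apply: (@roots_geq_poly_eq0 _ _ [seq i%:R | i <- iota 0 (size (p - q))]).
- by apply/allP => x _; rewrite /root h0.
- by rewrite map_inj_uniq ?iota_uniq // => i j /eqP; rewrite eqr_nat => /eqP.
- by rewrite size_map size_iota.
Qed.

Lemma mderiv_meval0 (n : nat) (C : numFieldType) (p : mpoly.mpoly n C) i :
  (forall v, meval v p = 0) -> forall v, meval v (mderiv i p) = 0.
Proof.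
move=> p0 v; pose g (j : 'I_n) : {poly C} := (v j)%:P + (i == j)%:R *: 'X.
have g0 : mmap polyC g p = 0.
  by apply: horner_inj => z; rewrite horner_mmap horner0 p0.
have := congr1 (fun P : {poly C} => P.[0]) (deriv_mmap g p).
rewrite g0 deriv0 horner0 horner_sum (bigD1 i) //= big1 => [|j ji].
  rewrite addr0 hornerM horner_mmap /g derivD derivC add0r derivZ derivX eqxx.
  rewrite scale1r hornerC mul1r => /esym; rewrite -[RHS]/0 => <-.
  by apply: meval_eq => j; rewrite !hornerE.
rewrite hornerM /g derivD derivC add0r derivZ derivX eq_sym (negbTE ji).
by rewrite scale0r horner0 mul0r.
Qed.

Lemma meval_eq0 (n : nat) (C : numFieldType) (p : mpoly.mpoly n C) :
  (forall v, meval v p = 0) -> p = 0.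
Proof.
move=> p0; apply/mpolyP => m; rewrite mcoeff0.
have h v : meval v (mderivm m p) = 0.
  rewrite mderivm_foldr; elim: (flatten _) v => //= i s IH.
  exact: mderiv_meval0.
have := h (fun=> 0); rewrite (mpolyE (mderivm m p)) raddf_sum /=.
have e0 k : meval (fun=> 0 : C) (mpolyX C k) = (k == mnm0)%:R.
  rewrite mevalX; have [->|k0] := eqVneq k mnm0.
    by apply: big1 => i _; rewrite mnm0E expr0.
  have [i ki] : exists i, k i != 0%N.
    apply/existsP; rewrite -negb_forall; apply: contra k0 => /forallP k0.
    by apply/eqP/mnmP => i; rewrite mnm0E; apply/eqP; have := k0 i; case: eqP.
  by rewrite (bigD1 i) //= expr0n (negbTE ki) mul0r.
under eq_bigr do rewrite mevalZ e0.
have -> : \sum_(k <- msupp (mderivm m p)) mcoeff k (mderivm m p) * (k == mnm0)%:R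
   = mcoeff mnm0 (mderivm m p).
  have [s0|s0] := boolP (mnm0 \in msupp (mderivm m p)).
    rewrite (bigD1_seq mnm0) ?msupp_uniq //= eqxx mulr1 big1 ?addr0 // => k k0.
    by rewrite (negbTE k0) mulr0.
  rewrite (memN_msupp_eq0 s0) big_seq big1 // => k ks.
  have -> : (k == mnm0) = false by apply: contraNF s0 => /eqP <-.
  by rewrite mulr0.
rewrite mcoeff_mderivm addm0 => /eqP; rewrite mulrn_eq0 => /orP[|/eqP //].
by rewrite eqn0Ngt prodn_gt0 // => i; rewrite ffactnn fact_gt0.
Qed.

(** * Infinitesimal invariants and the Casimir identity *)

Section CovariantRing.
Variables (C : numClosedFieldType) (m : nat).

(** The coordinates on [m] copies of [sl_2] and one copy of [C^2]: the tuple of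
    matrices [[x_k, y_k], [w_k, - x_k]] and the vector [(v_0, v_1)]. *)
Definition cvar : finType := ('I_m + ('I_m + ('I_m + bool)))%type.
Definition jx (k : 'I_m) : cvar := inl k.
Definition jy (k : 'I_m) : cvar := inr (inl k).
Definition jw (k : 'I_m) : cvar := inr (inr (inl k)).
Definition jv (b : bool) : cvar := inr (inr (inr b)).

(** The ring of polynomials in these coordinates. *)
Definition cring := mpoly.mpoly #|cvar| C.
Definition pvar (j : cvar) : cring := mpolyX C (mnm1 (enum_rank j)).
Definition pder (j : cvar) (p : cring) : cring := mderiv (enum_rank j) p.

Lemma sum_cvar (V : nmodType) (F : cvar -> V) :
  \sum_j F j = \sum_k (F (jx k) + F (jy k) + F (jw k))
               + (F (jv false) + F (jv true)).
Proof.
rewrite big_sumType /= big_sumType /= big_sumType /= big_bool /=.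
by rewrite !big_split /= [F (jv false) + _]addrC !addrA.
Qed.

Lemma pder_var i j : pder i (pvar j) = (i == j)%:R.
Proof. by rewrite /pder /pvar mderivXU (inj_eq enum_rank_inj). Qed.

Lemma pderD j p q : pder j (p + q) = pder j p + pder j q. Proof. exact: mderivD. Qed.
Lemma pderM j p q : pder j (p * q) = pder j p * q + p * pder j q.
Proof. exact: mderivM. Qed.
Lemma pder_comm i j p : pder i (pder j p) = pder j (pder i p).
Proof. exact: mderiv_comm. Qed.
Lemma pder_sum j (I : Type) (r : seq I) (P : pred I) (F : I -> cring) :
  pder j (\sum_(i <- r | P i) F i) = \sum_(i <- r | P i) pder j (F i).
Proof. exact: (raddf_sum (mderiv (enum_rank j))). Qed.
Lemma pderZ j c p : pder j (c *: p) = c *: pder j p. Proof. exact: mderivZ. Qed.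
Lemma pderMn j n p : pder j (p *+ n) = pder j p *+ n. Proof. exact: mderivMn. Qed.
Lemma pderN j p : pder j (- p) = - pder j p. Proof. exact: mderivN. Qed.

(** The derivation with coefficients [xi]. *)
Definition pvec (xi : cvar -> cring) (p : cring) : cring :=
  \sum_j xi j * pder j p.

Lemma pvec_comm xi i p :
  pvec xi (pder i p) = pder i (pvec xi p) - \sum_j pder i (xi j) * pder j p.
Proof.
apply/eqP; rewrite eq_sym subr_eq; apply/eqP; rewrite pder_sum -big_split; apply: eq_bigr => j _.
by rewrite pderM addrC pder_comm.
Qed.

Lemma pvecD xi p q : pvec xi (p + q) = pvec xi p + pvec xi q.
Proof. by rewrite -big_split; apply: eq_bigr => j _; rewrite pderD mulrDr. Qed.
Lemma pvecZ xi c p : pvec xi (c *: p) = c *: pvec xi p.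
Proof. by rewrite scaler_sumr; apply: eq_bigr => j _; rewrite pderZ scalerAr. Qed.
Lemma pvecN xi p : pvec xi (- p) = - pvec xi p.
Proof. by rewrite -scaleN1r pvecZ scaleN1r. Qed.
Lemma pvecMn xi p n : pvec xi (p *+ n) = pvec xi p *+ n.
Proof. by rewrite -scaler_nat pvecZ scaler_nat. Qed.

(** The coefficients of the vector fields of the infinitesimal actions of [E],
    [F] and [H], and of the Euler vector fields in the matrices and in the
    vector. *)
Definition xiE (j : cvar) : cring :=
  match j with
  | inl k => pvar (jw k)
  | inr (inl k) => - (pvar (jx k) *+ 2)
  | inr (inr (inl _)) => 0
  | inr (inr (inr b)) => if b then 0 else pvar (jv true)
  end.

Definition xiF (j : cvar) : cring :=
  match j with
  | inl k => - pvar (jy k)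
  | inr (inl k) => 0
  | inr (inr (inl k)) => pvar (jx k) *+ 2
  | inr (inr (inr b)) => if b then pvar (jv false) else 0
  end.

Definition xiH (j : cvar) : cring :=
  match j with
  | inl k => 0
  | inr (inl k) => pvar (jy k) *+ 2
  | inr (inr (inl k)) => - (pvar (jw k) *+ 2)
  | inr (inr (inr b)) => if b then - pvar (jv true) else pvar (jv false)
  end.

Definition xiX (j : cvar) : cring := if j is inr (inr (inr b)) then 0 else pvar j.
Definition xiV (j : cvar) : cring := if j is inr (inr (inr b)) then pvar j else 0.

Local Notation LE := (pvec xiE).
Local Notation LF := (pvec xiF).
Local Notation LH := (pvec xiH).
Local Notation EX := (pvec xiX).
Local Notation EV := (pvec xiV).

Lemma sum_delta (k : 'I_m) (F : 'I_m -> cring) :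
  \sum_i (k == i)%:R * F i = F k.
Proof.
rewrite (bigD1 k) //= eqxx mul1r big1 ?addr0 // => i ik.
by rewrite eq_sym (negbTE ik) mul0r.
Qed.

Lemma pder_x k j : pder (jx k) (pvar j) = (if j is inl k' then (k == k')%:R else 0).
Proof. by rewrite pder_var; case: j => [?|[?|[?|?]]]. Qed.
Lemma pder_y k j :
  pder (jy k) (pvar j) = (if j is inr (inl k') then (k == k')%:R else 0).
Proof. by rewrite pder_var; case: j => [?|[?|[?|?]]]. Qed.
Lemma pder_w k j :
  pder (jw k) (pvar j) = (if j is inr (inr (inl k')) then (k == k')%:R else 0).
Proof. by rewrite pder_var; case: j => [?|[?|[?|?]]]. Qed.
Lemma pder_v b j :
  pder (jv b) (pvar j) = (if j is inr (inr (inr b')) then (b == b')%:R else 0).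
Proof. by rewrite pder_var; case: j => [?|[?|[?|?]]]. Qed.
Lemma pder0 j : pder j 0 = 0. Proof. exact: raddf0. Qed.

Lemma mulr2nA (a b : cring) : (a *+ 2) * b = (a * b) *+ 2.
Proof. exact: mulrnAl. Qed.

Definition pderE := (pder_x, pder_y, pder_w, pder_v, pderN, pderMn, pder0,
  mul0r, mulr0, mulNr, mulr2nA, addr0, add0r, mul0rn, oppr0, sumrN, sumrMnl).

Ltac comm_tac := rewrite pvec_comm; congr (_ + _); rewrite sum_cvar /=;
  under eq_bigr do rewrite !pderE /=; rewrite ?big1_eq !pderE /= ?mul1r ?sum_delta ?addr0 ?add0r
    ?oppr0 //.

(** The commutators of these derivations with the partial derivatives. *)
Lemma LE_x k p : LE (pder (jx k) p) = pder (jx k) (LE p) - (- (pder (jy k) p *+ 2)).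
Proof. comm_tac. Qed.
Lemma LE_y k p : LE (pder (jy k) p) = pder (jy k) (LE p) - 0.
Proof. comm_tac. Qed.
Lemma LE_w k p : LE (pder (jw k) p) = pder (jw k) (LE p) - pder (jx k) p.
Proof. comm_tac. Qed.
Lemma LE_v b p : LE (pder (jv b) p)
  = pder (jv b) (LE p) - (if b then pder (jv false) p else 0).
Proof. case: b; comm_tac. Qed.
Lemma LF_x k p : LF (pder (jx k) p) = pder (jx k) (LF p) - pder (jw k) p *+ 2.
Proof. comm_tac. Qed.
Lemma LF_y k p : LF (pder (jy k) p) = pder (jy k) (LF p) - (- pder (jx k) p).
Proof. comm_tac. Qed.
Lemma LF_w k p : LF (pder (jw k) p) = pder (jw k) (LF p) - 0.
Proof. comm_tac. Qed.
Lemma LF_v b p : LF (pder (jv b) p)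
  = pder (jv b) (LF p) - (if b then 0 else pder (jv true) p).
Proof. case: b; comm_tac. Qed.
Lemma EX_x k p : EX (pder (jx k) p) = pder (jx k) (EX p) - pder (jx k) p.
Proof. comm_tac. Qed.
Lemma EX_y k p : EX (pder (jy k) p) = pder (jy k) (EX p) - pder (jy k) p.
Proof. comm_tac. Qed.
Lemma EX_w k p : EX (pder (jw k) p) = pder (jw k) (EX p) - pder (jw k) p.
Proof. comm_tac. Qed.
Lemma EX_v b p : EX (pder (jv b) p) = pder (jv b) (EX p) - 0.
Proof. comm_tac. Qed.
Lemma EV_x k p : EV (pder (jx k) p) = pder (jx k) (EV p) - 0.
Proof. comm_tac. Qed.
Lemma EV_y k p : EV (pder (jy k) p) = pder (jy k) (EV p) - 0.
Proof. comm_tac. Qed.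
Lemma EV_w k p : EV (pder (jw k) p) = pder (jw k) (EV p) - 0.
Proof. comm_tac. Qed.
Lemma EV_v b p : EV (pder (jv b) p) = pder (jv b) (EV p) - pder (jv b) p.
Proof. case: b; comm_tac. Qed.

Lemma pvec_var xi j : pvec xi (pvar j) = xi j.
Proof.
rewrite /pvec (bigD1 j) //= pder_var eqxx mulr1 big1 ?addr0 // => i ij.
by rewrite pder_var (negbTE ij) mulr0.
Qed.

Lemma pvec_bracket xi eta p :
  pvec xi (pvec eta p) - pvec eta (pvec xi p)
  = \sum_j (pvec xi (eta j) - pvec eta (xi j)) * pder j p.
Proof.
have H a b : pvec a (pvec b p) = \sum_j pvec a (b j) * pder j p
     + \sum_i \sum_j a i * b j * pder i (pder j p).
  rewrite {1}/pvec; under eq_bigr do rewrite pder_sum mulr_sumr.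
  under [X in _ = X + _]eq_bigr do rewrite /pvec mulr_suml.
  rewrite [X in _ = X + _]exchange_big -big_split; apply: eq_bigr => i _.
  rewrite -big_split; apply: eq_bigr => j _ /=.
  by rewrite pderM; ring.
rewrite !H opprD addrACA [X in _ + X = _](_ : _ = 0) ?addr0.
  by rewrite -sumrB; apply: eq_bigr => j _; rewrite mulrBl.
apply/eqP; rewrite subr_eq0 exchange_big; apply/eqP.
apply: eq_bigr => i _; apply: eq_bigr => j _; rewrite pder_comm; ring.
Qed.

Lemma LH_bracket p : LH p = LF (LE p) - LE (LF p).
Proof.
have h0 xi : pvec xi 0 = 0 by rewrite -(scale0r 0) pvecZ !scale0r.
rewrite pvec_bracket; apply: eq_bigr => j _; congr (_ * _).
case: j => [k|[k|[k|[]]]] /=; rewrite ?(pvecN, pvecMn, pvec_var, h0) /=.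
- by rewrite opprK subrr.
- by rewrite mulNrn opprK subr0.
- by rewrite sub0r.
- by rewrite sub0r.
- by rewrite subr0.
Qed.

(** The pair [(f1, f2)] stands for the function [a_0 f1 + a_1 f2] of an
    additional vector [a], and is infinitesimally [SL_2]-invariant as such. *)
Definition inv_pair (f1 f2 : cring) : Prop :=
  [/\ LE f1 = 0, LE f2 = - f1, LF f1 = - f2 & LF f2 = 0].

(** The contractions of the invariant pair with the derivatives with respect
    to the [k]-th matrix and to the vector; the former is again an invariant
    pair, the latter an invariant. *)
Definition capX1 k f1 f2 : cring := pder (jx k) f1 + pder (jy k) f2 *+ 2.
Definition capX2 k f1 f2 : cring := pder (jw k) f1 *+ 2 - pder (jx k) f2.
Definition capV f1 f2 : cring := pder (jv true) f1 - pder (jv false) f2.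

Lemma pvec0 xi : pvec xi 0 = 0.
Proof. by rewrite -(scale0r 0) pvecZ !scale0r. Qed.

Lemma inv_pair_capX k f1 f2 :
  inv_pair f1 f2 -> inv_pair (capX1 k f1 f2) (capX2 k f1 f2).
Proof.
move=> [E1 E2 F1 F2]; rewrite /capX1 /capX2; split;
rewrite ?(pvecD, pvecN, pvecMn) ?(LE_x, LE_y, LE_w, LF_x, LF_y, LF_w)
  ?(E1, E2, F1, F2) ?(pderN, pder0); ring.
Qed.

Lemma capV_inv f1 f2 :
  inv_pair f1 f2 -> LE (capV f1 f2) = 0 /\ LF (capV f1 f2) = 0.
Proof.
move=> [E1 E2 F1 F2]; rewrite /capV; split;
rewrite pvecD pvecN ?(LE_v, LF_v) ?(E1, E2, F1, F2) ?(pderN, pder0); ring.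
Qed.

Lemma sum_comb (F1 F2 F3 F4 F5 : 'I_m -> cring) r1 r2 r3 r4 r5 :
  (forall k, - (F1 k *+ 2) + F2 k + F3 k *+ 2 + F4 k = F5 k *+ 2) ->
  - (r1 *+ 2) + r2 + r3 *+ 2 + r4 = r5 *+ 2 ->
  - ((\sum_k F1 k + r1) *+ 2) + (\sum_k F2 k + r2) + (\sum_k F3 k + r3) *+ 2
    + (\sum_k F4 k + r4) = (\sum_k F5 k + r5) *+ 2.
Proof.
move=> hF hr; rewrite [RHS]mulrnDl -hr -sumrMnl -(eq_bigr _ (fun k _ => hF k)).
rewrite !big_split /= sumrN !sumrMnl; ring.
Qed.

(** The Casimir operator acts on an invariant pair by a scalar, which
    expresses the pair by its contractions. *)
Lemma casimir f1 f2 (n p : nat) : inv_pair f1 f2 ->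
  EX f1 = n%:R *: f1 -> EX f2 = n%:R *: f2 ->
  EV f1 = p%:R *: f1 -> EV f2 = p%:R *: f2 ->
  (3 + n * 2 + p)%N%:R *: f1 = (\sum_k (pvar (jx k) * capX1 k f1 f2
     + pvar (jw k) * capX2 k f1 f2) + pvar (jv true) * capV f1 f2) *+ 2 /\
  (3 + n * 2 + p)%N%:R *: f2 = (\sum_k (pvar (jy k) * capX1 k f1 f2
     - pvar (jx k) * capX2 k f1 f2) - pvar (jv false) * capV f1 f2) *+ 2.
Proof.
move=> [E1 E2 F1 F2] EX1 EX2 EV1 EV2.
(* Invariance and homogeneity write the left-hand sides as combinations of
   the vector fields, whose coefficients are then compared with those on the
   right. *)
have H1 : LH f1 = - f1 by rewrite LH_bracket E1 F1 pvecN E2 pvec0 sub0r opprK.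
have H2 : LH f2 = f2 by rewrite LH_bracket E2 F2 pvecN F1 pvec0 subr0 opprK.
have -> : (3 + n * 2 + p)%N%:R *: f1
    = - (LE f2 *+ 2) - LH f1 + EX f1 *+ 2 + EV f1.
  rewrite E2 H1 EX1 EV1 !scaler_nat !mulrnDr mulrnA.
  by set a := f1 *+ n; set b := f1 *+ p; ring.
have -> : (3 + n * 2 + p)%N%:R *: f2
    = - (LF f1 *+ 2) + LH f2 + EX f2 *+ 2 + EV f2.
  rewrite F1 H2 EX2 EV2 !scaler_nat !mulrnDr mulrnA.
  by set a := f2 *+ n; set b := f2 *+ p; ring.
rewrite -pvecN /pvec !sum_cvar /capX1 /capX2 /capV /=.
by split; apply: sum_comb => [k|]; rewrite ?pderN; ring.
Qed.

End CovariantRing.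

(** * Traceless two by two matrices *)

Section SL2Basics.
Variable C : numClosedFieldType.
Implicit Types (X Y Z : sl2 C) (g h : 'M[C]_2) (v a b : 'cV[C]_2).

Lemma sum_ord2 (V : nmodType) (F : 'I_2 -> V) : \sum_i F i = F 0 + F 1.
Proof. by rewrite !big_ord_recl big_ord0 addr0; congr (_ + F _); apply: val_inj. Qed.

Lemma ord2_ind (Q : 'I_2 -> Prop) : Q 0 -> Q 1 -> forall i, Q i.
Proof.
move=> Q0 Q1 [[|[|//]] hi].
  by rewrite (_ : Ordinal hi = 0) //; apply: val_inj.
by rewrite (_ : Ordinal hi = 1) //; apply: val_inj.
Qed.

Lemma mx2P (A B : 'M[C]_2) : A 0 0 = B 0 0 -> A 0 1 = B 0 1 -> A 1 0 = B 1 0 ->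
  A 1 1 = B 1 1 -> A = B.
Proof. by move=> *; apply/matrixP; elim/ord2_ind; elim/ord2_ind. Qed.

Lemma mulmx2E n (A : 'M[C]_2) (B : 'M[C]_(2, n)) i j :
  (A *m B) i j = A i 0 * B 0 j + A i 1 * B 1 j.
Proof. by rewrite mxE sum_ord2. Qed.

Lemma tr2E (A : 'M[C]_2) : \tr A = A 0 0 + A 1 1.
Proof. by rewrite /mxtrace sum_ord2. Qed.

Lemma subE (A B : 'M[C]_2) i j : (A - B) i j = A i j - B i j.
Proof. by rewrite !mxE. Qed.

Lemma addmxE2 (A B : 'M[C]_2) i j : (A + B) i j = A i j + B i j.
Proof. by rewrite mxE. Qed.

Lemma scalemxE2 (c : C) (A : 'M[C]_2) i j : (c *: A) i j = c * A i j.
Proof. by rewrite mxE. Qed.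

Lemma sl2P X Y : (X : 'M[C]_2) = Y -> X = Y.
Proof. exact: val_inj. Qed.

Lemma sl2_11 X : (X : 'M[C]_2) 1 1 = - (X : 'M[C]_2) 0 0.
Proof.
case: X => X /= hX; have /eqP : \tr X == 0 := hX.
by rewrite tr2E addrC => /eqP; rewrite addr_eq0 => /eqP.
Qed.

Lemma sl2DE X Y : sl2_mx (X + Y) = sl2_mx X + sl2_mx Y. Proof. by []. Qed.
Lemma sl2ZE (c : C) X : sl2_mx (c *: X) = c *: sl2_mx X. Proof. by []. Qed.
Lemma sl2NE X : sl2_mx (- X) = - sl2_mx X. Proof. by []. Qed.
Lemma sl20E : sl2_mx (0 : sl2 C) = 0. Proof. by []. Qed.
Lemma sl2_sumE (I : Type) (r : seq I) (P : pred I) (F : I -> sl2 C) :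
  sl2_mx (\sum_(i <- r | P i) F i) = \sum_(i <- r | P i) sl2_mx (F i).
Proof. by elim/big_rec2: _ => // i x y _ <-. Qed.

Lemma traceless_bracket X Y : (X *m Y - Y *m X : 'M[C]_2) \in @traceless C.
Proof.
change (\tr ((X : 'M_2) *m Y - (Y : 'M_2) *m X) == 0).
by rewrite raddfB /= mxtrace_mulC subrr.
Qed.

(** The commutator, as a traceless matrix. *)
Definition bracket X Y : sl2 C := Sl2 (traceless_bracket X Y).

Lemma bracketE X Y : sl2_mx (bracket X Y) = sl2_mx X *m sl2_mx Y - sl2_mx Y *m sl2_mx X.
Proof. by []. Qed.

(** The traceless matrix with first row [(x, y)] and lower left entry [w]. *)
Definition sl2_of (x y w : C) : 'M[C]_2 :=
  \matrix_(i, j) if i == 0 then if j == 0 then x else y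
                 else if j == 0 then w else - x.

Lemma sl2_of_traceless x y w : sl2_of x y w \in @traceless C.
Proof. by change (\tr (sl2_of x y w) == 0); rewrite tr2E !mxE /= subrr. Qed.

Definition mksl2 x y w : sl2 C := Sl2 (sl2_of_traceless x y w).

Lemma mksl2E x y w : ((mksl2 x y w : 'M_2) 0 0 = x) * ((mksl2 x y w : 'M_2) 0 1 = y)
  * ((mksl2 x y w : 'M_2) 1 0 = w) * ((mksl2 x y w : 'M_2) 1 1 = - x).
Proof. by rewrite !mxE. Qed.

(** The standard basis of [sl_2]. *)
Definition sl2E := mksl2 0 1 0.
Definition sl2F := mksl2 0 0 1.
Definition sl2H := mksl2 1 0 0.

Lemma sl2_decomp X : X = (X : 'M_2) 0 0 *: sl2H + (X : 'M_2) 0 1 *: sl2E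
   + (X : 'M_2) 1 0 *: sl2F.
Proof.
apply/sl2P/mx2P; rewrite !(sl2DE, sl2ZE) !mxE /= ?sl2_11; ring.
Qed.

Lemma SL2_unit g : SL2 g -> g \in unitmx.
Proof. by rewrite /SL2 /= unitmxE => ->; exact: unitr1. Qed.

Lemma SL2_mul g h : SL2 g -> SL2 h -> SL2 (g *m h).
Proof. by rewrite /SL2 /= det_mulmx => -> ->; rewrite mulr1. Qed.

Lemma det2E g : \det g = g 0 0 * g 1 1 - g 0 1 * g 1 0.
Proof.
rewrite (expand_det_row _ 0) sum_ord2 /cofactor !det_mx11 !mxE /=.
rewrite expr0 expr1 mul1r mulN1r mulrN; congr (_ * g _ _ - _ * g _ _); exact: val_inj.
Qed.

Lemma invmx2E g : SL2 g -> [/\ invmx g 0 0 = g 1 1, invmx g 0 1 = - g 0 1,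
   invmx g 1 0 = - g 1 0 & invmx g 1 1 = g 0 0].
Proof.
move=> hg; pose k : 'M[C]_2 := \matrix_(i, j) if i == 0 then if j == 0 then g 1 1 else - g 0 1
                 else if j == 0 then - g 1 0 else g 0 0.
have dg : g 0 0 * g 1 1 - g 0 1 * g 1 0 = 1 by rewrite -det2E.
have gk : g *m k = 1%:M.
  by apply: mx2P; rewrite mulmx2E !mxE /= -?dg; ring.
have -> : invmx g = k by rewrite -[LHS]mulmx1 -gk mulKmx // SL2_unit.
by rewrite !mxE.
Qed.

(** The elementary unipotent matrices. *)
Definition uE z : 'M[C]_2 := 1%:M + z *: (sl2E : 'M_2).
Definition uF z : 'M[C]_2 := 1%:M + z *: (sl2F : 'M_2).

Lemma uEE z : ((uE z 0 0 = 1) * (uE z 0 1 = z) * (uE z 1 0 = 0) * (uE z 1 1 = 1))%type.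
Proof. by rewrite !mxE /= ?mulr0 ?mulr1 ?add0r ?addr0 ?oppr0 ?mulr0 ?addr0. Qed.
Lemma uFE z : ((uF z 0 0 = 1) * (uF z 0 1 = 0) * (uF z 1 0 = z) * (uF z 1 1 = 1))%type.
Proof. by rewrite !mxE /= ?mulr0 ?mulr1 ?add0r ?addr0 ?oppr0 ?mulr0 ?addr0. Qed.

Lemma SL2_uE z : SL2 (uE z). Proof. by rewrite /SL2 /= det2E !uEE; ring. Qed.
Lemma SL2_uF z : SL2 (uF z). Proof. by rewrite /SL2 /= det2E !uFE; ring. Qed.

(** [SL_2] is generated by its elementary unipotent matrices. *)
Lemma SL2_ind (Q : 'M[C]_2 -> Prop) : (forall z, Q (uE z)) -> (forall z, Q (uF z)) ->
  (forall g h, SL2 g -> SL2 h -> Q g -> Q h -> Q (g *m h)) ->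
  forall g, SL2 g -> Q g.
Proof.
move=> QE QF QM.
have H g : SL2 g -> g 1 0 != 0 -> Q g.
  move=> hg c0; have dg : g 0 0 * g 1 1 - g 0 1 * g 1 0 = 1 by rewrite -det2E.
  have -> : g = uE ((g 0 0 - 1) / g 1 0) *m uF (g 1 0) *m uE ((g 1 1 - 1) / g 1 0).
    have e01 : g 0 1 = (g 0 0 * g 1 1 - 1) / g 1 0.
      by rewrite -dg; field.
    apply: mx2P; rewrite !mulmx2E !uEE !uFE ?e01; field => //.
  apply: (QM); [|exact: SL2_uE| |exact: QE].
    by apply: SL2_mul; [exact: SL2_uE|exact: SL2_uF].
  by apply: (QM); [exact: SL2_uE|exact: SL2_uF|exact: QE|exact: QF].
move=> g hg; have [c0|] := eqVneq (g 1 0) 0; last exact: H.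
have dg : g 0 0 * g 1 1 = 1 by rewrite -[RHS](hg : \det g = 1) det2E c0; ring.
have d0 : g 1 1 != 0.
  by apply/eqP => d0; move/eqP: dg; rewrite d0 mulr0 eq_sym oner_eq0.
have -> : g = g *m uF 1 *m uF (-1).
  by apply: mx2P; rewrite !mulmx2E !uFE; ring.
have h1 : SL2 (g *m uF 1) by apply: SL2_mul => //; exact: SL2_uF.
apply: QM => //; first exact: SL2_uF.
by apply: H => //; rewrite mulmx2E !uFE c0 mul0r add0r mulr1.
Qed.

Lemma AdE g X : SL2 g -> Ad g X = g *m X *m invmx g :> 'M[C]_2.
Proof. by move=> /SL2_unit; exact: Ad_mxE. Qed.

Lemma Ad_mul g h X : SL2 g -> SL2 h -> Ad (g *m h) X = Ad g (Ad h X).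
Proof.
move=> hg hh; apply/sl2P; rewrite !AdE //; last exact: SL2_mul.
have -> : invmx (g *m h) = invmx h *m invmx g.
  have e : g *m h *m (invmx h *m invmx g) = 1%:M.
    by rewrite mulmxA mulmxK ?SL2_unit // mulmxV ?SL2_unit.
  by rewrite -[LHS]mulmx1 -e mulKmx // SL2_unit //; exact: SL2_mul.
by rewrite !mulmxA.
Qed.

Lemma Ad_lin g (c : C) X Y : SL2 g -> Ad g (c *: X + Y) = c *: Ad g X + Ad g Y.
Proof.
move=> hg; apply/sl2P; rewrite AdE // !(sl2DE, sl2ZE).
rewrite !AdE //.
by rewrite mulmxDr mulmxDl -scalemxAr -scalemxAl.
Qed.

Lemma Ad_bracket g X Y : SL2 g -> Ad g (bracket X Y) = bracket (Ad g X) (Ad g Y).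
Proof.
move=> hg; apply/sl2P; rewrite AdE // !bracketE !AdE //.
by rewrite mulmxBr mulmxBl !mulmxA !mulmxKV ?SL2_unit.
Qed.

Lemma Ad_tr g X Y : SL2 g -> \tr ((Ad g X : 'M_2) *m Ad g Y) = \tr ((X : 'M_2) *m Y).
Proof.
move=> hg; rewrite !AdE // !mulmxA mulmxKV ?SL2_unit //.
by rewrite mxtrace_mulC !mulmxA mulVmx ?SL2_unit // mul1mx.
Qed.

(** The symplectic form on [C^2], and the nilpotent matrix [v v^T J]
    attached to a vector. *)
Definition symp a b : C := a 0 0 * b 1 0 - a 1 0 * b 0 0.
Definition nilp v : sl2 C :=
  mksl2 (- (v 0 0 * v 1 0)) (v 0 0 ^+ 2) (- v 1 0 ^+ 2).

Lemma symp_nilp X v : symp ((X : 'M_2) *m v) v = - \tr ((X : 'M_2) *m nilp v).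
Proof.
rewrite /symp tr2E !mulmx2E !mksl2E sl2_11; ring.
Qed.

Lemma Ad_nilp g v : SL2 g -> Ad g (nilp v) = nilp (g *m v).
Proof.
move=> hg; have [i00 i01 i10 i11] := invmx2E hg.
apply/sl2P/mx2P; rewrite AdE // !mulmx2E !mksl2E !mulmx2E ?i00 ?i01 ?i10 ?i11; ring.
Qed.

Lemma nilp_e0 : nilp (delta_mx 0 0) = sl2E.
Proof. by apply/sl2P/mx2P; rewrite !mksl2E !mxE /=; ring. Qed.

Lemma SL2_transitive v : v != 0 -> exists2 g, SL2 g & v = g *m delta_mx 0 0.
Proof.
move=> v0.
have [a0|a0] := eqVneq (v 0 0) 0.
  have b0 : v 1 0 != 0.
    apply: contra v0 => /eqP b0; apply/eqP/matrixP => i j; rewrite ord1 mxE.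
    by elim/ord2_ind: i.
  exists (\matrix_(i, j) if j == 0 then v i 0 else if i == 0 then - (v 1 0)^-1 else 0).
    by rewrite /SL2 /= det2E !mxE /= a0; field.
  by apply/matrixP => i j; rewrite ord1 mulmx2E !mxE /=; ring.
exists (\matrix_(i, j) if j == 0 then v i 0 else if i == 0 then 0 else (v 0 0)^-1).
  by rewrite /SL2 /= det2E !mxE /=; field.
by apply/matrixP => i j; rewrite ord1 mulmx2E !mxE /=; ring.
Qed.

(** The symmetric part of a product of traceless matrices is scalar. *)
Lemma sl2_mul_sym X Y : (X : 'M[C]_2) *m Y
  = (2%:R^-1 * \tr ((X : 'M_2) *m Y))%:M + 2%:R^-1 *: (bracket X Y : 'M_2).
Proof.
by apply: mx2P; rewrite bracketE tr2E !mxE !sum_ord2 /= !sl2_11; field.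
Qed.

Lemma bracket_bracket X Y Z : bracket (bracket X Y) Z =
  (\tr ((Y : 'M_2) *m Z) *+ 2) *: X - (\tr ((X : 'M_2) *m Z) *+ 2) *: Y.
Proof.
apply/sl2P/mx2P; rewrite !(bracketE, sl2DE, sl2ZE, sl2NE) !tr2E !mxE !sum_ord2 /= !mxE !sum_ord2
  !sl2_11; ring.
Qed.

(** A Gram determinant identity: on null vectors, the product of two triple
    products is a combination of pairings. *)
Lemma gram_nilp (X Y Z W : sl2 C) v : let t A := \tr ((A : 'M_2) *m nilp v) in
  let f A B := \tr ((A : 'M_2) *m (B : 'M_2)) in
  t (bracket X Y) * t (bracket Z W) =
   (f X Z * t Y * t W - f X W * t Y * t Z - f Y Z * t X * t W + f Y W * t X * t Z) *+ 2.
Proof.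
move=> t f; rewrite /t /f !tr2E !mulmx2E !mksl2E !bracketE !subE !mulmx2E !sl2_11.
ring.
Qed.

(** The Pluecker relation on null vectors. *)
Lemma pluecker_nilp (X Y Z : sl2 C) v : let t A := \tr ((A : 'M_2) *m nilp v) in
  t X * t (bracket Y Z) + t Y * t (bracket Z X) + t Z * t (bracket X Y) = 0.
Proof.
move=> t; rewrite /t !tr2E !mulmx2E !mksl2E !bracketE !subE !mulmx2E !sl2_11.
ring.
Qed.

End SL2Basics.

(** * Polynomial functions of several traceless matrices *)

Section PolynomialFunctions.
Variables (C : numClosedFieldType) (m : nat).
Implicit Types (X : 'I_m -> sl2 C) (f : ('I_m -> sl2 C) -> C).

Lemma poly_fun_const (c : C) : poly_fun (fun _ : 'I_m -> sl2 C => c).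
Proof. by exists (mpolyC _ c) => X; rewrite mevalC. Qed.

Lemma poly_funD f f' : poly_fun f -> poly_fun f' -> poly_fun (fun X => f X + f' X).
Proof. by move=> [p hp] [q hq]; exists (p + q) => X; rewrite mevalD hp hq. Qed.

Lemma poly_funM f f' : poly_fun f -> poly_fun f' -> poly_fun (fun X => f X * f' X).
Proof. by move=> [p hp] [q hq]; exists (p * q) => X; rewrite mevalM hp hq. Qed.

Lemma poly_fun_sum (I : Type) (r : seq I) (P : pred I) (F : I -> ('I_m -> sl2 C) -> C) :
  (forall i, P i -> poly_fun (F i)) -> poly_fun (fun X => \sum_(i <- r | P i) F i X).
Proof.
move=> hF; rewrite (_ : (fun _ => _) = \sum_(i <- r | P i) (F i : _ -> C^o)).
  elim/big_ind: _ => //; [exact: poly_fun_const|exact: poly_funD].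
by apply/funext => X; rewrite fct_sumE.
Qed.

Lemma poly_fun_entry k i j : poly_fun (fun X => (X k : 'M[C]_2) i j).
Proof.
exists (mpolyX C (mnm1 (enum_rank (k, i, j)))) => X.
by rewrite mevalXU /coords enum_rankK.
Qed.

Lemma homog_poly n f : homog_fun n f -> poly_fun f.
Proof. by move=> [p _ hp]; exists p. Qed.

Lemma homog_fun_const (c : C) : homog_fun 0 (fun _ : 'I_m -> sl2 C => c).
Proof.
exists (mpolyC _ c) => [|X]; last by rewrite mevalC.
by rewrite -[mpolyC _ c]mulr1 mul_mpolyC; apply: rpredZ; exact: dhomog1.
Qed.

Lemma homog_fun0 n : homog_fun n (fun _ : 'I_m -> sl2 C => 0).
Proof. by exists 0 => [|X]; [exact: rpred0|rewrite meval0]. Qed.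

Lemma homog_funD n f f' : homog_fun n f -> homog_fun n f' -> homog_fun n (fun X => f X + f' X).
Proof.
move=> [p pn hp] [q qn hq]; exists (p + q) => [|X]; first exact: rpredD.
by rewrite mevalD hp hq.
Qed.

Lemma homog_funM n n' f f' : homog_fun n f -> homog_fun n' f' ->
  homog_fun (n + n') (fun X => f X * f' X).
Proof.
move=> [p pn hp] [q qn hq]; exists (p * q) => [|X]; first exact: dhomogM.
by rewrite mevalM hp hq.
Qed.

Lemma homog_funZ n (c : C) f : homog_fun n f -> homog_fun n (fun X => c * f X).
Proof. by have := homog_funM (homog_fun_const c) => /[apply]. Qed.

Lemma homog_fun_sum n (I : Type) (r : seq I) (P : pred I) (F : I -> ('I_m -> sl2 C) -> C) :
  (forall i, P i -> homog_fun n (F i)) -> homog_fun n (fun X => \sum_(i <- r | P i) F i X).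
Proof.
move=> hF; rewrite (_ : (fun _ => _) = \sum_(i <- r | P i) (F i : _ -> C^o)).
  elim/big_ind: _ => //; [exact: homog_fun0|exact: homog_funD].
by apply/funext => X; rewrite fct_sumE.
Qed.

Lemma homog_fun_entry k i j : homog_fun 1 (fun X => (X k : 'M[C]_2) i j).
Proof.
exists (mpolyX C (mnm1 (enum_rank (k, i, j)))) => [|X].
  by rewrite dhomogX /= mdeg1.
by rewrite mevalXU /coords enum_rankK.
Qed.

Lemma homog_fun_scale n f z X : homog_fun n f ->
  f (fun k => z *: X k) = z ^+ n * f X.
Proof.
move=> [p /dhomogP pn hp]; rewrite !hp !mevalE mulr_sumr.
apply: eq_big_seq => mm /pn <-.
rewrite mulrCA; congr (_ * _); rewrite [X in z ^+ X]mdegE -prodrXr -big_split.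
apply: eq_bigr => l _ /=; rewrite -exprMn; congr (_ ^+ _).
by rewrite /coords; case: (enum_val l) => [[k i] j]; rewrite sl2ZE mxE.
Qed.

(** Every polynomial function is a sum of forms. *)
Lemma poly_fun_homog f : poly_fun f -> exists (N : nat) (F : nat -> ('I_m -> sl2 C) -> C),
  (forall n, homog_fun n (F n)) /\ forall X, f X = \sum_(n < N) F n X.
Proof.
move=> [p hp]; exists (mmeasure mdeg p), (fun n X => meval (coords X) (pihomog mdeg n p)).
split=> [n|X]; first by exists (pihomog mdeg n p) => //; exact: pihomogP.
by rewrite hp [in LHS](pihomog_partitionE (leqnn (mmeasure mdeg p))) raddf_sum.
Qed.

(** The combination of the matrices with coefficient vector [c]. *)
Definition comb X (c : 'cV[C]_m) : sl2 C := \sum_k c k 0 *: X k.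

Lemma comb_lin X (a : C) c d : comb X (a *: c + d) = a *: comb X c + comb X d.
Proof.
rewrite /comb scaler_sumr -big_split; apply: eq_bigr => k _.
by rewrite !mxE scalerDl scalerA.
Qed.

Lemma comb_scale X (a : C) c : comb X (a *: c) = a *: comb X c.
Proof.
rewrite /comb scaler_sumr; apply: eq_bigr => k _.
by rewrite !mxE scalerA.
Qed.

Lemma comb_delta X k : comb X (delta_mx k 0) = X k.
Proof.
rewrite /comb (bigD1 k) //= !mxE !eqxx scale1r big1 ?addr0 // => i ik.
by rewrite mxE (negbTE ik) scale0r.
Qed.

Lemma Ad_comb g X c : SL2 g -> comb (fun k => Ad g (X k)) c = Ad g (comb X c).
Proof.
move=> hg; rewrite /comb.
have Ad0 : Ad g 0 = 0 by apply/sl2P; rewrite AdE // sl20E mulmx0 mul0mx.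
elim/big_rec2: _ => [|k x y _ ->]; first by rewrite Ad0.
by rewrite Ad_lin.
Qed.

Lemma homog_fun_comb c i j : homog_fun 1 (fun X => (comb X c : 'M[C]_2) i j).
Proof.
rewrite (_ : (fun _ => _) = (fun X => \sum_k c k 0 * (X k : 'M_2) i j)).
  apply: homog_fun_sum => k _; apply: homog_funZ; exact: homog_fun_entry.
by apply/funext => X; rewrite /comb sl2_sumE summxE; apply: eq_bigr => k _; rewrite sl2ZE mxE.
Qed.

(** The invariants [tr (X_c X_d)]. *)
Definition pairing (c d : 'cV[C]_m) : ('I_m -> sl2 C) -> C^o :=
  fun X => \tr ((comb X c : 'M_2) *m (comb X d : 'M_2)).

Lemma homog_fun_pairing c d : homog_fun 2 (pairing c d).
Proof.
rewrite (_ : pairing c d = fun X => \sum_i \sum_j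
   (comb X c : 'M_2) i j * (comb X d : 'M_2) j i).
  apply: homog_fun_sum => i _; apply: homog_fun_sum => j _.
  by apply: (@homog_funM 1 1); exact: homog_fun_comb.
by apply/funext => X; apply: eq_bigr => i _; rewrite mxE.
Qed.

Lemma invariants_pairing c d : invariants (pairing c d).
Proof.
split; first exact: homog_poly (homog_fun_pairing c d).
by move=> g X hg; rewrite /pairing !Ad_comb // Ad_tr.
Qed.

Lemma invariants_const (c : C) : invariants (fun _ : 'I_m -> sl2 C => c : C^o).
Proof. by split=> //; exact: poly_fun_const. Qed.

Lemma invariantsD (f f' : ('I_m -> sl2 C) -> C^o) :
  invariants f -> invariants f' -> invariants (fun X => f X + f' X).
Proof.
move=> [pf hf] [pf' hf']; split; first exact: poly_funD.
by move=> g X hg; rewrite hf // hf'.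
Qed.

Lemma invariantsM (f f' : ('I_m -> sl2 C) -> C^o) :
  invariants f -> invariants f' -> invariants (fun X => (f X * f' X : C)).
Proof.
move=> [pf hf] [pf' hf']; split; first exact: poly_funM.
by move=> g X hg; rewrite hf // hf'.
Qed.

End PolynomialFunctions.

(** * Invariance under the group and under its Lie algebra *)

Section Evaluation.
Variables (C : numClosedFieldType) (m : nat).
Implicit Types (X : 'I_m -> sl2 C) (v : 'cV[C]_2).
Local Notation S := (cring C m).
Local Notation LE := (pvec (@xiE C m)).
Local Notation LF := (pvec (@xiF C m)).
Local Notation EX := (pvec (@xiX C m)).
Local Notation EV := (pvec (@xiV C m)).

(** The coordinates of a point, and the evaluation of polynomials there. *)
Definition pt X v (j : cvar m) : C :=
  match j with
  | inl k => (X k : 'M_2) 0 0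
  | inr (inl k) => (X k : 'M_2) 0 1
  | inr (inr (inl k)) => (X k : 'M_2) 1 0
  | inr (inr (inr b)) => if b then v 1 0 else v 0 0
  end.

Definition peval X v (p : S) : C := meval (fun l => pt X v (enum_val l)) p.

Lemma peval_var X v j : peval X v (pvar C j) = pt X v j.
Proof. by rewrite /peval mevalXU enum_rankK. Qed.
Lemma pevalD X v p q : peval X v (p + q) = peval X v p + peval X v q.
Proof. exact: mevalD. Qed.
Lemma pevalM X v p q : peval X v (p * q) = peval X v p * peval X v q.
Proof. exact: mevalM. Qed.
Lemma pevalN X v p : peval X v (- p) = - peval X v p.
Proof. exact: mevalN. Qed.
Lemma pevalZ X v c p : peval X v (c *: p) = c * peval X v p.
Proof. exact: mevalZ. Qed.
Lemma peval0 X v : peval X v 0 = 0. Proof. exact: meval0. Qed.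
Lemma pevalMn X v p n : peval X v (p *+ n) = peval X v p *+ n.
Proof. exact: mevalMn. Qed.
Lemma peval_sum X v (I : Type) (r : seq I) (P : pred I) (F : I -> S) :
  peval X v (\sum_(i <- r | P i) F i) = \sum_(i <- r | P i) peval X v (F i).
Proof. exact: raddf_sum. Qed.

Lemma peval_eq0 (p : S) : (forall X v, peval X v p = 0) -> p = 0.
Proof.
move=> p0; apply: meval_eq0 => u.
pose uu (j : cvar m) := u (enum_rank j).
pose X k : sl2 C := mksl2 (uu (jx k)) (uu (jy k)) (uu (jw k)).
pose v : 'cV[C]_2 := \col_i (if i == 0 then uu (jv m false) else uu (jv m true)).
rewrite -[RHS](p0 X v); apply: meval_eq => l.
rewrite -[in LHS](enum_valK l) /pt; case: (enum_val l) => [k|[k|[k|[]]]] /=;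
  by rewrite ?mksl2E ?mxE.
Qed.

(** The value of a polynomial along a path with polynomial coordinates. *)
Definition pathev (g : cvar m -> {poly C}) (p : S) : {poly C} :=
  mmap polyC (fun l => g (enum_val l)) p.

Lemma horner_pathev g X v p z : (forall j, (g j).[z] = pt X v j) ->
  (pathev g p).[z] = peval X v p.
Proof. by move=> hg; rewrite horner_mmap; apply: meval_eq => l. Qed.

Lemma pathev_var g j : pathev g (pvar C j) = g j.
Proof. by rewrite /pathev mmapX mmap1U enum_rankK. Qed.

Lemma pathevN g p : pathev g (- p) = - pathev g p. Proof. exact: mmapN. Qed.
Lemma pathevMn g p n : pathev g (p *+ n) = pathev g p *+ n. Proof. exact: mmapMn. Qed.
Lemma pathev0 g : pathev g 0 = 0. Proof. exact: mmap0. Qed.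

(** If the path [g] is an integral curve of the vector field [xi] up to the
    factor [q], then so is the derivative of [p] along [g]. *)
Lemma pathev_deriv g xi q p : (forall j, q * (g j)^`() = pathev g (xi j)) ->
  q * (pathev g p)^`() = pathev g (pvec xi p).
Proof.
move=> hg; rewrite /pathev deriv_mmap raddf_sum /= mulr_sumr.
rewrite (reindex_omap (@enum_rank (cvar m)) (fun l => Some (enum_val l))) => [|l _] /=; last first.
  by rewrite enum_valK.
apply: eq_big => [j|j _]; first by rewrite enum_rankK eqxx.
by rewrite rmorphM /= enum_rankK mulrA hg.
Qed.

(** The orbits of the two families of elementary unipotent matrices. *)
Definition pathE X v (j : cvar m) : {poly C} :=
  match j with
  | inl k => ((X k : 'M_2) 0 0)%:P + (X k : 'M_2) 1 0 *: 'X
  | inr (inl k) => ((X k : 'M_2) 0 1)%:P - ((X k : 'M_2) 0 0 *+ 2) *: 'X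
                   - (X k : 'M_2) 1 0 *: 'X^2
  | inr (inr (inl k)) => ((X k : 'M_2) 1 0)%:P
  | inr (inr (inr b)) => if b then (v 1 0)%:P else (v 0 0)%:P + v 1 0 *: 'X
  end.

Definition pathF X v (j : cvar m) : {poly C} :=
  match j with
  | inl k => ((X k : 'M_2) 0 0)%:P - (X k : 'M_2) 0 1 *: 'X
  | inr (inl k) => ((X k : 'M_2) 0 1)%:P
  | inr (inr (inl k)) => ((X k : 'M_2) 1 0)%:P + ((X k : 'M_2) 0 0 *+ 2) *: 'X
                   - (X k : 'M_2) 0 1 *: 'X^2
  | inr (inr (inr b)) => if b then (v 1 0)%:P + v 0 0 *: 'X else (v 0 0)%:P
  end.

Lemma pathE_horner X v j z :
  (pathE X v j).[z] = pt (fun k => Ad (uE z) (X k)) (uE z *m v) j.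
Proof.
have [i00 i01 i10 i11] := invmx2E (SL2_uE z).
case: j => [k|[k|[k|[]]]] /=; rewrite ?AdE ?mulmx2E ?(i00, i01, i10, i11) ?uEE ?sl2_11 ?hornerE
  //=; first [exact: SL2_uE | ring].
Qed.

Lemma pathF_horner X v j z :
  (pathF X v j).[z] = pt (fun k => Ad (uF z) (X k)) (uF z *m v) j.
Proof.
have [i00 i01 i10 i11] := invmx2E (SL2_uF z).
case: j => [k|[k|[k|[]]]] /=; rewrite ?AdE ?mulmx2E ?(i00, i01, i10, i11) ?uFE ?sl2_11 ?hornerE
  //=; first [exact: SL2_uF | ring].
Qed.

Lemma deriv_quadratic (a b c : C) :
  (a%:P + b *: 'X + c *: 'X^2)^`() = b%:P + (c *: 'X) *+ 2.
Proof.
rewrite !derivD derivC !derivZ derivX derivXn /= add0r alg_polyC.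
by rewrite scalerMnr.
Qed.

Lemma pathE_deriv X v p : (pathev (pathE X v) p)^`() = pathev (pathE X v) (LE p).
Proof.
rewrite -[LHS]mul1r; apply: pathev_deriv => j; rewrite mul1r.
case: j => [k|[k|[k|[]]]] /=; rewrite ?pathevN ?pathevMn ?pathev0 ?pathev_var /=.
- by rewrite deriv_linear_poly.
- rewrite -!scaleNr deriv_quadratic -!mul_polyC !polyCN !polyCMn; ring.
- by rewrite derivC.
- by rewrite derivC.
- by rewrite deriv_linear_poly.
Qed.

Lemma pathF_deriv X v p : (pathev (pathF X v) p)^`() = pathev (pathF X v) (LF p).
Proof.
rewrite -[LHS]mul1r; apply: pathev_deriv => j; rewrite mul1r.
case: j => [k|[k|[k|[]]]] /=; rewrite ?pathevN ?pathevMn ?pathev0 ?pathev_var /=.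
- by rewrite -scaleNr deriv_linear_poly polyCN.
- by rewrite derivC.
- rewrite -scaleNr deriv_quadratic -!mul_polyC !polyCN !polyCMn; ring.
- by rewrite deriv_linear_poly.
- by rewrite derivC.
Qed.

Lemma deriv_eq0_horner (P : {poly C}) z z' : P^`() = 0 -> P.[z] = P.[z'].
Proof.
move=> P0; suff -> : P = (P`_0)%:P by rewrite !hornerC.
apply/polyP => -[|i]; rewrite coefC //=; apply/eqP.
have := congr1 (fun Q : {poly C} => Q`_i) P0; rewrite coef_deriv coef0 => /eqP.
by rewrite mulrn_eq0.
Qed.

(** Invariance of a polynomial under [SL_2]. *)
Definition SL2_invariant (p : S) := forall g X v, SL2 g ->
  peval (fun k => Ad g (X k)) (g *m v) p = peval X v p.

Lemma uE0 : uE 0 = 1%:M :> 'M[C]_2. Proof. by rewrite /uE scale0r addr0. Qed.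
Lemma uF0 : uF 0 = 1%:M :> 'M[C]_2. Proof. by rewrite /uF scale0r addr0. Qed.
Lemma Ad1 (X : sl2 C) : Ad 1%:M X = X.
Proof. by apply/sl2P; rewrite Ad_mxE ?unitmx1 // mul1mx invmx1 mulmx1. Qed.

Lemma path0 X v : (forall j, (pathE X v j).[0] = pt X v j) *
  (forall j, (pathF X v j).[0] = pt X v j).
Proof.
split=> j; rewrite ?(pathE_horner, pathF_horner) ?(uE0, uF0) mul1mx;
  by congr pt; apply/funext => k; rewrite Ad1.
Qed.

(** Since [SL_2] is generated by elementary unipotent matrices, invariance means
    being killed by the vector fields of [E] and [F]. *)
Lemma SL2_invariant_inf p : SL2_invariant p <-> LE p = 0 /\ LF p = 0.
Proof.
split=> [hp|[hE hF]].
  split; apply: peval_eq0 => X v.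
    rewrite -(horner_pathev _ (path0 X v).1) -pathE_deriv.
    rewrite (_ : pathev _ _ = (peval X v p)%:P) ?derivC ?horner0 //.
    apply: horner_inj => z; rewrite (horner_pathev _ (fun j => pathE_horner X v j z)).
    by rewrite hornerC hp //; exact: SL2_uE.
  rewrite -(horner_pathev _ (path0 X v).2) -pathF_deriv.
  rewrite (_ : pathev _ _ = (peval X v p)%:P) ?derivC ?horner0 //.
  apply: horner_inj => z; rewrite (horner_pathev _ (fun j => pathF_horner X v j z)).
  by rewrite hornerC hp //; exact: SL2_uF.
move=> g + + hg; elim/SL2_ind: g / hg => [z|z|g h hg hh IHg IHh] X v.
- rewrite -(horner_pathev _ (fun j => pathE_horner X v j z)).
  rewrite -(horner_pathev _ (path0 X v).1); apply: deriv_eq0_horner.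
  by rewrite pathE_deriv hE pathev0.
- rewrite -(horner_pathev _ (fun j => pathF_horner X v j z)).
  rewrite -(horner_pathev _ (path0 X v).2); apply: deriv_eq0_horner.
  by rewrite pathF_deriv hF pathev0.
- rewrite -mulmxA -[RHS]IHh -[RHS]IHg.
  by congr (peval _ _ _); apply/funext => k; rewrite Ad_mul.
Qed.

(** The rays in the matrix and in the vector coordinates. *)
Definition pathX X v (j : cvar m) : {poly C} :=
  if j is inr (inr (inr b)) then (pt X v j)%:P else pt X v j *: 'X.
Definition pathV X v (j : cvar m) : {poly C} :=
  if j is inr (inr (inr b)) then pt X v j *: 'X else (pt X v j)%:P.

Lemma pathX_horner X v j z : (pathX X v j).[z] = pt (fun k => z *: X k) v j.
Proof.
by case: j => [k|[k|[k|b]]] /=; rewrite !hornerE ?sl2ZE ?mxE // mulrC.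
Qed.
Lemma pathV_horner X v j z : (pathV X v j).[z] = pt X (z *: v) j.
Proof.
by case: j => [k|[k|[k|[]]]] /=; rewrite !hornerE ?mxE // mulrC.
Qed.

Lemma pathX_deriv X v p :
  'X * (pathev (pathX X v) p)^`() = pathev (pathX X v) (EX p).
Proof.
apply: pathev_deriv => j.
case: j => [k|[k|[k|b]]] /=; rewrite ?pathev0 ?pathev_var /=.
all: by rewrite ?derivC ?mulr0 // derivZ derivX -scalerAr mulr1.
Qed.
Lemma pathV_deriv X v p :
  'X * (pathev (pathV X v) p)^`() = pathev (pathV X v) (EV p).
Proof.
apply: pathev_deriv => j.
case: j => [k|[k|[k|b]]] /=; rewrite ?pathev0 ?pathev_var /=.
all: by rewrite ?derivC ?mulr0 // derivZ derivX -scalerAr mulr1.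
Qed.

Lemma euler_poly (P Q : {poly C}) (c : C) n : 'X * P^`() = Q ->
  (forall z, P.[z] = z ^+ n * c) -> Q.[1] = n%:R * c.
Proof.
move=> <- hP; have -> : P = c *: 'X^n.
  by apply: horner_inj => z; rewrite hP !hornerE mulrC.
by rewrite derivZ derivXn !hornerE hornerMn !hornerE ?expr1n mulrC.
Qed.

Lemma EX_homog p n : (forall X v z, peval (fun k => z *: X k) v p = z ^+ n * peval X v p) ->
  EX p = n%:R *: p.
Proof.
move=> hp; apply/eqP; rewrite -subr_eq0; apply/eqP/peval_eq0 => X v.
have h1 j : (pathX X v j).[1] = pt X v j.
  by rewrite pathX_horner; congr pt; apply/funext => k; rewrite scale1r.
rewrite pevalD pevalN pevalZ -(horner_pathev _ h1).
rewrite (euler_poly (pathX_deriv X v p) (c := peval X v p) (n := n)) ?subrr // => z.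
by rewrite (horner_pathev _ (fun j => pathX_horner X v j z)) hp.
Qed.

Lemma EV_homog p n : (forall X v z, peval X (z *: v) p = z ^+ n * peval X v p) ->
  EV p = n%:R *: p.
Proof.
move=> hp; apply/eqP; rewrite -subr_eq0; apply/eqP/peval_eq0 => X v.
have h1 j : (pathV X v j).[1] = pt X v j by rewrite pathV_horner scale1r.
rewrite pevalD pevalN pevalZ -(horner_pathev _ h1).
rewrite (euler_poly (pathV_deriv X v p) (c := peval X v p) (n := n)) ?subrr // => z.
by rewrite (horner_pathev _ (fun j => pathV_horner X v j z)) hp.
Qed.

Lemma EX_neg p : EX p = - p -> p = 0.
Proof.
move=> hp; apply: peval_eq0 => X v.
have h1 j : (pathX X v j).[1] = pt X v j.
  by rewrite pathX_horner; congr pt; apply/funext => k; rewrite scale1r.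
rewrite -(horner_pathev _ h1); set P := pathev _ _.
have hP : 'X * P^`() = - P by rewrite pathX_deriv hp pathevN.
suff -> : P = 0 by rewrite horner0.
apply/polyP => i; have := congr1 (fun Q : {poly C} => Q`_i) hP.
rewrite coefXM coefN coef_deriv coef0; case: i => [|i] /=.
  by move/eqP; rewrite eq_sym oppr_eq0 => /eqP.
move=> h; apply/eqP; have : P`_i.+1 *+ i.+2 == 0 by rewrite mulrSr h addNr.
by rewrite mulrn_eq0.
Qed.

Lemma EV_zero p X v z : EV p = 0 -> peval X (z *: v) p = peval X v p.
Proof.
move=> hp; have h1 j : (pathV X v j).[1] = pt X v j by rewrite pathV_horner scale1r.
rewrite -(horner_pathev _ h1) -(horner_pathev _ (fun j => pathV_horner X v j z)).
apply: deriv_eq0_horner; have := pathV_deriv X v p.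
by rewrite hp pathev0 => /eqP; rewrite mulf_eq0 polyX_eq0 => /eqP.
Qed.

End Evaluation.

(** * Invariants of several traceless matrices and a vector *)

Section FirstFundamentalTheorem.
Variables (C : numClosedFieldType) (m : nat).
Implicit Types (X : 'I_m -> sl2 C) (v : 'cV[C]_2) (c d e : 'cV[C]_m).
Local Notation S := (cring C m).
Local Notation LE := (pvec (@xiE C m)).
Local Notation LF := (pvec (@xiF C m)).
Local Notation EX := (pvec (@xiX C m)).
Local Notation EV := (pvec (@xiV C m)).

(** The covariants of degree two in the vector, linear and quadratic in the
    matrices. *)
Definition tau c X v : C := \tr ((comb X c : 'M_2) *m nilp v).
Definition sigma c d X v : C :=
  \tr ((bracket (comb X c) (comb X d) : 'M_2) *m nilp v).

(** The module over the invariants spanned by the products of [s] factors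
    [tau], at most one of which may be replaced by some [sigma]. *)
Inductive cov_span (s : nat) : (('I_m -> sl2 C) -> 'cV[C]_2 -> C) -> Prop :=
  | cov_span_tau f cs : invariants f -> size cs = s ->
      cov_span s (fun X v => f X * \prod_(c <- cs) tau c X v)
  | cov_span_sigma f cs d e : invariants f -> (size cs).+1 = s ->
      cov_span s (fun X v => f X * \prod_(c <- cs) tau c X v * sigma d e X v)
  | cov_spanD F G : cov_span s F -> cov_span s G ->
      cov_span s (fun X v => F X v + G X v).

Lemma cov_spanM s f F : invariants f -> cov_span s F ->
  cov_span s (fun X v => f X * F X v).
Proof.
move=> hf; elim=> {F} [f' cs hf' scs|f' cs d e hf' scs|F G _ IHF _ IHG].
- rewrite (_ : (fun _ => _) = fun X v => (f X * f' X) * \prod_(c <- cs) tau c X v).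
    by apply: (cov_span_tau (f := fun X => (f X * f' X : C))) => //; exact: invariantsM.
  by apply/funext => X; apply/funext => v; rewrite mulrA.
- rewrite (_ : (fun _ => _) =
     fun X v => (f X * f' X) * \prod_(c <- cs) tau c X v * sigma d e X v).
    by apply: (cov_span_sigma (f := fun X => (f X * f' X : C))) => //; exact: invariantsM.
  by apply/funext => X; apply/funext => v; rewrite !mulrA.
- rewrite (_ : (fun _ => _) = fun X v => f X * F X v + f X * G X v).
    exact: cov_spanD.
  by apply/funext => X; apply/funext => v; rewrite mulrDr.
Qed.

Lemma cov_spanZ s (a : C) F : cov_span s F -> cov_span s (fun X v => a * F X v).
Proof. exact: cov_spanM (invariants_const _ a). Qed.

Lemma cov_span0 s : cov_span s (fun _ _ => 0).
Proof.
have := cov_span_tau (s := s) (invariants_const m (0 : C)) (size_nseq s 0).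
by congr cov_span; apply/funext => X; apply/funext => v; rewrite mul0r.
Qed.

Lemma cov_spanN s F : cov_span s F -> cov_span s (fun X v => - F X v).
Proof.
move=> /(cov_spanZ (-1)); congr cov_span; apply/funext => X; apply/funext => v.
by rewrite mulN1r.
Qed.

Lemma cov_span_sum s (I : Type) (r : seq I) (P : pred I)
    (F : I -> ('I_m -> sl2 C) -> 'cV[C]_2 -> C) :
  (forall i, P i -> cov_span s (F i)) ->
  cov_span s (fun X v => \sum_(i <- r | P i) F i X v).
Proof.
move=> hF; elim: r => [|i r IH].
  have := cov_span0 s; congr cov_span.
  by apply/funext => X; apply/funext => v; rewrite big_nil.
case Pi: (P i); last first.
  by move: IH; congr cov_span; apply/funext => X; apply/funext => v; rewrite big_cons Pi.
have := cov_spanD (hF i Pi) IH; congr cov_span.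
by apply/funext => X; apply/funext => v; rewrite big_cons Pi.
Qed.

Lemma cov_span_mul_tau s c F : cov_span s F ->
  cov_span s.+1 (fun X v => F X v * tau c X v).
Proof.
elim=> {F} [f cs hf scs|f cs d e hf scs|F G _ IHF _ IHG].
- have := cov_span_tau (s := s.+1) (cs := c :: cs) hf; rewrite /= scs => /(_ erefl).
  congr cov_span; apply/funext => X; apply/funext => v.
  by rewrite big_cons; ring.
- have := cov_span_sigma (s := s.+1) (cs := c :: cs) d e hf; rewrite /= scs => /(_ erefl).
  congr cov_span; apply/funext => X; apply/funext => v.
  by rewrite big_cons; ring.
- have := cov_spanD IHF IHG; congr cov_span; apply/funext => X; apply/funext => v; ring.
Qed.

(** Two factors [sigma] are eliminated by the Gram determinant identity. *)
Lemma cov_span_mul_sigma s c d F : cov_span s F ->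
  cov_span s.+1 (fun X v => F X v * sigma c d X v).
Proof.
elim=> {F} [f cs hf scs|f cs d' e hf scs|F G _ IHF _ IHG].
- have := cov_span_sigma (s := s.+1) (cs := cs) c d hf; rewrite /= scs => /(_ erefl).
  by congr cov_span.
- pose G (a b : 'cV[C]_m) (c1 c2 : 'cV[C]_m) X v : C :=
     (pairing a b X * f X) * \prod_(c <- c1 :: c2 :: cs) tau c X v.
  have hG a b c1 c2 : cov_span s.+1 (G a b c1 c2).
    apply: (cov_span_tau (f := fun X => (pairing a b X * f X : C))).
      by apply: invariantsM => //; exact: invariants_pairing.
    by rewrite /= scs.
  have := cov_spanZ 2%:R (cov_spanD (cov_spanD (hG d' c e d) (cov_spanN (hG d' d e c)))
      (cov_spanD (cov_spanN (hG e c d' d)) (hG e d d' c))).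
  congr cov_span; apply/funext => X; apply/funext => v.
  rewrite -[RHS]mulrA [sigma d' e X v * _](gram_nilp (comb X d') (comb X e) (comb X c) (comb X
    d) v).
  by rewrite /G !big_cons /pairing -!/(tau _ _ _); ring.
- have := cov_spanD IHF IHG; congr cov_span; apply/funext => X; apply/funext => v; ring.
Qed.

(** The functions of an additional vector [a] of the form [[Y a, v]], where [Y]
    is [1], a matrix [comb X c] or a commutator of two of these, with
    coefficients in [cov_span s]. *)
Inductive vec_span (s : nat) : ('cV[C]_2 -> ('I_m -> sl2 C) -> 'cV[C]_2 -> C) -> Prop :=
  | vec_span1 F : cov_span s F -> vec_span s (fun a X v => F X v * symp a v)
  | vec_span2 F c : cov_span s F ->
      vec_span s (fun a X v => F X v * symp ((comb X c : 'M_2) *m a) v)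
  | vec_span3 F c d : cov_span s F ->
      vec_span s (fun a X v => F X v * symp ((bracket (comb X c) (comb X d) : 'M_2) *m a) v)
  | vec_spanD F G : vec_span s F -> vec_span s G ->
      vec_span s (fun a X v => F a X v + G a X v).

Lemma vec_spanZ s (z : C) F : vec_span s F -> vec_span s (fun a X v => z * F a X v).
Proof.
elim=> {F} [F hF|F c hF|F c d hF|F G _ IHF _ IHG].
- have := vec_span1 (cov_spanZ z hF); congr vec_span.
  by apply/funext => a; apply/funext => X; apply/funext => v; rewrite mulrA.
- have := vec_span2 c (cov_spanZ z hF); congr vec_span.
  by apply/funext => a; apply/funext => X; apply/funext => v; rewrite mulrA.
- have := vec_span3 c d (cov_spanZ z hF); congr vec_span.
  by apply/funext => a; apply/funext => X; apply/funext => v; rewrite mulrA.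
- have := vec_spanD IHF IHG; congr vec_span.
  by apply/funext => a; apply/funext => X; apply/funext => v; rewrite mulrDr.
Qed.

Lemma vec_span_sum s (I : Type) (r : seq I) (F : I -> 'cV[C]_2 -> ('I_m -> sl2 C) -> 'cV[C]_2 ->
  C) :
  (forall i, vec_span s (F i)) ->
  vec_span s (fun a X v => \sum_(i <- r) F i a X v).
Proof.
move=> hF; elim: r => [|i r IH].
  have := vec_span1 (cov_span0 s); congr vec_span.
  by apply/funext => a; apply/funext => X; apply/funext => v; rewrite big_nil mul0r.
have := vec_spanD (hF i) IH; congr vec_span.
by apply/funext => a; apply/funext => X; apply/funext => v; rewrite big_cons.
Qed.

Lemma sympD (a b v : 'cV[C]_2) : symp (a + b) v = symp a v + symp b v.
Proof. by rewrite /symp !mxE; ring. Qed.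
Lemma sympZ (z : C) (a v : 'cV[C]_2) : symp (z *: a) v = z * symp a v.
Proof. by rewrite /symp !mxE; ring. Qed.

Lemma sympN (a v : 'cV[C]_2) : symp (- a) v = - symp a v.
Proof. by rewrite /symp !mxE; ring. Qed.

Lemma symp_mul (Y Z : sl2 C) a v : symp ((Y : 'M_2) *m ((Z : 'M_2) *m a)) v =
  2%:R^-1 * \tr ((Y : 'M_2) *m Z) * symp a v
   + 2%:R^-1 * symp ((bracket Y Z : 'M_2) *m a) v.
Proof.
by rewrite mulmxA [in LHS]sl2_mul_sym mulmxDl mul_scalar_mx -scalemxAl sympD !sympZ.
Qed.

(** Stability under [a |-> X_k a]: the product of two matrices is a scalar plus
    a commutator, and double commutators are combinations of the matrices. *)
Lemma vec_span_step s k F : vec_span s F ->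
  vec_span s (fun a X v => F ((X k : 'M_2) *m a) X v).
Proof.
elim=> {F} [F hF|F c hF|F c d hF|F G _ IHF _ IHG].
- have := vec_span2 (delta_mx k 0) hF; congr vec_span.
  by apply/funext => a; apply/funext => X; apply/funext => v; rewrite comb_delta.
- have h1 := vec_span1 (cov_spanZ (2%:R^-1) (cov_spanM (invariants_pairing c (delta_mx k 0)) hF)).
  have h2 := vec_span3 c (delta_mx k 0) (cov_spanZ (2%:R^-1) hF).
  have := vec_spanD h1 h2; congr vec_span.
  apply/funext => a; apply/funext => X; apply/funext => v.
  by rewrite symp_mul /pairing comb_delta; ring.
- pose kk : 'cV[C]_m := delta_mx k 0.
  pose f X : C := \tr ((bracket (comb X c) (comb X d) : 'M_2) *m X k).
  have hf : invariants f.
    split.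
      rewrite (_ : f = fun X => \sum_i \sum_j \sum_l
         ((comb X c : 'M_2) i l * (comb X d : 'M_2) l j
         + (-1) * ((comb X d : 'M_2) i l * (comb X c : 'M_2) l j)) * (X k : 'M_2) j i).
        do 3![apply: poly_fun_sum => ? _]; apply: poly_funM; last exact: poly_fun_entry.
        apply: poly_funD; first by apply: poly_funM; apply: homog_poly; exact: homog_fun_comb.
        apply: poly_funM; first exact: poly_fun_const.
        by apply: poly_funM; apply: homog_poly; exact: homog_fun_comb.
      apply/funext => X; apply: eq_bigr => i _; rewrite mxE; apply: eq_bigr => j _.
      rewrite bracketE subE !mxE -sumrB mulr_suml; apply: eq_bigr => l _.
      by rewrite mulN1r.
    by move=> g X hg; rewrite /f !Ad_comb // -Ad_bracket // Ad_tr.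
  have h1 := vec_span1 (cov_spanZ (2%:R^-1) (cov_spanM hf hF)).
  have h2 := vec_span2 c (cov_spanM (invariants_pairing d kk) hF).
  have h3 := vec_span2 d (cov_spanN (cov_spanM (invariants_pairing c kk) hF)).
  have := vec_spanD h1 (vec_spanD h2 h3); congr vec_span.
  apply/funext => a; apply/funext => X; apply/funext => v.
  rewrite symp_mul -/(f X) bracket_bracket /pairing /kk comb_delta.
  rewrite sl2DE sl2NE !sl2ZE mulmxBl -!scalemxAl sympD sympN !sympZ.
  by field.
- exact: vec_spanD IHF IHG.
Qed.

Lemma vec_span_diag s F : vec_span s F -> cov_span s.+1 (fun X v => F v X v).
Proof.
elim=> {F} [F hF|F c hF|F c d hF|F G _ IHF _ IHG].
- have := cov_span0 s.+1; congr cov_span; apply/funext => X; apply/funext => v.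
  by rewrite /symp; ring.
- have := cov_spanN (cov_span_mul_tau c hF); congr cov_span.
  by apply/funext => X; apply/funext => v; rewrite symp_nilp mulrN.
- have := cov_spanN (cov_span_mul_sigma c d hF); congr cov_span.
  by apply/funext => X; apply/funext => v; rewrite symp_nilp mulrN.
- exact: cov_spanD IHF IHG.
Qed.

(** Invariant pairs of odd degree in the vector, by induction on the degree in
    the matrices: the Casimir identity expresses a pair by its contractions. *)
Lemma vec_span_of_pair s (IH : forall n (g : S), LE g = 0 -> LF g = 0 ->
    EX g = n%:R *: g -> EV g = (s.*2)%:R *: g -> cov_span s (fun X v => peval X v g)) :
  forall n (f1 f2 : S), inv_pair f1 f2 ->
    EX f1 = n%:R *: f1 -> EX f2 = n%:R *: f2 ->
    EV f1 = (s.*2.+1)%:R *: f1 -> EV f2 = (s.*2.+1)%:R *: f2 ->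
  vec_span s (fun a X v => a 0 0 * peval X v f1 + a 1 0 * peval X v f2).
Proof.
have step n (f1 f2 : S) : inv_pair f1 f2 ->
    EX f1 = n%:R *: f1 -> EX f2 = n%:R *: f2 ->
    EV f1 = (s.*2.+1)%:R *: f1 -> EV f2 = (s.*2.+1)%:R *: f2 ->
    (forall k, vec_span s (fun a X v => a 0 0 * peval X v (capX1 k f1 f2)
                                 + a 1 0 * peval X v (capX2 k f1 f2))) ->
    vec_span s (fun a X v => a 0 0 * peval X v f1 + a 1 0 * peval X v f2).
  move=> hf EX1 EX2 EV1 EV2 hX.
  have [hV1 hV2] := capV_inv hf.
  have hV : cov_span s (fun X v => peval X v (capV f1 f2)).
    apply: (IH n) => //.
      by rewrite /capV pvecD pvecN !EX_v EX1 EX2 !pderZ !subr0 scalerBr.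
    rewrite /capV pvecD pvecN !EV_v EV1 EV2 !pderZ.
    have e k (A : S) : k.+1%:R *: A - A = k%:R *: A.
      by rewrite !scaler_nat mulrSr addrK.
    by rewrite !e -scalerBr.
  have [c1 c2] := casimir hf EX1 EX2 EV1 EV2.
  set w := (3 + _ + _)%N in c1 c2.
  have w0 : w%:R != 0 :> C by rewrite pnatr_eq0 /w addSn.
  have := vec_spanZ (w%:R^-1 * 2%:R)
    (vec_spanD (vec_span_sum (index_enum 'I_m) (fun k => vec_span_step k (hX k)))
               (vec_span1 hV)).
  congr vec_span; apply/funext => a; apply/funext => X; apply/funext => v.
  have e1 := congr1 (peval X v) c1; have e2 := congr1 (peval X v) c2.
  set cV := peval X v (capV f1 f2); set A1 := peval X v f1; set A2 := peval X v f2.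
  rewrite pevalZ pevalMn pevalD peval_sum pevalM peval_var /= -/A1 -/cV in e1.
  rewrite pevalZ pevalMn pevalD pevalN peval_sum pevalM peval_var /= -/A2 -/cV in e2.
  move: e1 e2; set S1 := \sum_(i < m) _; set S2 := \sum_(i < m) _ => e1 e2.
  have -> : \sum_(i < m) (((X i : 'M_2) *m a) 0 0 * peval X v (capX1 i f1 f2) +
       ((X i : 'M_2) *m a) 1 0 * peval X v (capX2 i f1 f2)) = a 0 0 * S1 + a 1 0 * S2.
    rewrite /S1 /S2 !mulr_sumr -big_split; apply: eq_bigr => i _ /=.
    rewrite !(pevalD X v (_ * _)) pevalN !pevalM !peval_var /= !mulmx2E sl2_11; ring.
  apply: (mulfI w0); rewrite [LHS]mulrA [w%:R * (_ * _)]mulrA mulfV // mul1r.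
  rewrite [RHS]mulrDr [w%:R * (a 0 0 * _)]mulrCA [w%:R * (a 1 0 * _)]mulrCA e1 e2 /symp.
  ring.
elim=> [|n IHn] f1 f2 hf EX1 EX2 EV1 EV2; apply: (step _ f1 f2 hf EX1 EX2 EV1 EV2) => k.
  have h g : EX g = 0 *: g -> forall k, (EX (pder (jx k) g) = - pder (jx k) g) *
      (EX (pder (jy k) g) = - pder (jy k) g) * (EX (pder (jw k) g) = - pder (jw k) g).
    by move=> hg k'; rewrite EX_x EX_y EX_w hg scale0r !pder0 !sub0r.
  have z1 : capX1 k f1 f2 = 0.
    by apply: EX_neg; rewrite /capX1 pvecD pvecMn !h // opprD mulNrn.
  have z2 : capX2 k f1 f2 = 0.
    by apply: EX_neg; rewrite /capX2 pvecD pvecN pvecMn !h // opprD mulNrn.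
  have := vec_span1 (cov_span0 s); congr vec_span.
  by apply/funext => a; apply/funext => X; apply/funext => v; rewrite z1 z2 peval0; ring.
have e (A : S) : n.+1%:R *: A - A = n%:R *: A by rewrite !scaler_nat mulrSr addrK.
apply: IHn; first exact: inv_pair_capX.
- rewrite /capX1 pvecD pvecMn EX_x EX_y EX1 EX2 !pderZ !e.
  by rewrite scalerDr scalerMnr.
- rewrite /capX2 pvecD pvecN pvecMn EX_x EX_w EX1 EX2 !pderZ !e.
  by rewrite scalerBr scalerMnr.
- rewrite /capX1 pvecD pvecMn EV_x EV_y EV1 EV2 !pderZ !subr0.
  by rewrite scalerDr scalerMnr.
- rewrite /capX2 pvecD pvecN pvecMn EV_x EV_w EV1 EV2 !pderZ !subr0.
  by rewrite scalerBr scalerMnr.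
Qed.

Lemma poly_fun_peval0 (g : S) : poly_fun (fun X => peval X 0 g).
Proof.
elim/mpoly_ring_ind: g => [c|i|p q Hp Hq|p q Hp Hq].
- have := poly_fun_const m c; congr poly_fun.
  by apply/funext => X; rewrite /peval mevalC.
- rewrite (_ : (fun _ => _) = (fun X => pt X 0 (enum_val i))).
    case: (enum_val i) => [k|[k|[k|b]]] /=; try exact: poly_fun_entry.
    rewrite !mxE; case: b; exact: poly_fun_const.
  by apply/funext => X; rewrite /peval mevalXU.
- have := poly_funD Hp Hq; congr poly_fun.
  by apply/funext => X; rewrite pevalD.
- have := poly_funM Hp Hq; congr poly_fun.
  by apply/funext => X; rewrite pevalM.
Qed.

(** The polynomial invariants of [m] traceless matrices and a vector, by
    induction on the degree in the vector: the two derivatives with respect to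
    the vector form an invariant pair, from which Euler's relation recovers the
    invariant. *)
Theorem invariant_cov_span s n (g : S) : LE g = 0 -> LF g = 0 ->
  EX g = n%:R *: g -> EV g = (s.*2)%:R *: g -> cov_span s (fun X v => peval X v g).
Proof.
elim: s n g => [|s IH] n g hE hF hX hV.
  have hI : invariants (fun X => peval X 0 g).
    split; first exact: poly_fun_peval0.
    move=> h X hh; have /SL2_invariant_inf hg := conj hE hF.
    by rewrite -(hg h X 0 hh) mulmx0.
  have := cov_span_tau (s := 0) hI (erefl : size [::] = 0%N); congr cov_span.
  apply/funext => X; apply/funext => v; rewrite big_nil mulr1.
  by rewrite -(EV_zero X v 0) ?scale0r // hV scale0r.
have e (A : S) : s.+1.*2%:R *: A - A = s.*2.+1%:R *: A.
  by rewrite doubleS !scaler_nat [in LHS]mulrSr addrK.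
have hp : vec_span s (fun a X v => a 0 0 * peval X v (pder (jv m false) g)
                       + a 1 0 * peval X v (pder (jv m true) g)).
  apply: (vec_span_of_pair IH (n := n)).
  - by split; rewrite ?(LE_v, LF_v) ?hE ?hF !pder0 ?subr0 ?sub0r.
  - by rewrite EX_v hX pderZ subr0.
  - by rewrite EX_v hX pderZ subr0.
  - by rewrite EV_v hV pderZ e.
  - by rewrite EV_v hV pderZ e.
have := cov_spanZ (s.+1.*2%:R^-1) (vec_span_diag hp); congr cov_span.
apply/funext => X; apply/funext => v.
have s0 : s.+1.*2%:R != 0 :> C by rewrite pnatr_eq0.
apply: (mulfI s0); rewrite mulrA mulfV // mul1r -(pevalZ X v s.+1.*2%:R) -hV.
rewrite {1}/pvec sum_cvar /= [in RHS]big1 => [|k _].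
  by rewrite add0r (pevalD X v (_ * _)) !pevalM !peval_var.
by rewrite !mul0r !addr0.
Qed.

End FirstFundamentalTheorem.

(** * The irreducible representations in a weight basis *)

Section StandardRepresentation.
Variables (C : numClosedFieldType) (n : nat).
Local Notation d := n.+1.

(** In the irreducible representation of dimension [n + 1], in a suitable
    basis of weight vectors, the matrices of the standard basis of [sl_2]. *)
Definition std_e : 'M[C]_d := \matrix_(i, j) (j == i.+1 :> nat)%:R.
Definition std_f : 'M[C]_d :=
  \matrix_(i, j) ((i == j.+1 :> nat) * (j.+1 * (n - j)))%N%:R.
Definition std_h : 'M[C]_d := \matrix_(i, j) ((i == j)%:R * (n%:R - (j.*2)%:R)).

Definition std_rep (X : sl2 C) : 'M[C]_d :=
  (X : 'M_2) 0 0 *: std_h + (X : 'M_2) 0 1 *: std_e + (X : 'M_2) 1 0 *: std_f.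

(** Eigenvectors of a matrix with eigenvalues in an arithmetic progression
    cannot go on forever. *)
Lemma eigen_progression (p : nat) (M : 'M[C]_p) (w : nat -> 'rV[C]_p) (a c : C) :
  c != 0 -> (forall k, w k *m M = (a + c * k%:R) *: w k) ->
  exists2 k, (k <= p)%N & w k = 0.
Proof.
move=> c0 hw.
have [/existsP[k /eqP wk]|/existsPn hne] := boolP [exists k : 'I_p.+1, w k == 0].
  by exists k => //; rewrite -ltnS.
pose s := [seq a + c * k%:R | k <- iota 0 p.+1].
have us : uniq s.
  rewrite map_inj_uniq ?iota_uniq // => i j /addrI /(mulfI c0) /eqP.
  by rewrite eqr_nat => /eqP.
have rs : all (root (char_poly M)) s.
  apply/allP => x /mapP[k]; rewrite mem_iota add0n => /andP[_ kp] ->.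
  rewrite -eigenvalue_root_char; apply/eigenvalueP; exists (w k); first exact: hw.
  exact: hne (Ordinal kp).
have := max_poly_roots (monic_neq0 (char_poly_monic M)) rs us.
by rewrite size_char_poly size_map size_iota ltnn.
Qed.

Lemma std_eE k (B : 'M[C]_(d, k)) i j :
  (std_e *m B) i j = (if insub i.+1 is Some i' then B i' j else 0).
Proof.
rewrite mxE; case: insubP => [i' hi' ii'|].
  rewrite (bigD1 i') //= mxE ii' eqxx mul1r big1 ?addr0 // => l li.
  by rewrite mxE -ii' (negbTE (_ : l != i' :> nat)) ?mul0r.
move=> hi; rewrite big1 // => l _; rewrite mxE.
case: eqP => [li|]; last by rewrite mul0r.
by rewrite -li ltn_ord in hi.
Qed.

Lemma mul_std_eE k (B : 'M[C]_(k, d)) i (j : 'I_d) :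
  (B *m std_e) i j = (if nat_of_ord j is 0%N then 0 else B i (inord j.-1)).
Proof.
rewrite mxE; case ej: (nat_of_ord j) => [|j'].
  by rewrite big1 // => l _; rewrite mxE ej mulr0.
have hj : (j' < d)%N by rewrite (leq_trans _ (ltn_ord j)) // ej.
rewrite (bigD1 (inord j')) //= mxE ej inordK // eqxx mulr1 big1 ?addr0 // => l lj.
rewrite mxE ej eqSS; case: eqP => [jl|]; last by rewrite mulr0.
by case/eqP: lj; apply: val_inj; rewrite /= inordK.
Qed.

Lemma std_e_exp s (i j : 'I_d) : (std_e ^+ s) i j = (j == (i + s)%N :> nat)%:R.
Proof.
elim: s i j => [|s IH] i j; first by rewrite expr0 mxE addn0 eq_sym.
rewrite exprS -mulmxE std_eE; case: insubP => [i' hi' ii'|hi].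
  by rewrite IH ii' addSnnS.
case: eqP => // ji; case/negP: hi; rewrite (leq_trans _ (ltn_ord j)) // ji.
by rewrite addnS ltnS ltnS leq_addr.
Qed.

(** Products of [k] matrices of the representation are zero below the [k]-th
    subdiagonal, where only the factors [std_f] contribute. *)
Fixpoint lower_coef (k j : nat) : nat :=
  if k is k'.+1 then ((j + k').+1 * (n - (j + k')) * lower_coef k' j)%N else 1%N.

Lemma lower_coef_gt0 k j : (j + k < d)%N -> (0 < lower_coef k j)%N.
Proof.
elim: k j => //= k IH j hk; rewrite !muln_gt0 /= subn_gt0 IH.
  by rewrite andbT; move: hk; rewrite addnS ltnS.
by rewrite (leq_trans _ hk) // ltnS addnS leqnSn.
Qed.

Lemma mulrmxE (A B : 'M[C]_d) i j : (A * B) i j = \sum_l A i l * B l j.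
Proof. by rewrite -mulmxE mxE. Qed.

Lemma std_rep_low (X : sl2 C) (i j : 'I_d) : (j.+1 < i)%N -> std_rep X i j = 0.
Proof.
move=> ji; rewrite !mxE.
have [-> [-> ->]] : (i == j) = false /\ (j == i.+1 :> nat) = false /\
  (i == j.+1 :> nat) = false by rewrite -val_eqE /=; lia.
by rewrite /= ?mulr0n !(mul0r, mul0n, mulr0n, mulr0, addr0).
Qed.

Lemma std_rep_sub (X : sl2 C) (i j : 'I_d) : i = j.+1 :> nat ->
  std_rep X i j = (X : 'M_2) 1 0 * (j.+1 * (n - j))%N%:R.
Proof.
move=> ij; rewrite !mxE.
have [-> [-> ->]] : (i == j) = false /\ (j == i.+1 :> nat) = false /\
  (i == j.+1 :> nat) = true by rewrite -val_eqE /=; lia.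
by rewrite /= !(mul0r, mulr0n, mulr0, add0r) mul1n.
Qed.

Lemma std_prod_lower (ws : seq (sl2 C)) (i j : 'I_d) :
  ((j + size ws < i)%N -> (\prod_(w <- ws) std_rep w) i j = 0) /\
  (i = (j + size ws)%N :> nat -> (\prod_(w <- ws) std_rep w) i j
     = (\prod_(w <- ws) (w : 'M_2) 1 0) * (lower_coef (size ws) j)%:R).
Proof.
elim: ws i j => [|w ws IH] i j /=.
  rewrite !big_nil addn0 mulr1; split=> [ji|ij]; rewrite mxE.
    by rewrite -val_eqE /= gtn_eqF.
  by rewrite (_ : i = j) ?eqxx //; apply: val_inj.
rewrite !big_cons mulrmxE; split=> [ji|ij].
  apply: big1 => l _; have [il|il] := leqP i l.+1; last by rewrite std_rep_low // mul0r.
  by rewrite (IH l j).1 ?mulr0 //; lia.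
have hl : (j + size ws < d)%N by have := ltn_ord i; lia.
pose l0 : 'I_d := Ordinal hl.
rewrite (bigD1 l0) //= std_rep_sub; last by rewrite ij addnS.
rewrite (IH l0 j).2 // [X in _ + X]big1 ?addr0 => [|l ll0].
  by rewrite /= natrM; ring.
have [il|il] := leqP i l.+1; last by rewrite std_rep_low // mul0r.
have ll : (l : nat) != l0 by [].
by rewrite (IH l j).1 ?mulr0 //; move: ll; rewrite /=; lia.
Qed.

(** The trace of [std_f ^ s * std_e ^ s]. *)
Definition trace_coef (s : nat) : C :=
  (\sum_(j < d | (j + s < d)%N) lower_coef s j)%N%:R.

Lemma trace_coef_neq0 s : (s < d)%N -> trace_coef s != 0.
Proof.
move=> sd; rewrite pnatr_eq0 (bigD1 ord0) //= addn_eq0 negb_and -lt0n.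
by rewrite lower_coef_gt0.
Qed.

Lemma trace_mul_e (A : 'M[C]_d) s :
  \tr (A *m std_e ^+ s) = \sum_(j < d | (j + s < d)%N) A (inord (j + s)) j.
Proof.
rewrite mxtrace_mulC /mxtrace [RHS]big_mkcond; apply: eq_bigr => j _.
rewrite mxE; case: ltnP => js.
  rewrite (bigD1 (inord (j + s))) //= std_e_exp inordK // eqxx mul1r.
  rewrite big1 ?addr0 // => l ll; rewrite std_e_exp.
  case: eqP => [lj|]; last by rewrite mul0r.
  by case/eqP: ll; apply: val_inj; rewrite /= inordK.
rewrite big1 // => l _; rewrite std_e_exp; case: eqP => [lj|]; last by rewrite mul0r.
by move: js; rewrite -lj leqNgt ltn_ord.
Qed.

Lemma std_trace (ws : seq (sl2 C)) s : (size ws <= s)%N ->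
  \tr (\prod_(w <- ws) std_rep w *m std_e ^+ s) =
  if size ws == s then trace_coef s * \prod_(w <- ws) (w : 'M_2) 1 0 else 0.
Proof.
move=> sws; rewrite trace_mul_e; case: eqP => [ss|/eqP ss].
  rewrite /trace_coef natr_sum mulr_suml; apply: eq_bigr => j js.
  by rewrite (std_prod_lower _ _ _).2 ?inordK ?ss // mulrC.
apply: big1 => j js; rewrite (std_prod_lower _ _ _).1 // inordK //.
by rewrite ltn_add2l ltn_neqAle ss.
Qed.

Lemma std_repE : (std_rep (sl2E C) = std_e) * (std_rep (sl2F C) = std_f)
   * (std_rep (sl2H C) = std_h).
Proof.
by rewrite /std_rep !mksl2E; split; [split|];
  rewrite !(scale0r, scale1r, addr0, add0r).
Qed.

(** A matrix that commutes with [std_e] and is orthogonal to all powers of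
    [std_f] vanishes: it is an upper triangular Toeplitz matrix. *)
Lemma commute_e_eq0 (A : 'M[C]_d) : std_e *m A = A *m std_e ->
  (forall s, (s < d)%N -> \tr (A *m std_f ^+ s) = 0) -> A = 0.
Proof.
move=> hA trA.
have step (i j : nat) : (i.+1 < d)%N -> (j < d)%N ->
    A (inord i.+1) (inord j) = (if j is j'.+1 then A (inord i) (inord j') else 0).
  move=> hi hj; have := congr1 (fun M : 'M_d => M (inord i) (inord j)) hA.
  rewrite std_eE mul_std_eE; rewrite inordK ?(ltnW hi) // inordK //.
  case: insubP => [i' _ ii'|]; last by rewrite hi.
  have -> : inord i.+1 = i' by apply: val_inj; rewrite /= inordK ?ii'.
  by case: j {hj}.
have low (i j : nat) : (i < d)%N -> (j < i)%N -> A (inord i) (inord j) = 0.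
  elim: i j => // i IH [|j] hi ji; rewrite step ?(ltn_trans ji) //.
  by apply: IH => //; exact: ltnW.
have diag (k j : nat) : (k + j < d)%N -> A (inord j) (inord (k + j)) = A (inord 0) (inord k).
  elim: j => [|j IH] hj; first by rewrite addn0.
  rewrite addnS step; last by rewrite -addnS.
    by apply: IH; rewrite (leq_trans _ hj) // addnS ltnW.
  by rewrite (leq_trans _ hj) // ltnS leq_addl.
have fE s (i j : 'I_d) : (std_f ^+ s) i j =
    (i == (j + s)%N :> nat)%:R * (lower_coef s j)%:R.
  elim: s i j => [|s IH] i j; first by rewrite expr0 mxE addn0 mulr1.
  rewrite exprS -mulmxE mxE; have [ij|ij] := eqVneq (i : nat) (j + s.+1)%N.
    have hl : (j + s < d)%N by rewrite (leq_trans _ (ltn_ord i)) // ij addnS.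
    rewrite (bigD1 (Ordinal hl)) //= mxE IH /= eqxx mul1r ij addnS eqxx mul1n.
    rewrite big1 ?addr0 => [|l ll]; first by rewrite -natrM mul1r.
    rewrite IH; case: eqP => [lj|]; last by rewrite mul0r mulr0.
    by case/eqP: ll; apply: val_inj.
  rewrite mul0r big1 // => l _; rewrite mxE IH.
  case: eqP => [il|]; last by rewrite mul0n mul0r.
  case: eqP => [lj|]; last by rewrite mul0r mulr0.
  by case/eqP: ij; rewrite il lj addnS.
have top k : (k < d)%N -> A (inord 0) (inord k) = 0.
  move=> kd; have := trA k kd.
  rewrite (_ : \tr _ = A (inord 0) (inord k) * trace_coef k).
    by move/eqP; rewrite mulf_eq0 (negbTE (trace_coef_neq0 kd)) orbF => /eqP.
  rewrite /trace_coef natr_sum mulr_sumr [RHS]big_mkcond; apply: eq_bigr => i _.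
  rewrite mxE; case: ltnP => ik; last first.
    rewrite big1 // => l _; rewrite fE; case: eqP => [li|]; last by rewrite mul0r mulr0.
    by move: ik; rewrite -li leqNgt ltn_ord.
  rewrite (bigD1 (Ordinal ik)) //= fE eqxx mul1r big1 ?addr0 => [|l ll].
    rewrite -(diag k i); last by rewrite addnC.
    by congr (A _ _ * _); apply: val_inj; rewrite /= ?inordK // addnC.
  rewrite fE; case: eqP => [li|]; last by rewrite mul0r mulr0.
  by case/eqP: ll; apply: val_inj.
apply/matrixP => i j; rewrite mxE -(inord_val i) -(inord_val j).
have [ij|ij] := ltnP j i; first exact: low.
by rewrite -(subnK ij) diag ?subnK // top // (leq_trans _ (ltn_ord j)) // ltnS leq_subr.
Qed.

End StandardRepresentation.

(** * Classification of the irreducible representations *)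

Section IrreducibleRepresentation.
Variables (C : numClosedFieldType) (n : nat).
Local Notation d := n.+1.
Variable rho : sl2 C -> 'M[C]_d.
Hypothesis rho_lin : forall a X Y, rho (a *: X + Y) = a *: rho X + rho Y.
Hypothesis rho_bracket : forall X Y,
  rho (bracket X Y) = rho X *m rho Y - rho Y *m rho X.

Local Notation e := (rho (sl2E C)).
Local Notation f := (rho (sl2F C)).
Local Notation h := (rho (sl2H C)).

Lemma rhoZ a X : rho (a *: X) = a *: rho X.
Proof.
have r0 : rho 0 = 0 by have := rho_lin (-1) 0 0; rewrite scaler0 addr0 scaleN1r addNr.
by rewrite -[in LHS](addr0 (a *: X)) rho_lin r0 addr0.
Qed.

Lemma rhoD X Y : rho (X + Y) = rho X + rho Y.
Proof. by rewrite -[X in LHS]scale1r rho_lin scale1r. Qed.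

Lemma rho_decomp X : rho X = (X : 'M_2) 0 0 *: h + (X : 'M_2) 0 1 *: e
   + (X : 'M_2) 1 0 *: f.
Proof. by rewrite {1}(sl2_decomp X) !rhoD !rhoZ. Qed.

Lemma bracket_std : (bracket (sl2H C) (sl2E C) = 2%:R *: sl2E C) *
  (bracket (sl2H C) (sl2F C) = - 2%:R *: sl2F C) *
  (bracket (sl2E C) (sl2F C) = sl2H C).
Proof.
by split; [split|]; apply/sl2P/mx2P; rewrite bracketE ?sl2ZE !mxE !sum_ord2 !mxE /=; ring.
Qed.

Lemma rel_he : h *m e = e *m h + 2%:R *: e.
Proof. by rewrite -rhoZ -bracket_std.1.1 rho_bracket addrCA subrr addr0. Qed.
Lemma rel_hf : h *m f = f *m h - 2%:R *: f.
Proof. by rewrite -scaleNr -rhoZ -bracket_std.1.2 rho_bracket addrCA subrr addr0. Qed.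
Lemma rel_ef : f *m e = e *m f - h.
Proof. by rewrite -bracket_std.2 rho_bracket opprB addrCA subrr addr0. Qed.

(** The powers of [A] are eigenvectors of [ad h] with distinct eigenvalues. *)
Lemma nilpotent_of_weight (A : 'M[C]_d) (c : C) : c != 0 ->
  h *m A = A *m h + c *: A -> exists k, A ^+ k = 0.
Proof.
move=> c0 hA.
have hAk k : h *m A ^+ k = A ^+ k *m h + (c * k%:R) *: A ^+ k.
  elim: k => [|k IH]; first by rewrite expr0 mulr0 scale0r addr0 mulmx1 mul1mx.
  rewrite exprSr -mulmxE mulmxA IH mulmxDl -[A ^+ k *m h *m A]mulmxA hA.
  rewrite mulmxDr mulmxA -scalemxAr -scalemxAl -addrA -scalerDl.
  by congr (_ + _ *: _); rewrite -[in RHS](addn1 k) natrD; ring.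
pose M := lin_mulmx h - lin_mulmxr h : 'M[C]_(d * d).
have [|k _] := @eigen_progression C _ M (fun k => mxvec (A ^+ k)) 0 c c0.
  move=> k; rewrite mulmxBr !mul_vec_lin /= hAk linearD linearZ /=.
  by rewrite addrAC subrr !add0r.
by move=> /(congr1 (@vec_mx _ _ _)); rewrite mxvecK raddf0 => ?; exists k.
Qed.

Lemma e_nilpotent : exists k, e ^+ k = 0.
Proof. by apply: (nilpotent_of_weight (c := 2%:R)); rewrite ?pnatr_eq0 // rel_he. Qed.
Lemma f_nilpotent : exists k, f ^+ k = 0.
Proof.
by apply: (nilpotent_of_weight (c := - 2%:R)); rewrite ?oppr_eq0 ?pnatr_eq0 // rel_hf scaleNr.
Qed.

Lemma eigenvector_exists (p : nat) (M : 'M[C]_p.+1) :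
  exists (a : C) (v : 'cV[C]_p.+1), v != 0 /\ M *m v = a *: v.
Proof.
have /closed_rootP[a] : size (char_poly M^T) != 1 by rewrite size_char_poly.
rewrite -eigenvalue_root_char => /eigenvalueP[w hw w0].
exists a, w^T; split; first by rewrite -(inj_eq (@trmx_inj _ _ _)) trmxK trmx0.
by rewrite -[M]trmxK -trmx_mul hw linearZ.
Qed.

(** A lowest weight vector. *)
Lemma lowest_weight_vector : exists (mu : C) (w : 'cV[C]_d),
  [/\ w != 0, f *m w = 0 & h *m w = mu *: w].
Proof.
have [a [v [v0 hv]]] := eigenvector_exists h.
have hk k : h *m (f ^+ k *m v) = (a - 2%:R * k%:R) *: (f ^+ k *m v).
  elim: k => [|k IH]; first by rewrite expr0 mul1mx mulr0 subr0.
  rewrite exprS -mulmxE -[f *m _ *m v]mulmxA mulmxA rel_hf mulmxBl -mulmxA IH.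
  rewrite -scalemxAr -scalemxAl -scalerBl; congr (_ *: _).
  by rewrite -[in RHS](addn1 k) natrD; ring.
have [k0 fk0] := f_nilpotent.
have exk : exists k, f ^+ k *m v == 0 by exists k0; rewrite fk0 mul0mx.
case: (ex_minnP exk) => -[|k] /eqP fk mink.
  by move: v0; rewrite -(mul1mx v) -[1%:M]/(f ^+ 0) fk eqxx.
exists (a - 2%:R * k%:R), (f ^+ k *m v); split=> //.
  by apply/negP => /mink; rewrite ltnn.
by rewrite mulmxA mulmxE -exprS fk.
Qed.

Hypothesis rho_irr : forall U : {vspace 'cV[C]_d},
  (forall X v, v \in U -> rho X *m v \in U) -> U = 0%VS \/ U = fullv.

(** An irreducible representation is conjugate to the standard one: the chain
    [e ^ k w] that starts at a lowest weight vector [w] spans an invariant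
    subspace. *)
Theorem rho_std : exists2 P : 'M[C]_d, P \in unitmx &
  forall X, rho X *m P = P *m std_rep n X.
Proof.
have [mu [w [w0 fw hw]]] := lowest_weight_vector.
pose x k := e ^+ k *m w.
have xS k : e *m x k = x k.+1 by rewrite /x exprS mulmxA mulmxE.
have hx k : h *m x k = (mu + 2%:R * k%:R) *: x k.
  elim: k => [|k IH]; first by rewrite /x expr0 mul1mx mulr0 addr0.
  rewrite -xS mulmxA rel_he mulmxDl -mulmxA IH -scalemxAr -scalemxAl -scalerDl.
  by congr (_ *: _); rewrite -[in RHS](addn1 k) natrD; ring.
have fx k : f *m x k.+1 = - (k.+1%:R * (mu + k%:R)) *: x k.
  elim: k => [|k IH].
    rewrite -xS mulmxA rel_ef mulmxBl -mulmxA /x expr0 mul1mx fw mulmx0 hw sub0r.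
    by rewrite addr0 mul1r scaleNr.
  rewrite -[x k.+2]xS mulmxA rel_ef mulmxBl -mulmxA IH hx -scalemxAr xS -scalerBl.
  by congr (_ *: _); rewrite -[k.+2]addn1 -[k.+1]addn1 !natrD; ring.
have [k0 ek0] := e_nilpotent.
have exk : exists k, x k == 0 by exists k0; rewrite /x ek0 mul0mx.
have x0 : x 0%N = w by rewrite /x expr0 mul1mx.
clearbody x; case: (ex_minnP exk) => -[|k] /eqP xk mink.
  by move: w0; rewrite -x0 xk eqxx.
have xk0 : x k != 0 by apply/negP => /mink; rewrite ltnn.
(* The end of the chain determines the lowest weight. *)
have muE : mu = - k%:R.
  have := fx k; rewrite xk mulmx0 => /esym/eqP; rewrite scaler_eq0 (negbTE xk0) orbF.
  by rewrite oppr_eq0 mulf_eq0 pnatr_eq0 /= addr_eq0 => /eqP.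
have kn : (k <= n)%N.
  have [||j jd xj] := @eigen_progression C d h^T (fun k => (x k)^T) mu 2%:R.
  - by rewrite pnatr_eq0.
  - by move=> j; rewrite -trmx_mul hx linearZ.
  have /mink kj : x j == 0 by rewrite -(inj_eq (@trmx_inj _ _ _)) xj trmx0.
  exact: leq_trans kj jd.
(* The chain in reverse order, which is the order of the standard basis. *)
pose Y : 'M[C]_(d, k.+1) := \matrix_(i, j) x (k - j)%N i 0.
have colY (A : 'M[C]_d) i j : (A *m Y) i j = (A *m x (k - j)%N) i 0.
  by rewrite !mxE; apply: eq_bigr => l _; rewrite mxE.
have eY : e *m Y = Y *m std_e C k.
  apply/matrixP => i j; rewrite colY xS mul_std_eE.
  case ej: (nat_of_ord j) => [|j']; first by rewrite subn0 xk mxE.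
  have jk : (j' < k)%N by have := ltn_ord j; rewrite ej.
  rewrite mxE inordK /=; last by lia.
  by congr (x _ i 0); lia.
have hY : h *m Y = Y *m std_h C k.
  apply/matrixP => i j; rewrite colY hx !mxE (bigD1 j) //= !mxE eqxx.
  rewrite big1 ?addr0 => [|l lj]; last by rewrite !mxE (negbTE lj) mul0r mulr0.
  have e1 : (k - j)%N%:R = k%:R - j%:R :> C by rewrite natrB // -ltnS.
  by rewrite muE e1 -muln2 natrM mulr1n; ring.
have fY : f *m Y = Y *m std_f C k.
  apply/matrixP => i j; rewrite colY [in RHS]mxE.
  have [jk|jk] := ltnP j k; last first.
    have -> : (k - j = 0)%N by apply/eqP.
    rewrite x0 fw mxE big1 // => l _; rewrite !mxE.
    have -> : (l == j.+1 :> nat) = false by have := ltn_ord l; lia.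
    by rewrite mul0n mulr0.
  rewrite (bigD1 (inord j.+1)) //= [X in X * _]mxE [X in _ * X + _]mxE inordK //.
  rewrite eqxx mul1n [X in _ + X]big1 ?addr0 => [|l lj]; last first.
    rewrite !mxE; case: eqP => [lj'|]; last by rewrite mul0n mulr0.
    by case/eqP: lj; apply: val_inj; rewrite /= inordK // -lj'.
  have -> : (k - j = (k - j.+1).+1)%N by lia.
  rewrite fx mxE muE mulrC; congr (_ * _).
  have kE : k = (k - j.+1 + j + 1)%N by lia.
  have -> : k%:R = (k - j.+1)%N%:R + j%:R + 1 :> C by rewrite [in LHS]kE !natrD.
  by rewrite natrM -[(k - j.+1).+1]addn1 -[j.+1 in X in _ = X * _]addn1 !natrD; ring.
have rhoY X : rho X *m Y = Y *m std_rep k X.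
  rewrite rho_decomp /std_rep !mulmxDl !mulmxDr -!scalemxAl -!scalemxAr.
  by rewrite eY hY fY.
pose L := linfun (mulmx Y : 'cV[C]_k.+1 -> 'cV[C]_d).
have LE c : L c = Y *m c by rewrite lfunE.
have [|U0|Ufull] := rho_irr (U := limg L).
- move=> X v /memv_imgP[c _ ->]; rewrite LE mulmxA rhoY -mulmxA -LE.
  by rewrite memv_img ?memvf.
- have : L (delta_mx 0 0) \in limg L by rewrite memv_img ?memvf.
  rewrite U0 memv0 LE -colE => /eqP c0; move: xk0.
  suff -> : x k = col 0 Y by rewrite c0 eqxx.
  by apply/matrixP => i j; rewrite ord1 !mxE subn0.
have surj (u : 'cV[C]_d) : exists c, Y *m c = u.
  have : u \in limg L by rewrite Ufull memvf.
  by move=> /memv_imgP[c _ ->]; exists c; rewrite LE.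
have /fin_all_exists[c hc] := fun i : 'I_d => surj (delta_mx i 0).
pose Q : 'M[C]_(k.+1, d) := \matrix_(i, j) c j i 0.
have YQ : Y *m Q = 1%:M.
  apply/matrixP => i j; have := congr1 (fun M : 'cV_d => M i 0) (hc j).
  rewrite !mxE eqxx andbT => <-; apply: eq_bigr => l _.
  by rewrite !mxE.
have kn' : k = n.
  apply/eqP; rewrite eqn_leq kn /= -ltnS -[X in (X <= _)%N](mxrank1 C d) -YQ.
  by rewrite (leq_trans (mxrankM_maxl _ _)) // rank_leq_col.
clear -YQ rhoY kn'; clearbody Q; clearbody Y; subst k.
by exists Y => //; case/mulmx1_unit: YQ.
Qed.

End IrreducibleRepresentation.

(** * Traces against powers of nilpotent elements *)

Section TraceForms.
Variables (C : numClosedFieldType) (n : nat).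
Local Notation d := n.+1.

Lemma conj_mx_prod (U : 'M[C]_d) (T : Type) (ws : seq T) (F : T -> 'M[C]_d) :
  U \in unitmx ->
  \prod_(w <- ws) (U *m F w *m invmx U) = U *m (\prod_(w <- ws) F w) *m invmx U.
Proof.
move=> hU; elim: ws => [|w ws IH]; first by rewrite !big_nil mulmx1 mulmxV.
by rewrite !big_cons IH -!mulmxE !mulmxA mulmxKV.
Qed.

Lemma conj_mx_exp (U A : 'M[C]_d) s : U \in unitmx ->
  (U *m A *m invmx U) ^+ s = U *m A ^+ s *m invmx U.
Proof.
move=> hU; elim: s => [|s IH]; first by rewrite !expr0 mulmx1 mulmxV.
by rewrite !exprS IH -!mulmxE !mulmxA mulmxKV.
Qed.

Lemma tr_conj_mx (U A : 'M[C]_d) : U \in unitmx -> \tr (U *m A *m invmx U) = \tr A.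
Proof. by move=> hU; rewrite mxtrace_mulC mulmxA mulVmx // mul1mx. Qed.

(** The curve of nilpotent elements through [nilp v] in the direction [E]. *)
Lemma nilp_uE z (v : 'cV[C]_2) : nilp (uE z *m v) =
  (- (z ^+ 2 * (nilp v : 'M_2) 1 0)) *: sl2E C + (z *: bracket (sl2E C) (nilp v) + nilp v).
Proof.
apply/sl2P/mx2P; rewrite !(sl2DE, sl2ZE, bracketE);
  rewrite !(subE, scalemxE2, addmxE2) !mulmx2E !mksl2E !mulmx2E !uEE; ring.
Qed.

Lemma horner_scalar_mx (p : {poly 'M[C]_d}) (z : C) :
  p.[z%:A] = \sum_(i < size p) z ^+ i *: p`_i.
Proof.
rewrite horner_coef; apply: eq_bigr => i _.
by rewrite exprZn expr1n -scalerAr mulr1.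
Qed.

Lemma comm_poly_scalar (p : {poly 'M[C]_d}) (z : C) : comm_poly p z%:A.
Proof. by rewrite /comm_poly -scalerAl -scalerAr mulr1 mul1r. Qed.

(** If a matrix [A] is orthogonal to all powers of the curve
    [N + z [E, N] + z^2 M], then [[E, A]] is orthogonal to the powers of [N]. *)
Lemma orthogonal_bracket (A N E M : 'M[C]_d) s :
  (forall z : C, \tr (A *m (N + (z *: (E *m N - N *m E) + z ^+ 2 *: M)) ^+ s) = 0) ->
  \tr ((E *m A - A *m E) *m N ^+ s) = 0.
Proof.
move=> hA; pose q : {poly 'M[C]_d} := N%:P + ((E *m N - N *m E) *: 'X + M *: 'X^2).
have q0 : q`_0 = N by rewrite !coefE /= !mulr0 !addr0.
have q1 : q`_1 = E * N - N * E by rewrite !coefE /= add0r mulr1 mulr0 addr0.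
have qs0 k : (q ^+ k)`_0 = N ^+ k.
  by elim: k => [|k IH]; rewrite ?expr0 ?coef1 // !exprS coefM big_ord1 subnn q0 IH.
have qs1 k : (q ^+ k)`_1 = E * N ^+ k - N ^+ k * E.
  elim: k => [|k IH]; first by rewrite !expr0 coef1 mulr1 mul1r subrr.
  rewrite !exprS coefM !big_ord_recl big_ord0 addr0 /= q0 q1 IH qs0.
  by rewrite mulrBr mulrBl !mulrA addrC addrA subrK.
have hq z : (q ^+ s).[z%:A] = (N + (z *: (E *m N - N *m E) + z ^+ 2 *: M)) ^+ s.
  rewrite horner_exp_comm; last exact: comm_poly_scalar.
  congr (_ ^+ _); rewrite /q !(hornerD, hornerC, hornerZ, hornerX, hornerXn).
  by rewrite exprZn expr1n -!scalerAr !mulr1.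
pose U : set 'M[C]_d := [set B | \tr (A *m B) = 0].
have hU : is_subspace U.
  split=> [|a x y Ux Uy]; rewrite /U /=; first by rewrite mulmx0 mxtrace0.
  by rewrite mulmxDr -scalemxAr mxtraceD mxtraceZ Ux Uy mulr0 addr0.
have UQ k : U (q ^+ s)`_k.
  have [ks|sk] := ltnP k (size (q ^+ s)); last by rewrite nth_default //; exact: hU.1.
  apply: (@subspace_coef C 'M[C]_d U _ (fun i : 'I_(size (q ^+ s)) => (q ^+ s)`_i) [::]
    hU _ (Ordinal ks)) => z _.
  by rewrite -horner_scalar_mx hq /U /=.
have := UQ 1%N; rewrite /U /= qs1 -!mulmxE mulmxBr raddfB /= => /eqP.
rewrite subr_eq0 => /eqP h1; rewrite mulmxBl raddfB /= -[A *m E *m _]mulmxA h1.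
rewrite -[E *m A *m _]mulmxA [\tr (E *m _)]mxtrace_mulC.
by rewrite !mulmxA subrr.
Qed.

Lemma subrE (A B : 'M[C]_d) i j : (A - B) i j = A i j - B i j.
Proof. by rewrite !mxE. Qed.

Variable rho : sl2 C -> 'M[C]_d.
Hypothesis rho_lin : forall a X Y, rho (a *: X + Y) = a *: rho X + rho Y.
Hypothesis rho_bracket : forall X Y,
  rho (bracket X Y) = rho X *m rho Y - rho Y *m rho X.
Hypothesis rho_irr : forall U : {vspace 'cV[C]_d},
  (forall X v, v \in U -> rho X *m v \in U) -> U = 0%VS \/ U = fullv.

(** The powers of the matrices of nilpotent elements span all matrices. *)
Theorem nilp_powers_span (A : 'M[C]_d) :
  (forall v s, (s < d)%N -> \tr (A *m rho (nilp v) ^+ s) = 0) -> A = 0.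
Proof.
move=> hA; have [P hP rhoP] := rho_std rho_lin rho_bracket rho_irr.
have conjP B s X : \tr (invmx P *m B *m P *m std_rep n X ^+ s) = \tr (B *m rho X ^+ s).
  have -> : rho X = P *m std_rep n X *m invmx P by rewrite -rhoP mulmxK.
  rewrite conj_mx_exp // !mulmxA [RHS]mxtrace_mulC !mulmxA.
  by [].
pose good (B : 'M[C]_d) := forall v s, (s < d)%N -> \tr (B *m std_rep n (nilp v) ^+ s) = 0.
have goodE B : good B -> good (std_e C n *m B - B *m std_e C n).
  move=> gB v s sd.
  pose M := (- (nilp v : 'M_2) 1 0) *: std_e C n.
  apply: (orthogonal_bracket (M := M)) => z.
  rewrite -[RHS](gB (uE z *m v) s sd); congr (\tr (_ *m _ ^+ _)).
  have std_lin (a : C) (X Y : sl2 C) : std_rep n (a *: X + Y) = a *: std_rep n X + std_rep n Y.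
    rewrite /std_rep !(sl2DE, sl2ZE) !(addmxE2, scalemxE2).
    set H := std_h C n; set E := std_e C n; set F := std_f C n.
    by clearbody H E F; apply/matrixP => i j; rewrite !mxE; ring.
  have std_br (X Y : sl2 C) : std_rep n (bracket X Y) =
      std_rep n X *m std_rep n Y - std_rep n Y *m std_rep n X.
    apply: (can_inj (mulKmx hP)).
    rewrite mulmxBr !mulmxA -!rhoP rho_bracket mulmxBl.
    by rewrite -!mulmxA -!rhoP.
  rewrite nilp_uE !std_lin std_br (std_repE C n).1.1 /M.
  set D := _ - _; set N := std_rep n _; set E := std_e C n; set w := (nilp v : 'M_2) 1 0.
  by clearbody D N E w; apply/matrixP => i j; rewrite !mxE; ring.
(* The set of matrices with this property is stable under [ad e], which
   raises the lowest diagonal that can be nonzero; it remains to treat the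
   matrices that commute with [e]. *)
suff H r (B : 'M[C]_d) : (r <= d.*2)%N -> (forall i j : 'I_d, (j + d < i + (d.*2 - r))%N -> B i
  j = 0) ->
    good B -> B = 0.
  have : invmx P *m A *m P = 0.
    apply: (H d.*2) => //; first by move=> i j; have := ltn_ord i; lia.
    by move=> v s sd; rewrite conjP hA.
  by move=> /(congr1 (mulmx P)); rewrite mulmx0 -!mulmxA mulKVmx // => /(congr1 (mulmxr (invmx
    P))) /=; rewrite mul0mx mulmxK.
elim: r B => [|r IH] B hr hB gB.
  apply/matrixP => i j; rewrite mxE hB //.
  have := ltn_ord i; have := ltn_ord j; lia.
have eB : std_e C n *m B - B *m std_e C n = 0.
  apply: IH; [exact: ltnW| |exact: goodE].
  move=> i j ij; rewrite subrE std_eE mul_std_eE.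
  have -> : (if insub i.+1 is Some i' then B i' j else 0) = 0.
    case: insubP => [i' _ ii'|//]; apply: hB; rewrite ii'; lia.
  case ej: (nat_of_ord j) => [|j']; first by rewrite subrr.
  rewrite hB ?subrr //= inordK; have := ltn_ord j; lia.
(* The lower triangular nilpotent matrix [F] is of the form [nilp v]. *)
apply: commute_e_eq0; first by apply/eqP; rewrite -subr_eq0 eB.
move=> s sd; have := gB (\col_i (if i == 0 then 0 else 'i)) s sd.
rewrite (_ : nilp _ = sl2F C) ?std_repE //.
by apply/sl2P/mx2P; rewrite !mksl2E !mxE /= ?sqrCi ?opprK //; ring.
Qed.

Variable Psi : 'M[C]_2 -> 'M[C]_d.
Hypothesis Psi_unit : forall g, SL2 g -> Psi g \in unitmx.
Hypothesis Psi_rho : forall g X, SL2 g -> Psi g *m rho X *m invmx (Psi g) = rho (Ad g X).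

(** The pairing of products of at most [s] matrices [rho w] with the [s]-th
    powers of the matrices of nilpotent elements. *)
Theorem trace_rho (ws : seq (sl2 C)) (v : 'cV[C]_2) s : (size ws <= s)%N ->
  \tr (\prod_(w <- ws) rho w *m rho (nilp v) ^+ s) =
  if size ws == s then trace_coef C n s * \prod_(w <- ws) \tr ((w : 'M_2) *m nilp v)
  else 0.
Proof.
move=> sws; have [P hP rhoP] := rho_std rho_lin rho_bracket rho_irr.
have rhoE X : rho X = P *m std_rep n X *m invmx P by rewrite -rhoP mulmxK.
have he us : (size us <= s)%N -> \tr (\prod_(w <- us) rho w *m rho (sl2E C) ^+ s) =
    if size us == s then trace_coef C n s * \prod_(w <- us) (w : 'M_2) 1 0 else 0.
  move=> sus; rewrite -(std_trace n sus); under eq_bigr do rewrite rhoE.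
  rewrite rhoE conj_mx_prod // conj_mx_exp // (std_repE C n).1.1.
  by rewrite !mulmxA mulmxKV // mxtrace_mulC !mulmxA mulVmx // mul1mx.
have [->|v0] := eqVneq v 0.
  have n0 : nilp (0 : 'cV[C]_2) = 0.
    by apply/sl2P/mx2P; rewrite !mksl2E !mxE; ring.
  have r0 : rho 0 = 0 by rewrite -(scale0r 0) (rhoZ rho_lin) scale0r.
  case: s sws he => [|s] sws he.
    have ws0 : ws = [::] by case: ws sws.
    by have := he [::] isT; rewrite ws0 !big_nil !expr0.
  rewrite n0 r0 expr0n /= mulmx0 mxtrace0; case: eqP => // sw.
  by case: ws sw sws => // w ws _ _; rewrite big_cons mulmx0 mxtrace0 mul0r mulr0.
(* By equivariance it suffices to consider the first basis vector. *)
have [g hg vg] := SL2_transitive v0.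
have hgi : SL2 (invmx g) by rewrite /SL2 /= det_inv hg invr1.
pose us := [seq Ad (invmx g) w | w <- ws].
have gi X : Ad g (Ad (invmx g) X) = X.
  by rewrite -Ad_mul // mulmxV ?SL2_unit // Ad1.
have sus : size us = size ws by rewrite size_map.
have := he us; rewrite sus => /(_ sws).
have -> : \prod_(w <- us) (w : 'M_2) 1 0 = \prod_(w <- ws) \tr ((w : 'M_2) *m nilp v).
  rewrite big_map; apply: eq_bigr => w _.
  rewrite vg -Ad_nilp // nilp_e0 -[in RHS](gi w) Ad_tr //.
  by rewrite tr2E !mulmx2E !mksl2E; ring.
move=> <-; rewrite big_map -[RHS](tr_conj_mx _ (Psi_unit hg)).
have -> : rho (nilp v) = Psi g *m rho (sl2E C) *m invmx (Psi g).
  by rewrite Psi_rho // -nilp_e0 Ad_nilp // vg.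
have -> : \prod_(w <- ws) rho w =
    Psi g *m (\prod_(w <- ws) rho (Ad (invmx g) w)) *m invmx (Psi g).
  rewrite -conj_mx_prod ?Psi_unit //; apply: eq_bigr => w _.
  by rewrite Psi_rho // gi.
by rewrite conj_mx_exp ?Psi_unit // !mulmxA mulmxKV ?Psi_unit.
Qed.

End TraceForms.

(** * The tangent representation *)

Section TangentRepresentation.
Variables (C : numClosedFieldType) (n : nat).
Local Notation d := n.+1.
Variables (Psi : 'M[C]_2 -> 'M[C]_d) (rho : sl2 C -> 'M[C]_d).
Hypothesis hPsi : is_holomorphic_rep Psi.
Hypothesis hrho : is_tangent_rep Psi rho.

Lemma Psi_unitmx g : SL2 g -> Psi g \in unitmx.
Proof.
move=> hg; have [P1 PM _] := hPsi.
have hgi : SL2 (invmx g) by rewrite /SL2 /= det_inv hg invr1.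
have : Psi g *m Psi (invmx g) = 1%:M by rewrite -PM // mulmxV ?SL2_unit.
by case/mulmx1_unit.
Qed.

Lemma Psi_inv g : SL2 g -> Psi (invmx g) = invmx (Psi g).
Proof.
move=> hg; have [P1 PM _] := hPsi.
have hgi : SL2 (invmx g) by rewrite /SL2 /= det_inv hg invr1.
have h : Psi g *m Psi (invmx g) = 1%:M by rewrite -PM // mulmxV ?SL2_unit.
by rewrite -[RHS]mulmx1 -h mulKmx // Psi_unitmx.
Qed.

Lemma tangent_lin a X Y : rho (a *: X + Y) = a *: rho X + rho Y.
Proof. by have [F _ hF] := hrho; rewrite !hF sl2DE sl2ZE linearP. Qed.

(** Entrywise convergence of matrix functions at [0]. *)
Definition mcvg p q (f : C -> 'M[C]_(p, q)) (L : 'M[C]_(p, q)) : Prop :=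
  forall i j, (fun z => f z i j) @ 0^' --> L i j.

Lemma mcvg_const p q (L : 'M[C]_(p, q)) : mcvg (fun=> L) L.
Proof. by move=> i j; exact: cvg_cst. Qed.

Lemma mcvgD p q (f g : C -> 'M[C]_(p, q)) L M : mcvg f L -> mcvg g M ->
  mcvg (fun z => f z + g z) (L + M).
Proof.
move=> hf hg i j; rewrite mxE; under eq_fun do rewrite mxE.
exact: cvgD (hf i j) (hg i j).
Qed.

Lemma cvg_sum_seq (I : Type) (s : seq I) (F : I -> C -> C) (a : I -> C) :
  (forall i, F i @ 0^' --> a i) ->
  (fun z => \sum_(i <- s) F i z) @ 0^' --> \sum_(i <- s) a i.
Proof.
move=> hF; elim: s => [|i s IH].
  rewrite big_nil (_ : (fun _ => _) = fun=> 0); first exact: cvg_cst.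
  by apply/funext => z; rewrite big_nil.
rewrite big_cons (_ : (fun _ => _) = (fun z => F i z + \sum_(i <- s) F i z)).
  exact: cvgD.
by apply/funext => z; rewrite big_cons.
Qed.

Lemma mcvgM p q r (f : C -> 'M[C]_(p, q)) (g : C -> 'M[C]_(q, r)) L M :
  mcvg f L -> mcvg g M -> mcvg (fun z => f z *m g z) (L *m M).
Proof.
move=> hf hg i j; rewrite mxE; under eq_fun do rewrite mxE.
exact: cvg_sum_seq (fun k => cvgM (hf i k) (hg k j)).
Qed.

Lemma mcvgZ p q (f : C -> 'M[C]_(p, q)) L : mcvg f L ->
  mcvg (fun z => z *: f z) 0.
Proof.
move=> hf i j; rewrite mxE -[X in _ --> X](mul0r (L i j)); under eq_fun do rewrite mxE.
apply: cvgM (hf i j); exact: nbhs_dnbhs.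
Qed.

Lemma mcvg_unique p q (f : C -> 'M[C]_(p, q)) L M : mcvg f L -> mcvg f M -> L = M.
Proof.
move=> hL hM; apply/matrixP => i j.
exact: (cvg_unique (@norm_hausdorff _ _) (hL i j) (hM i j)).
Qed.

Lemma mcvg_near p q (f g : C -> 'M[C]_(p, q)) L :
  (\forall z \near 0^', f z = g z) -> mcvg f L -> mcvg g L.
Proof.
move=> fg hf i j; apply: cvg_trans (hf i j); apply: near_eq_cvg.
by apply: filterS fg => z ->.
Qed.

(** Translates of the identity along a nilpotent direction lie in [SL_2]. *)
Definition upath (N : sl2 C) (z : C) : 'M[C]_2 := 1%:M + z *: (N : 'M_2).

Lemma SL2_upath (N : sl2 C) z : \det (N : 'M_2) = 0 -> SL2 (upath N z).
Proof.
rewrite /SL2 /upath /= !det2E !(addmxE2, scalemxE2) sl2_11 !mxE /= => hN.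
transitivity (1 + z ^+ 2 * 0); last by ring.
by rewrite -hN; ring.
Qed.

(** The difference quotients of the representation along such translates; they
    converge to the values of the tangent representation. *)
Definition quot (N : sl2 C) (z : C) : 'M[C]_d := z^-1 *: (Psi (upath N z) - 1%:M).

Lemma cvg_quot (N : sl2 C) : \det (N : 'M_2) = 0 -> mcvg (quot N) (rho N).
Proof.
move=> hN; have [P1 _ _] := hPsi; have [F hF rhoF] := hrho.
have [dF F1] := nbhs_singleton hF.
have F11 : F 1%:M = 1%:M by rewrite F1 ?P1 // /SL2 /= det1.
have hder : (fun z : C => z^-1 *: ((F \o shift 1%:M) (z *: (N : 'M_2)) - F 1%:M)) @ 0^'
   --> rho N.
  rewrite rhoF -deriveE //.
  have hd := @diff_derivable C 'M[C]_2 'M[C]_d F 1%:M (N : 'M_2) dF.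
  exact: (cvgP _ hd).
have hc i j : (fun z => (z^-1 *: ((F \o shift 1%:M) (z *: (N : 'M_2)) - F 1%:M)) i j) @ 0^'
   --> rho N i j.
  exact: (cvg_comp _ _ hder (@coord_continuous _ _ _ i j (rho N))).
apply: mcvg_near hc.
have hp : (fun z : C => upath N z) @ 0^' --> (1%:M : 'M[C]_2).
  have : (fun z : C => 1%:M + z *: (N : 'M_2)) @ 0^'
      --> (1%:M + 0 *: (N : 'M[C]_2) : 'M[C]_2).
    apply: cvgD; first exact: cvg_cst.
    by apply: cvgZ; [exact: nbhs_dnbhs|exact: cvg_cst].
  by rewrite scale0r addr0.
have h : \forall z \near (0 : C)^', differentiable F (upath N z) /\
    (SL2 (upath N z) -> F (upath N z) = Psi (upath N z)) := hp _ hF.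
apply: filterS h => z [_ hz].
rewrite /quot -hz; last exact: SL2_upath.
congr (_ *: (_ - _)); last exact: F11.
by rewrite /upath /= addrC.
Qed.

Lemma Psi_upath (N : sl2 C) z : z != 0 -> Psi (upath N z) = 1%:M + z *: quot N z.
Proof. by move=> z0; rewrite /quot scalerA mulfV // scale1r addrC subrK. Qed.

Lemma near0_neq0 : \forall z \near (0 : C)^', z != 0.
Proof. by apply: (@nbhs_dnbhs_neq C 0). Qed.

Lemma cvg_Psi_upath (N : sl2 C) : \det (N : 'M_2) = 0 ->
  mcvg (fun z => Psi (upath N z)) 1%:M.
Proof.
move=> hN; rewrite -[X in mcvg _ X]addr0.
have h := mcvgD (@mcvg_const _ _ (1%:M : 'M[C]_d)) (mcvgZ (cvg_quot hN)).
apply: (@mcvg_near _ _ _ _ _ _ h).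
by apply: filterS near0_neq0 => z z0; rewrite Psi_upath.
Qed.

(** Every traceless matrix is a combination of nilpotent ones. *)
Lemma nilpotent_ind (Q : sl2 C -> Prop) :
  (forall a X Y, Q X -> Q Y -> Q (a *: X + Y)) ->
  (forall N : sl2 C, \det (N : 'M_2) = 0 -> Q N) -> forall X, Q X.
Proof.
move=> QD QN X; pose x := (X : 'M_2) 0 0; pose y := (X : 'M_2) 0 1; pose w := (X : 'M_2) 1 0.
have -> : X = x *: mksl2 1 (-1) 1 + ((x + y) *: sl2E C + ((w - x) *: sl2F C + 0)).
  apply/sl2P/mx2P; rewrite !(sl2DE, sl2ZE, sl20E) !(addmxE2, scalemxE2) !mksl2E !mxE ?sl2_11 /x
    /y /w; ring.
have Q0 : Q 0 by apply: QN; rewrite sl20E det0.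
have QN' a b c : \det (mksl2 a b c : 'M[C]_2) = 0 -> Q (mksl2 a b c) := QN _.
by apply: (QD); [|apply: (QD); [|apply: (QD)]] => //; apply: QN';
  rewrite det2E !mksl2E; ring.
Qed.

Lemma tangent_Ad g X : SL2 g -> Psi g *m rho X *m invmx (Psi g) = rho (Ad g X).
Proof.
move=> hg; have [P1 PM _] := hPsi.
elim/nilpotent_ind: X => [a X Y IHX IHY|N hN].
  rewrite Ad_lin // !tangent_lin mulmxDr mulmxDl -scalemxAr -scalemxAl.
  by rewrite IHX IHY.
have hN' : \det (Ad g N : 'M_2) = 0 by rewrite AdE // !det_mulmx hN mulr0 mul0r.
apply: (mcvg_unique (f := fun z => Psi g *m quot N z *m invmx (Psi g))).
  by apply: mcvgM; [apply: mcvgM; [exact: mcvg_const|exact: cvg_quot]|exact: mcvg_const].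
apply: (@mcvg_near _ _ _ _ _ _ (cvg_quot hN')); apply: nearW => z.
have e : upath (Ad g N) z = g *m upath N z *m invmx g.
  rewrite /upath AdE // mulmxDr mulmxDl mulmx1 mulmxV ?SL2_unit //.
  by rewrite -scalemxAr -scalemxAl.
have hgi : SL2 (invmx g) by rewrite /SL2 /= det_inv (hg : \det g = 1) invr1.
rewrite /quot e !PM //; try exact: SL2_upath; last by apply: SL2_mul => //; exact: SL2_upath.
rewrite Psi_inv // -scalemxAr -scalemxAl mulmxBr mulmxBl mulmx1 mulmxV //.
exact: Psi_unitmx.
Qed.

(** The limit of [(Psi(1 + z N) - 1) / z * rho(Y)], computed directly and by
    means of the equivariance of [rho]. *)
Lemma tangent_bracket X Y : rho (bracket X Y) = rho X *m rho Y - rho Y *m rho X.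
Proof.
elim/nilpotent_ind: X => [a X X' IHX IHX'|N hN].
  have -> : bracket (a *: X + X') Y = a *: bracket X Y + bracket X' Y.
    apply/sl2P; rewrite bracketE !(sl2DE, sl2ZE) !bracketE.
    rewrite mulmxDl mulmxDr -scalemxAl -scalemxAr scalerBr opprD addrACA.
    by [].
  rewrite !tangent_lin IHX IHX' mulmxDl mulmxDr -scalemxAl -scalemxAr scalerBr.
  by rewrite opprD addrACA.
have tN : \tr ((N : 'M_2) *m Y *m N) = 0.
  rewrite mxtrace_mulC mulmxA (_ : (N : 'M_2) *m N = 0) ?mul0mx ?mxtrace0 //.
  move: hN; rewrite det2E sl2_11 => hN.
  apply: mx2P; rewrite !mulmx2E ?sl2_11 mxE; first [ring | rewrite -[RHS]oppr0 -hN; ring].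
have tN' : (N : 'M_2) *m Y *m N \in @traceless C.
  by change (\tr ((N : 'M_2) *m Y *m N) == 0); rewrite tN.
pose NYN : sl2 C := Sl2 tN'.
have AdN z : Ad (upath N z) Y = z *: (bracket N Y - z *: NYN) + Y.
  have hz := SL2_upath z hN; have [i00 i01 i10 i11] := invmx2E hz.
  have uE i j : upath N z i j = (i == j)%:R + z * (N : 'M_2) i j by rewrite !mxE.
  move: (upath N z) hz i00 i01 i10 i11 uE => g hz i00 i01 i10 i11 uE.
  apply/sl2P; rewrite AdE // !(sl2DE, sl2ZE, sl2NE) (_ : sl2_mx NYN = N *m Y *m N) //.
  rewrite bracketE; apply: mx2P; rewrite !(subE, scalemxE2, addmxE2) !mulmx2E ?i00 ?i01 ?i10 ?i11;
    rewrite !uE ?sl2_11 /=; ring.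
pose f z := quot N z *m rho Y.
have h1 : mcvg f (rho N *m rho Y) by apply: mcvgM; [exact: cvg_quot|exact: mcvg_const].
have h2 : mcvg f (rho Y *m rho N + (rho (bracket N Y) + 0) *m 1%:M).
  have h := mcvgD (mcvgM (@mcvg_const _ _ (rho Y)) (cvg_quot hN))
    (mcvgM (mcvgD (@mcvg_const _ _ (rho (bracket N Y))) (mcvgZ (@mcvg_const _ _ (- rho NYN))))
      (cvg_Psi_upath hN)).
  apply: (@mcvg_near _ _ _ _ _ _ h).
  apply: filterS near0_neq0 => z z0.
  have hz : Psi (upath N z) *m rho Y = rho (Ad (upath N z) Y) *m Psi (upath N z).
    have hg := SL2_upath z hN.
    by rewrite -(tangent_Ad Y hg) mulmxKV // Psi_unitmx.
  have rN : rho (bracket N Y - z *: NYN) = rho (bracket N Y) + z *: - rho NYN.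
    rewrite addrC -scaleNr tangent_lin scalerN -scaleNr addrC.
    by [].
  rewrite /f /quot -scalemxAl mulmxBl mul1mx hz AdN tangent_lin rN.
  move: (rho (bracket N Y) + z *: - rho NYN) => B.
  rewrite -scalemxAr mulmxBr mulmx1 mulmxDl -scalemxAl -addrA [RHS]scalerDr scalerA.
  by rewrite mulVf // scale1r [RHS]addrC.
have := mcvg_unique h1 h2; rewrite addr0 mulmx1 => ->.
by rewrite addrC addrA addNr add0r.
Qed.

End TangentRepresentation.

(** * Irreducibility of the tangent representation *)

Section Integration.
(** A numerically closed field [C] that is presented as the complex numbers
    over the real numbers [R]. *)
Variables (R : realType) (C : numClosedFieldType) (io : {rmorphism R -> C}).
Variables (re im : {additive C -> R}).
Hypothesis io_lt : forall x y, (io x < io y) = (x < y).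
Hypothesis io_norm : forall x, `|io x| = io `|x|.
Hypothesis io_pos : forall e : C, 0 < e -> exists2 r, 0 < r & e = io r.
Hypothesis re_scale : forall r z, re (io r * z) = r * re z.
Hypothesis im_scale : forall r z, im (io r * z) = r * im z.
Hypothesis re_norm : forall z, io `|re z| <= `|z|.
Hypothesis im_norm : forall z, io `|im z| <= `|z|.
Hypothesis re_im_inj : forall z w, re z = re w -> im z = im w -> z = w.

Lemma near_real_complex (P : C -> Prop) :
  (\forall z \near (0 : C)^', P z) -> \forall h \near (0 : R)^', P (io h).
Proof.
move=> /nbhs_ballP[e /= e0 eP]; have [r r0 er] := io_pos e0.
apply/nbhs_ballP; exists r => //= h; rewrite /ball /= sub0r normrN => hr h0.
apply: eP => /=; last by rewrite fmorph_eq0.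
by rewrite /ball /= sub0r normrN io_norm er io_lt.
Qed.

(** A function of a real variable with zero derivative is constant; the two
    parts of the values are treated separately. *)
Lemma part_const (p : {additive C -> R}) (phi : R -> C) :
  (forall r z, p (io r * z) = r * p z) -> (forall z, io `|p z| <= `|z|) ->
  (forall x, (fun h : R => (io h)^-1 * (phi (h + x) - phi x)) @ (0 : R)^' --> (0 : C)) ->
  forall x y, p (phi x) = p (phi y).
Proof.
move=> p_scale p_norm hphi x0 y0.
apply: (@is_derive_0_is_cst R (fun r => p (phi r))) => x.
have hc : (fun h : R => h^-1 *: (((fun y => p (phi y)) \o shift x) (h *: 1) - p (phi x)))
    @ (0 : R)^' --> (0 : R).
  apply/cvgr0Pnorm_lt => e e0.
  have e0' : 0 < io e by rewrite -(rmorph0 io) io_lt.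
  have /cvgr0Pnorm_lt/(_ _ e0') := hphi x; apply: filterS => h hh.
  rewrite -io_lt (le_lt_trans _ hh) //.
  rewrite (_ : _ *: _ = p ((io h)^-1 * (phi (h + x) - phi x))) //.
  rewrite -fmorphV p_scale (raddfB p) -[LHS]/(h^-1 * (p (phi (h * 1 + x)) - p (phi x))).
  by rewrite mulr1.
apply: DeriveDef; first exact: (cvgP _ hc).
exact: (cvg_lim (@norm_hausdorff _ _) hc).
Qed.

Lemma complex_const (phi : R -> C) :
  (forall x, (fun h : R => (io h)^-1 * (phi (h + x) - phi x)) @ (0 : R)^' --> (0 : C)) ->
  forall x y, phi x = phi y.
Proof. by move=> hphi x y; apply: re_im_inj; apply: part_const. Qed.

Variable n : nat.
Local Notation d := n.+1.
Variables (Psi : 'M[C]_2 -> 'M[C]_d) (rho : sl2 C -> 'M[C]_d).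
Hypothesis hPsi : is_holomorphic_rep Psi.
Hypothesis hrho : is_tangent_rep Psi rho.

Lemma upathD (N : sl2 C) z w : (N : 'M_2) *m N = 0 ->
  upath N (z + w) = upath N z *m upath N w.
Proof.
move=> N2; rewrite /upath mulmxDl !mulmxDr !mul1mx mulmx1 -scalemxAl -scalemxAr N2.
by rewrite !scaler0 addr0 scalerDl [z *: _ + _]addrC addrA.
Qed.

(** A subspace that is stable under [rho N] with [N] nilpotent is stable under
    the unipotent matrices [Psi (1 + N)]: along the real line, the functions
    [l rho(N)^j Psi(1 + r N) u] have the next one as derivative. *)
Lemma stable_upath (N : sl2 C) (U : {vspace 'cV[C]_d}) u :
  (N : 'M_2) *m N = 0 -> (exists k, rho N ^+ k = 0) ->
  (forall v, v \in U -> rho N *m v \in U) -> u \in U -> Psi (upath N 1) *m u \in U.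
Proof.
move=> N2 [k Nk] hU uU; have [P1 PM _] := hPsi.
have dN : \det (N : 'M_2) = 0.
  apply/eqP; have := congr1 (fun A : 'M[C]_2 => \det A) N2.
  by rewrite det_mulmx det0 => /eqP; rewrite mulf_eq0 orbb.
(* A projection with kernel [U], as a matrix [M]. *)
pose p : 'End('cV[C]_d) := (\1 - projv U)%VF.
have pE v : p v = v - projv U v by rewrite !lfunE /= lfunE /= lfunE.
have pU v : v \in U <-> p v = 0.
  rewrite pE; split=> [vU|/eqP]; first by rewrite projv_id // subrr.
  by rewrite subr_eq0 => /eqP ->; exact: memv_proj.
pose M : 'M[C]_d := \matrix_(i, j) p (delta_mx j 0) i 0.
have ME v : M *m v = p v.
  rewrite [in RHS](matrix_sum_delta v) linear_sum; apply/matrixP => i j.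
  rewrite ord1 mxE summxE; apply: eq_bigr => l _.
  by rewrite big_ord1 linearZ !mxE mulrC.
pose A (r : R) := Psi (upath N (io r)).
have A0 : A 0 = 1%:M by rewrite /A rmorph0 /upath scale0r addr0.
have AD x y : A (x + y) = A x *m A y.
  by rewrite /A rmorphD upathD // PM //; exact: SL2_upath.
have hN j v : v \in U -> rho N ^+ j *m v \in U.
  elim: j => [|j IH] vU; first by rewrite expr0 mul1mx.
  by rewrite exprS -mulmxE -mulmxA hU // IH.
(* Downward induction on the exponent of [rho N]. *)
have H j r : M *m rho N ^+ (k - j) *m A r *m u = 0.
  elim: j r => [|j IH] r; first by rewrite subn0 Nk mulmx0 !mul0mx.
  have [kj|jk] := leqP k j.
    have -> : (k - j.+1 = k - j)%N by lia.
    exact: IH.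
  apply/matrixP => i l; rewrite ord1 [RHS]mxE.
  have z0 : (M *m rho N ^+ (k - j.+1) *m A 0 *m u) i 0 = 0.
    have /pU := hN (k - j.+1)%N _ uU; rewrite -ME => h.
    by rewrite A0 mulmx1 -mulmxA h mxE.
  rewrite -[RHS]z0; pose phi r := (M *m rho N ^+ (k - j.+1) *m A r *m u) i 0.
  apply: (complex_const (phi := phi)) => x.
  pose B := M *m rho N ^+ (k - j.+1).
  have h := @mcvgM C _ _ _ _ _ _ _ (@mcvgM C _ _ _ _ _ _ _
     (@mcvg_const C _ _ B) (cvg_quot hPsi hrho dN)) (@mcvg_const C _ _ (A x *m u)).
  have L0 : B *m rho N *m (A x *m u) = 0.
    rewrite /B -[M *m _ *m rho N]mulmxA mulmxE -exprSr -mulmxE mulmxA.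
    have -> : ((k - j.+1).+1 = k - j)%N by lia.
    exact: IH.
  have := h i 0; rewrite L0 mxE => /cvgr0Pnorm_lt hlim.
  apply/cvgr0Pnorm_lt => e e0; have := near_real_complex (hlim e e0).
  apply: filterS => y; rewrite (_ : (_ *m _) i 0 = (io y)^-1 * (phi (y + x) - phi x)) //.
  have -> : phi (y + x) - phi x = (B *m (A y - 1%:M) *m (A x *m u)) i 0.
    rewrite /phi -/B AD mulmxBr mulmx1 mulmxBl !mulmxA.
    by rewrite [RHS]mxE [X in _ = _ + X]mxE.
  by rewrite /quot -/(A y) -scalemxAr -scalemxAl mxE.
apply/pU; rewrite -ME; have := H k 1; rewrite subnn expr0 mulmx1 -mulmxA.
by rewrite /A rmorph1.
Qed.

Lemma tangent_irreducible : is_irreducible_rep Psi -> forall U : {vspace 'cV[C]_d},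
  (forall X v, v \in U -> rho X *m v \in U) -> U = 0%VS \/ U = fullv.
Proof.
move=> [_ hirr] U hU; apply: hirr => g v hg; have [P1 PM _] := hPsi.
have rlin := tangent_lin hrho; have rbr := tangent_bracket hPsi hrho.
elim/SL2_ind: g / hg v => [z|z|g h hg hh IHg IHh] v vU.
- rewrite (_ : uE z = upath (z *: sl2E C) 1); last by rewrite /upath scale1r sl2ZE.
  apply: stable_upath => //; last by move=> w; exact: hU.
    by apply: mx2P; rewrite sl2ZE !mulmx2E !scalemxE2 !mksl2E !mxE; ring.
  have [k ek] := e_nilpotent rlin rbr; exists k.
  by rewrite (rhoZ rlin) exprZn ek scaler0.
- rewrite (_ : uF z = upath (z *: sl2F C) 1); last by rewrite /upath scale1r sl2ZE.
  apply: stable_upath => //; last by move=> w; exact: hU.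
    by apply: mx2P; rewrite sl2ZE !mulmx2E !scalemxE2 !mksl2E !mxE; ring.
  have [k fk] := f_nilpotent rlin rbr; exists k.
  by rewrite (rhoZ rlin) exprZn fk scaler0.
- by rewrite PM // -mulmxA; apply: IHg; exact: IHh.
Qed.
End Integration.

Section ComplexNumbers.
Variable R : realType.

(** Irreducibility of a representation passes to its tangent representation. *)
Theorem complex_tangent_irreducible (n : nat) (Psi : 'M[R[i]]_2 -> 'M[R[i]]_n.+1)
    (rho : sl2 R[i] -> 'M[R[i]]_n.+1) :
  is_holomorphic_rep Psi -> is_tangent_rep Psi rho -> is_irreducible_rep Psi ->
  forall U : {vspace 'cV[R[i]]_n.+1},
  (forall X v, v \in U -> rho X *m v \in U) -> U = 0%VS \/ U = fullv.
Proof.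
move=> hPsi hrho.
have norm_im (z : R[i]) : real_complex R `|complex.Im z| <= `|z|.
  (* The imaginary part is a real part up to the factor [i]. *)
  have := normc_ge_Re ('i%C * z); rewrite normrM.
  rewrite (_ : `|'i%C| = 1) ?mul1r; last first.
    by rewrite normc_def /= expr0n expr1n /= add0r sqrtr1.
  by case: z => a b; rewrite /= mul0r mul1r sub0r normrN.
apply: (@tangent_irreducible R _ (real_complex R) (@complex.Re R) (@complex.Im R)
  _ _ _ _ _ _ _ _ n Psi rho hPsi hrho).
- by move=> x y; exact: ltcR.
- by move=> x; rewrite normc_def /= expr0n /= addr0 sqrtr_sqr.
- move=> e; rewrite ltcE /= => /andP[/eqP ei er]; exists (complex.Re e) => //.
  by case: e ei er => a b /= ->.
- by move=> r [a b] /=; rewrite mul0r subr0.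
- by move=> r [a b] /=; rewrite mul0r addr0.
- exact: normc_ge_Re.
- exact: norm_im.
- by move=> [a b] [a' b'] /= -> ->.
Qed.
End ComplexNumbers.

(** * Submodules for the general linear group *)

Section GeneralLinearAction.
Variables (C : numClosedFieldType) (m n : nat).
Local Notation d := n.+1.
Local Notation E := (('I_m -> sl2 C) -> 'M[C]_d).
Implicit Types (X : 'I_m -> sl2 C) (c e : 'cV[C]_m) (b : 'M[C]_(m, 2)).

Lemma comb_right_mul X g c : comb (right_mul X g) c = comb X (g *m c).
Proof.
rewrite /comb /right_mul; under eq_bigr do rewrite scaler_sumr.
rewrite exchange_big; apply: eq_bigr => i _; rewrite mxE scaler_suml.
by apply: eq_bigr => j _; rewrite scalerA mulrC.
Qed.

(** Functions of [z] with polynomial dependence on [z]. *)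
Definition poly_family (Q : C -> E) : Prop :=
  exists (I : finType) (k : I -> nat) (A : I -> E),
    forall z, Q z = \sum_i z ^+ k i *: A i.

Lemma poly_family_const (A : E) : poly_family (fun=> A).
Proof. by exists unit, (fun=> 0%N), (fun=> A) => z; rewrite big_const card_unit /= addr0
  scale1r. Qed.

Lemma poly_familyD Q Q' : poly_family Q -> poly_family Q' ->
  poly_family (fun z => Q z + Q' z).
Proof.
move=> [I [k [A hQ]]] [J [l [B hQ']]].
exists (I + J)%type, (fun i => match i with inl i => k i | inr j => l j end),
  (fun i => match i with inl i => A i | inr j => B j end) => z.
by rewrite hQ hQ' big_sumType.
Qed.

Lemma poly_familyM Q Q' : poly_family Q -> poly_family Q' ->
  poly_family (fun z => Q z * Q' z).
Proof.
move=> [I [k [A hQ]]] [J [l [B hQ']]].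
exists (I * J)%type, (fun p => (k p.1 + l p.2)%N), (fun p => A p.1 * B p.2) => z.
rewrite hQ hQ' big_distrlr pair_big /=; apply: eq_bigr => p _.
apply/funext => X; apply/matrixP => i j.
rewrite -[RHS]/((z ^+ (k p.1 + l p.2) *: (A p.1 X *m B p.2 X)) i j) exprD -scalerA.
by rewrite scalemxAr scalemxAl.
Qed.

Lemma poly_family_scale Q : poly_family Q -> poly_family (fun z => z *: Q z).
Proof.
move=> [I [k [A hQ]]]; exists I, (fun i => (k i).+1), A => z.
by rewrite hQ scaler_sumr; apply: eq_bigr => i _; rewrite scalerA -exprS.
Qed.

Lemma poly_familyZ (a : C) Q : poly_family Q -> poly_family (fun z => a *: Q z).
Proof.
move=> [I [k [A hQ]]]; exists I, k, (fun i => a *: A i) => z.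
rewrite hQ scaler_sumr; apply: eq_bigr => i _; rewrite !scalerA; congr (_ *: _).
exact: mulrC.
Qed.

Lemma poly_familyX Q s : poly_family Q -> poly_family (fun z => Q z ^+ s).
Proof.
move=> hQ; elim: s => [|s IH]; first exact: poly_family_const.
have := poly_familyM hQ IH; congr poly_family.
by apply/funext => z; rewrite exprS.
Qed.

Lemma poly_family_sum (I : Type) (r : seq I) (Q : I -> C -> E) :
  (forall i, poly_family (Q i)) -> poly_family (fun z => \sum_(i <- r) Q i z).
Proof.
move=> hQ; elim: r => [|i r IH].
  have := poly_family_const 0; congr poly_family.
  by apply/funext => z; rewrite big_nil.
have := poly_familyD (hQ i) IH; congr poly_family.
by apply/funext => z; rewrite big_cons.
Qed.

(** A subspace that contains all but finitely many members of a polynomial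
    family contains the member at zero, which is a combination of others. *)
Lemma poly_family_limit (U : set E) (Q : C -> E) (bad : seq C) :
  is_subspace U -> poly_family Q -> (forall z, z \notin bad -> U (Q z)) -> U (Q 0).
Proof.
move=> hU [I [k [A hQ]]] UQ.
have [z [w [zbad hw]]] := coef_eval_weights (\max_i k i).+1 0 bad.
suff -> : Q 0 = \sum_j w j *: Q (z j).
  by apply: is_subspace_sum => // j _; apply: is_subspaceZ => //; apply: UQ.
rewrite hQ; under [RHS]eq_bigr do rewrite hQ scaler_sumr.
rewrite exchange_big; apply: eq_bigr => i _ /=.
under eq_bigr do rewrite scalerA; rewrite -scaler_suml hw ?expr0n //.
by rewrite ltnS leq_bigmax.
Qed.

(** All but finitely many shifts of a square matrix are invertible. *)
Lemma unitmx_shift (g : 'M[C]_m) : exists bad : seq C,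
  forall z, z \notin bad -> g + z%:M \in unitmx.
Proof.
have [r hr] := closed_field_poly_normal (char_poly g).
exists [seq - x | x <- r] => z; apply: contraR => hz.
have [v v0 hv] : exists2 v : 'rV[C]_m, v != 0 & v *m (g + z%:M) = 0.
  have : kermx (g + z%:M) != 0 by rewrite kermx_eq0 row_free_unit.
  by case/rowV0Pn => v /sub_kermxP hv v0; exists v.
have : root (char_poly g) (- z).
  rewrite -eigenvalue_root_char; apply/eigenvalueP; exists v => //.
  by apply/eqP; rewrite scaleNr -subr_eq0 opprK -mul_mx_scalar -mulmxDr hv.
rewrite hr rootZ ?lead_coef_eq0 ?monic_neq0 ?char_poly_monic // root_prod_XsubC => hz'.
by apply/mapP; exists (- z) => //; rewrite opprK.
Qed.

(** The span of a family of maps indexed by pairs of coefficient vectors, the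
    columns of the index. *)
Definition fam_span (Fam : 'M[C]_(m, 2) -> E) : set E :=
  [set F | exists r : seq (C * 'M[C]_(m, 2)), F = \sum_(p <- r) p.1 *: Fam p.2].

Lemma gl_act_sum g (I : Type) (r : seq I) (F : I -> E) :
  gl_act g (\sum_(i <- r) F i) = \sum_(i <- r) gl_act g (F i).
Proof. by apply/funext => X; rewrite /gl_act !fct_sumE. Qed.

Lemma fam_span_subspace Fam : is_subspace (fam_span Fam).
Proof.
split; first by exists [::]; rewrite big_nil.
move=> a _ _ [r ->] [r' ->]; exists ([seq (a * p.1, p.2) | p <- r] ++ r').
rewrite big_cat big_map /= scaler_sumr; congr (_ + _).
by apply: eq_bigr => p _; rewrite scalerA.
Qed.

Section Family.
Variable Fam : 'M[C]_(m, 2) -> E.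
Hypothesis FamM : forall g b, gl_act g (Fam b) = Fam (g *m b).
Hypothesis FamP : forall b b', poly_family (fun z => Fam (b + z *: b')).

Lemma fam_span_gl : is_gl_submodule (fam_span Fam).
Proof.
split; first exact: fam_span_subspace.
move=> g _ _ [r ->]; exists [seq (p.1, g *m p.2) | p <- r].
rewrite big_map gl_act_sum; apply: eq_bigr => p _ /=.
by rewrite -FamM.
Qed.

(** Submodules are stable under the action of singular matrices. *)
Lemma gl_submodule_singular (U : set E) (F : E) g :
  is_gl_submodule U -> fam_span Fam F -> U F -> U (gl_act g F).
Proof.
move=> [hU Ug] [r ->] UF; have [bad hbad] := unitmx_shift g.
pose Q z := \sum_(p <- r) p.1 *: Fam (g *m p.2 + z *: p.2).
have hQ : poly_family Q by apply: poly_family_sum => p; apply: poly_familyZ.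
have -> : gl_act g (\sum_(p <- r) p.1 *: Fam p.2) = Q 0.
  rewrite gl_act_sum; apply: eq_bigr => p _; rewrite scale0r addr0.
  by rewrite -FamM.
apply: (poly_family_limit hU hQ (bad := bad)) => z /hbad gz.
have := Ug _ _ gz UF; rewrite gl_act_sum; congr U; apply: eq_bigr => p _.
by rewrite -mul_scalar_mx -mulmxDl -FamM.
Qed.

Variable b0 : 'M[C]_(m, 2).
Hypothesis b0_gen : forall b, exists g, g *m b0 = b.

Lemma fam_in_submodule (U : set E) : is_gl_submodule U -> U (Fam b0) ->
  fam_span Fam `<=` U.
Proof.
move=> hU Ub _ [r ->]; apply: is_subspace_sum; first exact: hU.1.
move=> p _; apply: is_subspaceZ; first exact: hU.1.
have [g <-] := b0_gen p.2; rewrite -FamM; apply: gl_submodule_singular => //.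
by exists [:: (1, b0)]; rewrite big_seq1 scale1r.
Qed.

(** The submodule generated by one member whose orbit under all matrices is
    the whole family. *)
Lemma gl_gen_fam : gl_gen (Fam b0) = fam_span Fam.
Proof.
apply/seteqP; split.
  apply: smallest_sub; first exact: fam_span_gl.
  by move=> _ ->; exists [:: (1, b0)]; rewrite big_seq1 scale1r.
move=> F hF U [hU Ub]; apply: (fam_in_submodule hU) hF; exact: Ub.
Qed.
End Family.
End GeneralLinearAction.

(** * The generating families of covariants *)

Section GeneratingFamilies.
Variables (C : numClosedFieldType) (m n : nat).
Local Notation d := n.+1.
Local Notation E := (('I_m -> sl2 C) -> 'M[C]_d).
Variable rho : sl2 C -> 'M[C]_d.
Hypothesis rho_lin : forall a X Y, rho (a *: X + Y) = a *: rho X + rho Y.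
Hypothesis rho_bracket : forall X Y,
  rho (bracket X Y) = rho X *m rho Y - rho Y *m rho X.
Hypothesis rho_irr : forall U : {vspace 'cV[C]_d},
  (forall X v, v \in U -> rho X *m v \in U) -> U = 0%VS \/ U = fullv.
Variable Psi : 'M[C]_2 -> 'M[C]_d.
Hypothesis Psi_unit : forall g, SL2 g -> Psi g \in unitmx.
Hypothesis Psi_rho : forall g X, SL2 g -> Psi g *m rho X *m invmx (Psi g) = rho (Ad g X).
Implicit Types (X : 'I_m -> sl2 C) (b : 'M[C]_(m, 2)).

(** The maps [X |-> rho (c . X) ^ s] and [X |-> rho (c . X) ^ s rho [c . X, e . X]],
    where [c] and [e] are the columns of [b]; the boolean [w] says whether the
    commutator is present. *)
Definition kfam (w : bool) b : E := fun X =>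
  if w then rho (bracket (comb X (col 0 b)) (comb X (col 1 b))) else 1.
Definition pfam s b : E := fun X => rho (comb X (col 0 b)) ^+ s.
Definition fam w s b : E := fun X => pfam s b X *m kfam w b X.

Lemma col_mulmx (g : 'M[C]_m) b j : col j (g *m b) = g *m col j b.
Proof. by apply/colP => i; rewrite !mxE; apply: eq_bigr => k _; rewrite mxE. Qed.

Lemma famM w s g b : gl_act g (fam w s b) = fam w s (g *m b).
Proof.
by apply/funext => X; rewrite /gl_act /fam /pfam /kfam !comb_right_mul !col_mulmx.
Qed.

Lemma rho_comb X c : rho (comb X c) = \sum_k c k 0 *: rho (X k).
Proof.
rewrite /comb; elim/big_rec2: _ => [|k x y _ IH]; first by rewrite -(scale0r 0) (rhoZ rho_lin)
  scale0r.
by rewrite rho_lin IH.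
Qed.

Lemma rho_bracket_comb X c e : rho (bracket (comb X c) (comb X e)) =
  \sum_p \sum_q (c p 0 * e q 0) *: rho (bracket (X p) (X q)).
Proof.
rewrite rho_bracket !rho_comb !mulmx_suml.
under [X in X - _]eq_bigr do rewrite mulmx_sumr.
under [X in _ - X]eq_bigr do rewrite mulmx_sumr.
rewrite [X in _ - X]exchange_big -sumrB; apply: eq_bigr => p _.
rewrite -sumrB; apply: eq_bigr => q _.
rewrite rho_bracket scalerBr -!scalemxAl -!scalemxAr !scalerA.
by rewrite [e q 0 * _]mulrC.
Qed.

Lemma colD b b' z j : col j (b + z *: b') = z *: col j b' + col j b.
Proof. by apply/matrixP => k l; rewrite !mxE addrC. Qed.

Lemma famP w s b b' : poly_family (fun z => fam w s (b + z *: b')).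
Proof.
have lin j : poly_family (fun z X => rho (comb X (col j (b + z *: b')))).
  have := poly_familyD (poly_family_scale (poly_family_const (fun X => rho (comb X (col j b')))))
    (poly_family_const (fun X => rho (comb X (col j b)))).
  congr poly_family; apply/funext => z; apply/funext => X.
  by rewrite colD comb_lin rho_lin.
have -> : (fun z => fam w s (b + z *: b')) =
    (fun z => (fun X => rho (comb X (col 0 (b + z *: b')))) ^+ s * kfam w (b + z *: b')).
  apply/funext => z; apply/funext => X; rewrite /fam /pfam.
  rewrite -[RHS]/(_ X *m _ X); congr (_ *m _).
  by elim: s => [|s IH]; rewrite ?expr0 // !exprS IH.
apply: poly_familyM; first exact: poly_familyX.
case: w; last exact: (poly_family_const (fun=> 1)).
have := poly_familyD (poly_familyM (lin 0) (lin 1))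
  (poly_familyZ (-1) (poly_familyM (lin 1) (lin 0))).
congr poly_family; apply/funext => z; apply/funext => X.
by rewrite scaleN1r /kfam rho_bracket.
Qed.

Lemma homog_map_mul k l (F G : E) : homog_map k F -> homog_map l G ->
  homog_map (k + l) (fun X => F X *m G X).
Proof.
move=> hF hG i j; rewrite (_ : (fun _ => _) = fun X => \sum_p F X i p * G X p j).
  by apply: homog_fun_sum => p _; exact: homog_funM.
by apply/funext => X; rewrite mxE.
Qed.

Lemma homog_map_rho c : homog_map 1 (fun X => rho (comb X c)).
Proof.
move=> i j; rewrite (_ : (fun _ => _) = fun X => \sum_k c k 0 * rho (X k) i j); last first.
  by apply/funext => X; rewrite rho_comb summxE; apply: eq_bigr => k _; rewrite mxE.
apply: homog_fun_sum => k _; apply: homog_funZ.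
rewrite (_ : (fun _ => _) = fun X => (rho (sl2H C) i j * (X k : 'M_2) 0 0 +
   rho (sl2E C) i j * (X k : 'M_2) 0 1) + rho (sl2F C) i j * (X k : 'M_2) 1 0).
  by apply: homog_funD; first apply: homog_funD;
    apply: homog_funZ; exact: homog_fun_entry.
apply/funext => X; rewrite {1}(sl2_decomp (X k)) !(rhoD rho_lin) !(rhoZ rho_lin).
by rewrite !mxE; ring.
Qed.

Lemma homog_fam (w : bool) s b : homog_map (s + w.*2) (fam w s b).
Proof.
apply: homog_map_mul.
  elim: s => [|s IH]; first by move=> i j; rewrite /pfam /=; exact: homog_fun_const.
  have := homog_map_mul (homog_map_rho (col 0 b)) IH; congr homog_map.
  by apply/funext => X; rewrite /pfam exprS.
case: w => /=; last by move=> i j; exact: homog_fun_const.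
move=> i j; rewrite (_ : (fun _ => _) = fun X =>
  (rho (comb X (col 0 b)) *m rho (comb X (col 1 b))) i j +
  -1 * (rho (comb X (col 1 b)) *m rho (comb X (col 0 b))) i j).
  apply: homog_funD; last apply: homog_funZ.
    exact: (homog_map_mul (homog_map_rho _) (homog_map_rho _)).
  exact: (homog_map_mul (homog_map_rho _) (homog_map_rho _)).
by apply/funext => X; rewrite /kfam rho_bracket mulN1r !mxE.
Qed.

Lemma covariants_fam w s b : covariants Psi (fam w s b).
Proof.
split=> [i j|g X hg]; first exact: homog_poly (homog_fam w s b i j).
have hc c : rho (comb (fun k => Ad g (X k)) c) = Psi g *m rho (comb X c) *m invmx (Psi g).
  by rewrite Ad_comb // Psi_rho.
rewrite /fam /pfam hc conj_mx_exp ?Psi_unit // -!mulmxA; congr (_ *m (_ *m _)).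
rewrite /kfam; case: w; last by rewrite mulmx1 mul1mx.
have hm c e : (Psi g *m rho (comb X c) *m invmx (Psi g)) *m
    (Psi g *m rho (comb X e) *m invmx (Psi g)) =
    Psi g *m (rho (comb X c) *m rho (comb X e)) *m invmx (Psi g).
  by rewrite !mulmxA mulmxKV // Psi_unit.
rewrite !rho_bracket !hc !hm -mulmxBl -mulmxBr mulmxA mulKmx ?mulmxA //.
exact: Psi_unit.
Qed.

End GeneratingFamilies.

(** * Linear relations in the families, and symbols *)

Section Irreducibility.
Variables (C : numClosedFieldType) (m n : nat).
Local Notation d := n.+1.
Local Notation E := (('I_m -> sl2 C) -> 'M[C]_d).
Variable rho : sl2 C -> 'M[C]_d.
Hypothesis rho_lin : forall a X Y, rho (a *: X + Y) = a *: rho X + rho Y.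
Hypothesis rho_bracket : forall X Y,
  rho (bracket X Y) = rho X *m rho Y - rho Y *m rho X.
Hypothesis rho_irr : forall U : {vspace 'cV[C]_d},
  (forall X v, v \in U -> rho X *m v \in U) -> U = 0%VS \/ U = fullv.
Variable Psi : 'M[C]_2 -> 'M[C]_d.
Hypothesis Psi_unit : forall g, SL2 g -> Psi g \in unitmx.
Hypothesis Psi_rho : forall g X, SL2 g -> Psi g *m rho X *m invmx (Psi g) = rho (Ad g X).
Implicit Types (X : 'I_m -> sl2 C) (b : 'M[C]_(m, 2)).
Local Notation fam := (fam rho).
Local Notation pfam := (pfam rho).
Local Notation kfam := (kfam rho).

(** The pairing of a coefficient vector with the first column of an index, and
    the pairing of two coefficient vectors with its minors. *)
Definition dot (c : 'cV[C]_m) b : C := \sum_k c k 0 * b k 0.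
Definition wdg (c e : 'cV[C]_m) b : C :=
  dot c b * (\sum_k e k 0 * b k 1) - dot e b * (\sum_k c k 0 * b k 1).

Lemma lin_sum (z : C) (c c' : 'cV[C]_m) (y : 'I_m -> C) :
  \sum_k (z *: c + c') k 0 * y k = z * (\sum_k c k 0 * y k) + \sum_k c' k 0 * y k.
Proof.
rewrite mulr_sumr -big_split; apply: eq_bigr => k _.
by rewrite !mxE mulrDl mulrA.
Qed.

Lemma dot_lin (z : C) c c' b : dot (z *: c + c') b = z * dot c b + dot c' b.
Proof. exact: lin_sum. Qed.

Lemma wdg_lin (z : C) c c' e b : wdg (z *: c + c') e b = z * wdg c e b + wdg c' e b.
Proof. by rewrite /wdg dot_lin lin_sum; ring. Qed.

Lemma dot_delta k b : dot (delta_mx k 0) b = b k 0.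
Proof.
rewrite /dot (bigD1 k) //= mxE !eqxx mul1r big1 ?addr0 // => i ik.
by rewrite mxE (negbTE ik) mul0r.
Qed.

Lemma wdg_delta p q b : wdg (delta_mx p 0) (delta_mx q 0) b =
  b p 0 * b q 1 - b q 0 * b p 1.
Proof.
have h k : \sum_i (delta_mx k 0 : 'cV[C]_m) i 0 * b i 1 = b k 1.
  rewrite (bigD1 k) //= mxE !eqxx mul1r big1 ?addr0 // => i ik.
  by rewrite mxE (negbTE ik) mul0r.
by rewrite /wdg !dot_delta !h.
Qed.

(** The coordinate functions of the family. *)
Definition cfam (w : bool) s (c e : 'cV[C]_m) b : C :=
  dot c b ^+ s * (if w then wdg c e b else 1).

Lemma kfam_wdg b X : kfam true b X = \sum_p \sum_q
  (2%:R^-1 * wdg (delta_mx p 0) (delta_mx q 0) b) *: rho (bracket (X p) (X q)).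
Proof.
have brN (Y Z : sl2 C) : rho (bracket Y Z) = - rho (bracket Z Y).
  by rewrite !rho_bracket opprB.
pose S := \sum_p \sum_q (b p 0 * b q 1) *: rho (bracket (X p) (X q)).
have kS : kfam true b X = S.
  rewrite /kfam (rho_bracket_comb rho_lin rho_bracket).
  by apply: eq_bigr => p _; apply: eq_bigr => q _; rewrite !mxE.
have kS' : S = - \sum_p \sum_q (b q 0 * b p 1) *: rho (bracket (X p) (X q)).
  rewrite /S exchange_big -sumrN; apply: eq_bigr => p _.
  by rewrite -sumrN; apply: eq_bigr => q _; rewrite brN scalerN.
rewrite kS -[LHS](scale1r) -[1 in LHS](@mulVf C 2%:R) ?pnatr_eq0 // -scalerA scaler_nat mulr2n.
rewrite [X in _ *: (_ + X)]kS' /S -sumrB scaler_sumr; apply: eq_bigr => p _.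
rewrite -sumrB scaler_sumr; apply: eq_bigr => q _.
by rewrite -scalerBl scalerA wdg_delta.
Qed.

(** The entries of [rho (X_c) ^ s] are sums of products of [s] linear functions
    of [c]. *)
Lemma pfam_entry (U : set ('M[C]_(m, 2) -> C^o)) s (psi : 'M[C]_(m, 2) -> C) X i j :
  is_subspace U ->
  (forall cs, size cs = s -> U (fun b => \prod_(c <- cs) dot c b * psi b)) ->
  U (fun b => pfam s b X i j * psi b).
Proof.
move=> hU; elim: s psi i => [|s IH] psi i hpsi.
  have := is_subspaceZ ((1%:M : 'M[C]_d) i j) hU (hpsi [::] erefl).
  congr U; apply/funext => b.
  by rewrite -[LHS]/(_ * (\prod_(c <- [::]) dot c b * psi b)) big_nil mul1r.
rewrite (_ : (fun _ => _) = \sum_k (fun b => pfam s b X k j *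
    (dot (\col_l rho (X l) i k) b * psi b) : C^o)).
  apply: is_subspace_sum => // k _; apply: IH => cs scs.
  have := hpsi (\col_l rho (X l) i k :: cs); rewrite /= scs => /(_ erefl).
  congr U; apply/funext => b; rewrite big_cons; ring.
apply/funext => b; rewrite fct_sumE /pfam exprS -mulmxE mxE mulr_suml.
apply: eq_bigr => k _; rewrite (rho_comb rho_lin) summxE.
rewrite (_ : dot _ b = \sum_l (col 0 b l 0 *: rho (X l)) i k); first by ring.
by rewrite /dot; apply: eq_bigr => l _; rewrite !mxE mulrC.
Qed.

(** A linear relation between the coordinate functions at some points is also
    one between the members of the family. *)
Lemma fam_relation (w : bool) s (r : seq (C * 'M[C]_(m, 2))) :
  (forall c e, \sum_(p <- r) p.1 * cfam w s c e p.2 = 0) ->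
  \sum_(p <- r) p.1 *: fam w s p.2 = 0.
Proof.
move=> hr; pose U : set ('M[C]_(m, 2) -> C^o) := [set f | \sum_(p <- r) p.1 * f p.2 = 0].
have hU : is_subspace U.
  split=> [|z f g Uf Ug]; rewrite /U /=.
    by rewrite big1 // => p _; rewrite mulr0.
  under eq_bigr do rewrite fct_lcombE mulrDr mulrCA.
  by rewrite big_split /= -mulr_sumr Uf Ug mulr0 addr0.
have Ucol c e : U (fun b => cfam w s c e b) by exact: hr.
(* Polarisation of the hypothesis. *)
have Uprod X (k j : 'I_d) cs : size cs = s ->
    U (fun b => \prod_(c <- cs) dot c b * kfam w b X k j).
  case: w hr Ucol => hr Ucol scs; last first.
    rewrite (_ : (fun _ => _) = ((1%:M : 'M[C]_d) k j *: (fun b => \prod_(c <- cs) dot c b : C^o))).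
      apply: is_subspaceZ => //; apply: polarize_powers scs => //.
        by move=> *; exact: dot_lin.
      move=> c; have := Ucol c 0; congr U; apply/funext => b.
      by rewrite /cfam mulr1.
    by apply/funext => b; rewrite mulrC.
  rewrite (_ : (fun _ => _) = \sum_p \sum_q (2%:R^-1 * rho (bracket (X p) (X q)) k j) *:
      (fun b => \prod_(c <- cs) dot c b * wdg (delta_mx p 0) (delta_mx q 0) b : C^o)).
    apply: is_subspace_sum => // p _; apply: is_subspace_sum => // q _.
    apply: is_subspaceZ => //; apply: (polarize_wedge (tau := dot) (sigma := wdg)) scs => //.
    - by move=> *; exact: dot_lin.
    - by move=> *; exact: wdg_lin.
    - by move=> x y b; rewrite /wdg opprB.
    - by move=> x y z b; rewrite /wdg; ring.
  apply/funext => b; rewrite fct_sumE kfam_wdg summxE mulr_sumr.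
  apply: eq_bigr => p _; rewrite fct_sumE summxE mulr_sumr; apply: eq_bigr => q _.
  rewrite [(_ *: rho _) k j]mxE.
  by rewrite -[RHS]/(_ * rho _ k j * (_ * _)); ring.
apply/funext => X; apply/matrixP => i j.
rewrite fct_sumE summxE [RHS]mxE.
suff : U (fun b => fam w s b X i j).
  rewrite /U /= => h; rewrite -[RHS]h; apply: eq_bigr => p _.
  by rewrite -[LHS]/((p.1 *: fam w s p.2 X) i j) mxE.
rewrite (_ : (fun _ => _) = \sum_k (fun b => pfam s b X i k * kfam w b X k j : C^o)).
  by apply: is_subspace_sum => // k _; apply: pfam_entry => // cs; apply: Uprod.
by apply/funext => b; rewrite fct_sumE /fam mxE.
Qed.

(** The symbol of order [k] of a map. *)
Definition symb k (F : E) X v : C := \tr (F X *m rho (nilp v) ^+ k).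

Lemma symb_fam (w : bool) s b k X v : (s + w <= k)%N ->
  symb k (fam w s b) X v =
  if (s + w)%N == k then trace_coef C n k * (tau (col 0 b) X v ^+ s *
    (if w then sigma (col 0 b) (col 1 b) X v else 1)) else 0.
Proof.
pose ws := nseq s (comb X (col 0 b)) ++
  (if w then [:: bracket (comb X (col 0 b)) (comb X (col 1 b))] else [::]).
have sws : size ws = (s + w)%N by rewrite size_cat size_nseq; case: (w).
have hws : \prod_(x <- ws) rho x = fam w s b X.
  rewrite big_cat /= big_nseq -mulmxE /fam /pfam /kfam; congr (_ *m _).
    by elim: s {ws sws} => [|s IH] //=; rewrite IH exprS.
  by case: (w); rewrite mulmxE ?big_seq1 ?big_nil.
rewrite /symb -hws -sws => sk.
rewrite (trace_rho rho_lin rho_bracket rho_irr Psi_unit Psi_rho v sk).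
case: ifP => // _; congr (_ * _); rewrite big_cat big_nseq; congr (_ * _).
  by elim: s {ws sws hws sk} => [|s IH] //; rewrite iterS IH exprS.
by case: (w); rewrite ?big_seq1 ?big_nil.
Qed.

Hypothesis hm : (1 < m)%N.

(** The index of the generators [t_1 ^ s] and [t_1 ^ s [t_1, t_2]]. *)
Definition base_index : 'M[C]_(m, 2) := \matrix_(k, j) (k == widen_ord hm j)%:R.
Local Notation b0 := base_index.

Lemma col_base j : col j b0 = delta_mx (widen_ord hm j) 0.
Proof. by apply/colP => k; rewrite !mxE eqxx andbT. Qed.

Lemma tr_base_mul : b0^T *m b0 = 1%:M.
Proof.
apply/matrixP => i j; rewrite mxE (bigD1 (widen_ord hm i)) //= !mxE eqxx mul1r.
by rewrite big1 ?addr0 // => k ki; rewrite !mxE (negbTE ki) mul0r.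
Qed.

Lemma base_index_gen b : exists g, g *m b0 = b.
Proof. by exists (b *m b0^T); rewrite -mulmxA tr_base_mul mulmx1. Qed.

Lemma gl_gen_famE w s : gl_gen (fam w s b0) = fam_span (fam w s).
Proof. exact: (gl_gen_fam (famM _ _ _) (famP rho_lin rho_bracket _ _) base_index_gen). Qed.

Lemma symb_base_neq0 (w : bool) s : (s + w < d)%N ->
  exists X v, symb (s + w) (fam w s b0) X v != 0.
Proof.
(* At [X_1 = F], [X_2 = H] and the nilpotent element [E]. *)
move=> sd; pose X k := if (k : nat) == 0%N then sl2F C else sl2H C.
have X0 : comb X (col 0 b0) = sl2F C by rewrite col_base comb_delta.
have X1 : comb X (col 1 b0) = sl2H C by rewrite col_base comb_delta.
exists X, (delta_mx 0 0); rewrite symb_fam // eqxx.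
rewrite mulf_neq0 ?trace_coef_neq0 // /tau /sigma X0 X1 nilp_e0.
rewrite mulf_neq0 // ?expf_neq0 //.
  rewrite (_ : \tr _ = 1) ?oner_eq0 //.
  by rewrite tr2E !mulmx2E !mksl2E; ring.
case: (w); rewrite ?oner_eq0 //.
rewrite tr2E !mulmx2E !bracketE !subE !mulmx2E !mksl2E.
rewrite (_ : _ + _ = 2%:R); first by rewrite pnatr_eq0.
by ring.
Qed.

Lemma fam_base_neq0 (w : bool) s : (s + w < d)%N -> fam w s b0 <> 0.
Proof.
move=> sd F0; have [X [v]] := symb_base_neq0 sd.
by rewrite F0 /symb mul0mx mxtrace0 eqxx.
Qed.

End Irreducibility.

(** * Irreducibility and highest weights *)

Section IrreducibleSummands.
Variables (C : numClosedFieldType) (m n : nat).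
Local Notation d := n.+1.
Local Notation E := (('I_m -> sl2 C) -> 'M[C]_d).
Variable rho : sl2 C -> 'M[C]_d.
Hypothesis rho_lin : forall a X Y, rho (a *: X + Y) = a *: rho X + rho Y.
Hypothesis rho_bracket : forall X Y,
  rho (bracket X Y) = rho X *m rho Y - rho Y *m rho X.
Hypothesis rho_irr : forall U : {vspace 'cV[C]_d},
  (forall X v, v \in U -> rho X *m v \in U) -> U = 0%VS \/ U = fullv.
Variable Psi : 'M[C]_2 -> 'M[C]_d.
Hypothesis Psi_unit : forall g, SL2 g -> Psi g \in unitmx.
Hypothesis Psi_rho : forall g X, SL2 g -> Psi g *m rho X *m invmx (Psi g) = rho (Ad g X).
Hypothesis hm : (1 < m)%N.
Implicit Types (X : 'I_m -> sl2 C) (b : 'M[C]_(m, 2)) (c e : 'cV[C]_m).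
Local Notation fam := (fam rho).
Local Notation pfam := (pfam rho).
Local Notation kfam := (kfam rho).
Local Notation b0 := (base_index C hm).

(** Matrices of rank at most two, which map any index to one whose columns are
    combinations of those of [b0]. *)
Definition rank2 (z : C) c e : 'M[C]_m :=
  col 0 b0 *m c^T + z *: (col 1 b0 *m e^T).

Lemma mul_rank1 (x y c : 'cV[C]_m) :
  x *m c^T *m y = (\sum_k c k 0 * y k 0) *: x.
Proof.
rewrite -mulmxA [c^T *m y]mx11_scalar mul_mx_scalar mxE; congr (_ *: _).
by apply: eq_bigr => k _; rewrite mxE.
Qed.

Lemma rank2_col z c e b j : col j (rank2 z c e *m b) =
  (\sum_k c k 0 * b k j) *: col 0 b0 + (z * \sum_k e k 0 * b k j) *: col 1 b0.
Proof.
rewrite col_mulmx mulmxDl -scalemxAl !mul_rank1 scalerA.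
by congr (_ *: _ + (_ * _) *: _); apply: eq_bigr => k _; rewrite mxE.
Qed.

Lemma bracket_comb2 (x y x' y' : C) (Y Z : sl2 C) :
  bracket (x *: Y + y *: Z) (x' *: Y + y' *: Z) = (x * y' - x' * y) *: bracket Y Z.
Proof.
apply/sl2P/mx2P; rewrite !bracketE !sl2ZE !subE ?scalemxE2 ?bracketE ?subE !mulmx2E !sl2DE !sl2ZE;
  rewrite !(addmxE2, scalemxE2) ?sl2_11; ring.
Qed.

Lemma kfam_rank2 w z c e b X :
  kfam w (rank2 z c e *m b) X = (z * wdg c e b) ^+ w *: kfam w b0 X.
Proof.
case: w => /=; last by rewrite expr0 scale1r.
rewrite /kfam !rank2_col !comb_lin !comb_scale bracket_comb2 (rhoZ rho_lin).
by congr (_ *: _); rewrite expr1 /wdg /dot; ring.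
Qed.

Lemma pfam_rank2 s c e b X :
  pfam s (rank2 0 c e *m b) X = dot c b ^+ s *: pfam s b0 X.
Proof.
by rewrite /pfam rank2_col mul0r scale0r addr0 comb_scale (rhoZ rho_lin) exprZn.
Qed.

(** The action of such matrices, divided by [z] if there is a commutator, takes
    an element of the span to an element that tends to a multiple of the
    generator as [z] tends to [0]. *)
Lemma submodule_cfam (U : set E) (w : bool) s c e (r : seq (C * 'M[C]_(m, 2))) :
  is_gl_submodule U -> U (\sum_(p <- r) p.1 *: fam w s p.2) ->
  U ((\sum_(p <- r) p.1 * cfam w s c e p.2) *: fam w s b0).
Proof.
move=> hU UF; set F := \sum_(p <- r) _ in UF.
have hF : fam_span (fam w s) F by exists r.
pose Q z : E := \sum_(p <- r) (p.1 * wdg c e p.2 ^+ w) *: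
  (fam false s (rank2 z c e *m p.2) * kfam w b0).
have hQ : poly_family Q.
  apply: poly_family_sum => p; apply: poly_familyZ; apply: poly_familyM; last exact:
    poly_family_const.
  have := famP rho_lin rho_bracket false s (col 0 b0 *m c^T *m p.2) (col 1 b0 *m e^T *m p.2).
  congr poly_family; apply/funext => z; congr (fam _ _ _).
  by rewrite mulmxDl -scalemxAl.
have UQ z : z \notin [:: 0] -> U (Q z).
  rewrite inE => z0.
  have := gl_submodule_singular (@famM C m n rho w s) (famP rho_lin rho_bracket w s) (rank2 z c
    e) hU hF UF.
  move=> /(is_subspaceZ (z ^- w) hU.1); congr U; rewrite gl_act_sum scaler_sumr.
  apply: eq_bigr => p _; rewrite -[gl_act _ _]/(p.1 *: gl_act _ (fam w s p.2)) famM.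
  apply/funext => X; rewrite -[LHS]/(z ^- w *: (p.1 *: fam w s _ X)).
  rewrite -[RHS]/(_ *: (fam false s _ X *m kfam w b0 X)).
  rewrite /fam kfam_rank2 mulmx1 -scalemxAr !scalerA exprMn; congr (_ *: _).
  by rewrite mulrACA mulVf ?mul1r // expf_neq0.
have := poly_family_limit hU.1 hQ UQ; congr U.
rewrite scaler_suml; apply: eq_bigr => p _; apply/funext => X.
rewrite -[LHS]/(_ *: (fam false s _ X *m kfam w b0 X)) -[RHS]/(_ *: (pfam s _ X *m kfam w b0 X)).
rewrite /fam pfam_rank2 mulmx1 -scalemxAl scalerA /cfam; congr (_ *: _).
by case: (w); rewrite ?expr1 ?expr0; ring.
Qed.

Theorem gl_gen_fam_irreducible (w : bool) s : (s + w < d)%N ->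
  is_gl_irreducible (gl_gen (fam w s b0)).
Proof.
move=> sd; rewrite gl_gen_famE //.
have hS := fam_span_gl (@famM C m n rho w s).
have Sb0 : fam_span (fam w s) (fam w s b0) by exists [:: (1, b0)]; rewrite big_seq1 scale1r.
have fam0 := @fam_base_neq0 C m n rho rho_lin rho_bracket rho_irr Psi Psi_unit Psi_rho hm w s sd.
split=> //; first by move=> h; apply: fam0; move: Sb0; rewrite h.
move=> U hU US; have [UF|nUF] := pselect (U (fam w s b0)).
  right; apply/seteqP; split=> //.
  exact: (fam_in_submodule (@famM C m n rho w s) (famP rho_lin rho_bracket w s) (base_index_gen
    hm) hU UF).
left; apply/seteqP; split=> [F UF|_ ->]; last by have [[]] := hU.
have [r Fr] := US _ UF; rewrite /= Fr.
apply: (fam_relation rho_lin rho_bracket) => c e; apply: contra_notP nUF => /eqP r0.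
have := submodule_cfam c e hU; move: UF; rewrite Fr => UF /(_ _ _ _ UF).
by move=> /(is_subspaceZ (\sum_(p <- r) p.1 * cfam w s c e p.2)^-1 hU.1); rewrite scalerA mulVf
  // scale1r.
Qed.

Theorem gl_gen_fam_weight (w : bool) s : (s + w < d)%N ->
  has_highest_weight (gl_gen (fam w s b0)) (if w then [:: s.+1; 1%N] else [:: s]).
Proof.
move=> sd; exists (fam w s b0); split.
- by rewrite gl_gen_famE //; exists [:: (1, b0)]; rewrite big_seq1 scale1r.
- exact: (@fam_base_neq0 C m n rho rho_lin rho_bracket rho_irr Psi Psi_unit Psi_rho hm w s sd).
- move=> g hg; rewrite famM.
  have h0 : col 0 (g *m b0) = col 0 b0.
    rewrite col_mulmx col_base -colE; apply/colP => k; rewrite !mxE eqxx andbT.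
    by rewrite hg //; congr (_%:R).
  have h1 : col 1 (g *m b0) = g (widen_ord hm 0) (widen_ord hm 1) *: col 0 b0 + col 1 b0.
    rewrite col_mulmx !col_base -colE; apply/colP => k; rewrite !mxE eqxx !andbT.
    have [->|k0] := eqVneq k (widen_ord hm 0).
      by rewrite mulr1 (_ : _ == _ = false) ?addr0 //; apply/eqP => /(congr1 val).
    rewrite mulr0 add0r hg //=.
    by rewrite lt0n; apply: contraNneq k0 => k0; apply/eqP/val_inj.
  apply/funext => X; rewrite /fam /pfam /kfam h0; congr (_ *m _).
  case: (w) => //; rewrite h1 comb_lin.
  have := bracket_comb2 1 0 (g (widen_ord hm 0) (widen_ord hm 1)) 1 (comb X (col 0 b0)) (comb X
    (col 1 b0)).
  by rewrite !scale1r scale0r addr0 mulr0 subr0 mulr1 scale1r => ->.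
- move=> z _; rewrite famM.
  have hj j : col j (diag_mx z *m b0) = z 0 (widen_ord hm j) *: col j b0.
    apply/colP => k; rewrite mul_diag_mx !mxE.
    by have [->|_] := eqVneq k; rewrite ?mulr0 ?mulr1.
  have zE : \prod_(i < m) z 0 i ^+ nth 0%N (if w then [:: s.+1; 1%N] else [:: s]) i =
      z 0 (widen_ord hm 0) ^+ (s + w) * z 0 (widen_ord hm 1) ^+ w.
    rewrite (bigD1 (widen_ord hm 0)) //= (bigD1 (widen_ord hm 1)) //= big1 => [|i /andP [i0 i1]].
      by rewrite mulr1; case: (w); rewrite ?addn1 ?addn0.
    have: (1 < i)%N.
      by move: i0 i1; rewrite -!(inj_eq val_inj) /=; case: (i : nat) => [|[|]].
    by case: (i : nat) => [|[|i']] // _; case: (w); rewrite /= ?nth_nil expr0.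
  apply/funext => X; rewrite zE -[RHS]/(_ *: (pfam s b0 X *m kfam w b0 X)).
  rewrite /fam /pfam hj comb_scale (rhoZ rho_lin) exprZn -scalemxAl exprD -!scalerA; congr (_ *: _).
  rewrite scalerA scalemxAr -exprMn; congr (_ *m _).
  case: (w); last by rewrite expr0 scale1r.
  have := bracket_comb2 (z 0 (widen_ord hm 0)) 0 0 (z 0 (widen_ord hm 1)) (comb X (col 0 b0))
    (comb X (col 1 b0)).
  rewrite !scale0r addr0 add0r mul0r subr0 => hb.
  by rewrite expr1 /kfam !hj !comb_scale hb (rhoZ rho_lin).
Qed.

End IrreducibleSummands.

(** * Homogeneous components *)

Section HomogeneousComponents.
Variables (C : numClosedFieldType) (m : nat).
Implicit Types (X : 'I_m -> sl2 C).

Lemma homog_map_scale d k (F : ('I_m -> sl2 C) -> 'M[C]_d) z X :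
  homog_map k F -> F (fun i => z *: X i) = z ^+ k *: F X.
Proof. by move=> hF; apply/matrixP => i j; rewrite mxE (homog_fun_scale _ _ (hF i j)). Qed.

(** A polynomial map is the sum of its homogeneous components, which are
    combinations of its composites with scalings. *)
Lemma poly_map_homog d (F : ('I_m -> sl2 C) -> 'M[C]_d) : poly_map F ->
  exists (N : nat) (G : nat -> ('I_m -> sl2 C) -> 'M[C]_d),
    [/\ forall k, homog_map k (G k), F = \sum_(k < N) G k &
      forall k, (k < N)%N -> exists z w : 'I_N -> C,
        forall X, G k X = \sum_j w j *: F (fun i => z j *: X i)].
Proof.
move=> hF.
have /choice [N0 hN0] : forall p : 'I_d * 'I_d, exists N0 : nat,
    exists G : nat -> ('I_m -> sl2 C) -> C, (forall k, homog_fun k (G k)) /\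
      forall X, F X p.1 p.2 = \sum_(k < N0) G k X.
  by move=> p; exact: poly_fun_homog (hF p.1 p.2).
have [G0 hG0] := choice hN0; pose N := \max_p N0 p.
pose G k X : 'M[C]_d := \matrix_(i, j) (if (k < N0 (i, j))%N then G0 (i, j) k X else 0).
have hG k : homog_map k (G k).
  move=> i j; rewrite (_ : (fun _ => _) =
    if (k < N0 (i, j))%N then G0 (i, j) k else fun=> 0); last first.
    by apply/funext => X; rewrite mxE; case: ifP.
  by case: ifP => _; [exact: (hG0 (i, j)).1|exact: homog_fun0].
have FG X : F X = \sum_(k < N) G k X.
  apply/matrixP => i j; rewrite summxE (hG0 (i, j)).2 /=.
  rewrite (big_ord_widen N (fun k => G0 (i, j) k X)) ?leq_bigmax //=.
  by rewrite big_mkcond; apply: eq_bigr => k _; rewrite mxE.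
exists N, G; split=> // [|k kN]; first by apply/funext => X; rewrite fct_sumE.
(* The component of degree [k] is extracted by interpolation. *)
have [z [w [_ hw]]] := coef_eval_weights N k ([::] : seq C).
exists z, w => X; under eq_bigr do rewrite FG scaler_sumr.
rewrite exchange_big (bigD1 (Ordinal kN)) //= [X in _ + X]big1 ?addr0 => [|e ek].
  under eq_bigr do rewrite (homog_map_scale _ _ (hG _)) scalerA.
  by rewrite -scaler_suml hw // eqxx scale1r.
under eq_bigr do rewrite (homog_map_scale _ _ (hG _)) scalerA.
by rewrite -scaler_suml hw // (_ : (_ == _) = false) ?scale0r //; apply: contraNF ek => /eqP ek;
  apply/eqP/val_inj.
Qed.

Lemma Ad_scale g (z : C) (X : sl2 C) : SL2 g -> Ad g (z *: X) = z *: Ad g X.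
Proof.
move=> hg; apply/sl2P; rewrite AdE // !sl2ZE AdE //.
by rewrite -scalemxAr -scalemxAl.
Qed.

Lemma homog_poly_map d k (F : ('I_m -> sl2 C) -> 'M[C]_d) : homog_map k F -> poly_map F.
Proof. by move=> hF i j; exact: homog_poly (hF i j). Qed.

(** The homogeneous components of a covariant are covariants. *)
Lemma covariants_homog d (Psi : 'M[C]_2 -> 'M[C]_d) F : covariants Psi F ->
  exists (N : nat) (G : nat -> ('I_m -> sl2 C) -> 'M[C]_d),
    [/\ forall k, homog_map k (G k), F = \sum_(k < N) G k &
      forall k, (k < N)%N -> covariants Psi (G k)].
Proof.
move=> [hF eF]; have [N [G [hG FG hw]]] := poly_map_homog hF.
exists N, G; split=> // k kN; split; first exact: homog_poly_map (hG k).
move=> g X hg; have [z [w GE]] := hw k kN; rewrite !GE mulmx_sumr mulmx_suml.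
apply: eq_bigr => j _; rewrite -scalemxAr -scalemxAl -eF //; congr (_ *: F _).
by apply/funext => i; rewrite Ad_scale.
Qed.

Lemma invariants_homog (f : ('I_m -> sl2 C) -> C^o) : invariants f ->
  exists (N : nat) (g : nat -> ('I_m -> sl2 C) -> C^o),
    [/\ forall k, homog_fun k (g k), f = \sum_(k < N) g k &
      forall k, (k < N)%N -> invariants (g k)].
Proof.
move=> [pf hf]; pose F X : 'M[C]_1 := (f X)%:M.
have hF : poly_map F.
  by move=> i j; have := pf; congr poly_fun; apply/funext => X; rewrite !ord1 mxE eqxx.
have [N [G [hG FG hw]]] := poly_map_homog hF.
exists N, (fun k X => G k X 0 0); split=> [k||k kN]; first exact: hG.
  apply/funext => X; rewrite fct_sumE -summxE.
  by have := congr1 (fun H : ('I_m -> sl2 C) -> 'M[C]_1 => H X 0 0) FG; rewrite fct_sumE /F mxE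
    eqxx.
split; first exact: homog_poly (hG k 0 0).
move=> g X hg; have [z [w GE]] := hw k kN; rewrite !GE !summxE.
apply: eq_bigr => j _; congr (fun_of_matrix (w j *: _) 0 0).
rewrite /F; congr (_%:M); rewrite -[in RHS](hf g) //.
by congr (f _); apply/funext => i; rewrite Ad_scale.
Qed.

(** Polynomial functions of the matrices and a vector. *)
Definition cpoly (phi : ('I_m -> sl2 C) -> 'cV[C]_2 -> C) : Prop :=
  exists g, forall X v, peval X v g = phi X v.

Lemma cpoly_const c : cpoly (fun _ _ => c).
Proof. by exists (mpolyC _ c) => X v; rewrite /peval mevalC. Qed.

Lemma cpolyD p q : cpoly p -> cpoly q -> cpoly (fun X v => p X v + q X v).
Proof. by move=> [g hg] [h hh]; exists (g + h) => X v; rewrite pevalD hg hh. Qed.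

Lemma cpolyM p q : cpoly p -> cpoly q -> cpoly (fun X v => p X v * q X v).
Proof. by move=> [g hg] [h hh]; exists (g * h) => X v; rewrite pevalM hg hh. Qed.

Lemma cpoly_sum (I : Type) (r : seq I) (p : I -> ('I_m -> sl2 C) -> 'cV[C]_2 -> C) :
  (forall i, cpoly (p i)) -> cpoly (fun X v => \sum_(i <- r) p i X v).
Proof.
move=> hp; elim: r => [|i r IH].
  have := cpoly_const 0; congr cpoly; apply/funext => X; apply/funext => v.
  by rewrite big_nil.
have := cpolyD (hp i) IH; congr cpoly; apply/funext => X; apply/funext => v.
by rewrite big_cons.
Qed.

Lemma cpoly_entry k i j : cpoly (fun X _ => (X k : 'M[C]_2) i j).
Proof.
have hx : cpoly (fun X _ => (X k : 'M[C]_2) 0 0) by exists (pvar C (jx k)) => X v; rewrite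
  peval_var.
elim/ord2_ind: i; elim/ord2_ind: j => //.
- by exists (pvar C (jy k)) => X v; rewrite peval_var.
- by exists (pvar C (jw k)) => X v; rewrite peval_var.
- have := cpolyM (cpoly_const (-1)) hx; congr cpoly.
  by apply/funext => X; apply/funext => v; rewrite sl2_11 mulN1r.
Qed.

Lemma cpoly_vec i : cpoly (fun _ v => v i 0).
Proof.
elim/ord2_ind: i.
  by exists (pvar C (jv m false)) => X v; rewrite peval_var.
by exists (pvar C (jv m true)) => X v; rewrite peval_var.
Qed.

Lemma cpoly_poly_fun f : poly_fun f -> cpoly (fun X _ => f X).
Proof.
move=> [p hp]; rewrite (_ : (fun _ _ => _) = fun X _ => meval (coords X) p); last first.
  by apply/funext => X; apply/funext => v; rewrite hp.
elim/mpoly_ring_ind: p {hp} => [c|i|p q Hp Hq|p q Hp Hq].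
- have := cpoly_const c; congr cpoly.
  by apply/funext => X; apply/funext => v; rewrite mevalC.
- have := cpoly_entry (enum_val i).1.1 (enum_val i).1.2 (enum_val i).2; congr cpoly.
  apply/funext => X; apply/funext => v; rewrite mevalXU /coords.
  by case: (enum_val i) => [[k a] b].
- have := cpolyD Hp Hq; congr cpoly.
  by apply/funext => X; apply/funext => v; rewrite mevalD.
- have := cpolyM Hp Hq; congr cpoly.
  by apply/funext => X; apply/funext => v; rewrite mevalM.
Qed.

End HomogeneousComponents.

(** * Generation of the module of covariants *)

Section Generation.
Variables (C : numClosedFieldType) (m n : nat).
Local Notation d := n.+1.
Local Notation E := (('I_m -> sl2 C) -> 'M[C]_d).
Variable rho : sl2 C -> 'M[C]_d.
Hypothesis rho_lin : forall a X Y, rho (a *: X + Y) = a *: rho X + rho Y.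
Hypothesis rho_bracket : forall X Y,
  rho (bracket X Y) = rho X *m rho Y - rho Y *m rho X.
Hypothesis rho_irr : forall U : {vspace 'cV[C]_d},
  (forall X v, v \in U -> rho X *m v \in U) -> U = 0%VS \/ U = fullv.
Variable Psi : 'M[C]_2 -> 'M[C]_d.
Hypothesis Psi_unit : forall g, SL2 g -> Psi g \in unitmx.
Hypothesis Psi_rho : forall g X, SL2 g -> Psi g *m rho X *m invmx (Psi g) = rho (Ad g X).
Implicit Types (X : 'I_m -> sl2 C) (v : 'cV[C]_2) (b : 'M[C]_(m, 2)) (F G : E).
Local Notation fam := (fam rho).
Local Notation symb := (symb rho).

Lemma covariants_submodule : is_inv_submodule (@covariants C m d Psi).
Proof.
split=> [|F G [pF hF] [pG hG]|f F [pf hf] [pF hF]].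
- split=> [i j|g X hg]; last by rewrite mulmx0 mul0mx.
  have := poly_fun_const m (0 : C); congr poly_fun; apply/funext => X.
  by rewrite -[RHS]/((0 : 'M[C]_d) i j) mxE.
- split=> [i j|g X hg].
    have := poly_funD (pF i j) (pG i j); congr poly_fun; apply/funext => X.
    by rewrite -[RHS]/((F X + G X) i j) mxE.
  rewrite -[LHS]/(F _ + G _) hF // hG //.
  by rewrite -[(F + G) X]/(F X + G X) mulmxDr mulmxDl.
- split=> [i j|g X hg].
    have := poly_funM pf (pF i j); congr poly_fun; apply/funext => X.
    by rewrite /inv_scale mxE.
  by rewrite /inv_scale hf // hF // -scalemxAr -scalemxAl.
Qed.

Lemma inv_submodule_subspace (U : set E) : is_inv_submodule U -> is_subspace U.
Proof.
move=> [U0 UD UZ]; split=> // a F G UF UG; apply: UD => //.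
by have := UZ _ F (invariants_const m a) UF; congr U.
Qed.

Lemma inv_span_submodule (B : set E) : is_inv_submodule (inv_span B).
Proof.
split=> [U [[]]//|F G hF hG U hU|f F hf hF U hU].
  by case: (hU) => -[_ UD _] _; apply: UD; [exact: hF|exact: hG].
by case: (hU) => -[_ _ UZ] _; apply: UZ => //; exact: hF.
Qed.

Lemma inv_span_sub (B U : set E) : is_inv_submodule U -> B `<=` U -> inv_span B `<=` U.
Proof. by move=> hU BU; exact: smallest_sub. Qed.

Lemma sub_inv_span (B : set E) : B `<=` inv_span B.
Proof. by move=> F BF U [_ BU]; exact: BU. Qed.

(** The members of the families whose symbols of highest order have order less
    than [d]. *)
Definition generators : set E :=
  [set F | exists (w : bool) s b, (s + w < d)%N /\ F = fam w s b].

Lemma generators_covariants : inv_span generators `<=` covariants Psi.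
Proof.
apply: inv_span_sub; first exact: covariants_submodule.
by move=> _ [w [s [b [_ ->]]]]; exact: covariants_fam.
Qed.

Lemma symb_lin k (a : C) F G X v : symb k (a *: F + G) X v = a * symb k F X v + symb k G X v.
Proof.
rewrite /symb -[(a *: F + G) X]/(a *: F X + G X).
by rewrite mulmxDl mxtraceD -scalemxAl mxtraceZ.
Qed.

Lemma symbZ k f F X v : symb k (inv_scale f F) X v = f X * symb k F X v.
Proof. by rewrite /symb /inv_scale -scalemxAl mxtraceZ. Qed.

Lemma cpoly_symb k F : poly_map F -> cpoly (symb k F).
Proof.
move=> pF.
have cN i j : cpoly (fun _ : 'I_m -> sl2 C => fun v => (rho (nilp v) ^+ k) i j).
  elim: k i j => [|k IH] i j; first exact: cpoly_const.
  rewrite (_ : (fun _ _ => _) = fun X v => \sum_l rho (nilp v) i l * (rho (nilp v) ^+ k) l j);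
    last first.
    by apply/funext => X; apply/funext => v; rewrite exprS -mulmxE mxE.
  apply: cpoly_sum => l; apply: cpolyM => //.
  rewrite (_ : (fun _ _ => _) = fun X v => (rho (sl2H C) i l * (-1 * (v 0 0 * v 1 0)) +
     rho (sl2E C) i l * (v 0 0 * v 0 0)) + rho (sl2F C) i l * (-1 * (v 1 0 * v 1 0))).
    by apply: cpolyD; first apply: cpolyD; apply: cpolyM; try exact: cpoly_const;
      try (apply: cpolyM; first exact: cpoly_const); apply: cpolyM; exact: cpoly_vec.
  apply/funext => X; apply/funext => v.
  rewrite (sl2_decomp (nilp v)) !mksl2E !(rhoD rho_lin) !(rhoZ rho_lin).
  by rewrite !mxE; ring.
rewrite (_ : symb k F = fun X v => \sum_i \sum_l F X i l * (rho (nilp v) ^+ k) l i).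
  apply: cpoly_sum => i; apply: cpoly_sum => l; apply: cpolyM => //.
  exact: cpoly_poly_fun (pF i l).
by apply/funext => X; apply/funext => v; apply: eq_bigr => i _; rewrite mxE.
Qed.

(** The symbols of covariants are invariants of the matrices and a vector. *)
Lemma symb_cov_span k F : covariants Psi F -> cov_span k (symb k F).
Proof.
move=> /covariants_homog [N [G [hG -> cG]]].
rewrite (_ : symb k _ = fun X v => \sum_(l < N) symb k (G l) X v); last first.
  by apply/funext => X; apply/funext => v; rewrite /symb fct_sumE mulmx_suml raddf_sum.
apply: cov_span_sum => l _; have [pG eG] := cG l (ltn_ord l).
have [g gE] := cpoly_symb k pG.
have -> : symb k (G l) = fun X v => peval X v g by apply/funext => X; apply/funext => v.
have [hE hF] : pvec (@xiE C m) g = 0 /\ pvec (@xiF C m) g = 0.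
  apply/SL2_invariant_inf => h X v hh; rewrite !gE /symb eG // -Ad_nilp // -Psi_rho //.
  rewrite conj_mx_exp ?Psi_unit //.
  by rewrite !mulmxA mulmxKV ?Psi_unit // -[Psi h *m _ *m _]mulmxA tr_conj_mx ?Psi_unit.
apply: (invariant_cov_span (n := l)) => //.
  by apply: EX_homog => X v z; rewrite !gE /symb (homog_map_scale _ _ (hG l)) -scalemxAl mxtraceZ.
apply: EV_homog => X v z; rewrite !gE /symb.
have -> : nilp (z *: v) = z ^+ 2 *: nilp v.
  by apply/sl2P/mx2P; rewrite sl2ZE scalemxE2 !mksl2E !mxE; ring.
by rewrite (rhoZ rho_lin) exprZn -scalemxAr mxtraceZ -exprM mul2n.
Qed.

(** Conversely, these are symbols of combinations of the generators, whose
    symbols of higher order vanish. *)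
Lemma cov_span_symb k phi : (k < d)%N -> cov_span k phi ->
  exists G, [/\ inv_span generators G, symb k G = phi &
    forall s, (k < s)%N -> symb s G = fun _ _ => 0].
Proof.
move=> kd.
pose T := (('I_m -> sl2 C) * 'cV[C]_2)%type.
pose P : set (T -> C^o) := [set f | exists G, [/\ inv_span generators G,
  forall X v, symb k G X v = f (X, v) & forall s X v, (k < s)%N -> symb s G X v = 0]].
have hM := inv_span_submodule generators.
have PM f : invariants f -> is_subspace [set h : T -> C^o | P (fun t => f t.1 * h t)].
  move=> hf; split.
    exists 0; split; first by case: hM.
      by move=> X v; rewrite /symb mul0mx mxtrace0 mulr0.
    by move=> s X v _; rewrite /symb mul0mx mxtrace0.
  move=> a x y [G [MG Gx G0]] [H [MH Hy H0]]; exists (a *: G + H); split.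
  - exact: (inv_submodule_subspace hM).2.
  - by move=> X v; rewrite symb_lin Gx Hy fct_lcombE mulrDr mulrCA.
  - by move=> s X v ks; rewrite symb_lin G0 // H0 // mulr0 addr0.
have Pfam (w : bool) s f b : (s + w)%N = k -> invariants f ->
    P (fun t => f t.1 * (tau (col 0 b) t.1 t.2 ^+ s *
      (if w then sigma (col 0 b) (col 1 b) t.1 t.2 else 1))).
  move=> swk hf; have c0 := trace_coef_neq0 C kd.
  have hsymb := symb_fam rho_lin rho_bracket rho_irr Psi_unit Psi_rho.
  exists ((trace_coef C n k)^-1 *: inv_scale f (fam w s b)); split.
  - apply: (is_subspaceZ _ (inv_submodule_subspace hM)).
    case: hM => _ _; apply=> //; apply: sub_inv_span.
    by exists w, s, b; rewrite swk.
  - move=> X v; rewrite -[_ *: _]addr0 symb_lin symbZ hsymb ?swk // eqxx.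
    by rewrite /symb mul0mx mxtrace0 addr0 [f X * _]mulrCA mulKf.
  - move=> l X v kl; rewrite -[_ *: _]addr0 symb_lin symbZ hsymb ?swk ?(ltnW kl) //.
    by rewrite (ltn_eqF kl) /symb mul0mx mxtrace0 addr0 !mulr0.
pose bb (c e : 'cV[C]_m) : 'M[C]_(m, 2) := \matrix_(i, j) (if j == 0 then c i 0 else e i 0).
have bb0 c e : col 0 (bb c e) = c by apply/colP => i; rewrite !mxE.
have bb1 c e : col 1 (bb c e) = e by apply/colP => i; rewrite !mxE.
have tau_lin (a : C) (x y : 'cV[C]_m) (t : T) :
    tau (a *: x + y) t.1 t.2 = a * tau x t.1 t.2 + tau y t.1 t.2.
  by rewrite /tau comb_lin sl2DE sl2ZE mulmxDl mxtraceD -scalemxAl mxtraceZ.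
have brl (a : C) (x y z : sl2 C) : bracket (a *: x + y) z = a *: bracket x z + bracket y z.
  apply/sl2P; rewrite !(bracketE, sl2DE, sl2ZE) mulmxDl mulmxDr -scalemxAl -scalemxAr.
  by rewrite scalerBr opprD addrACA.
suff H : cov_span k phi -> P (fun t => phi t.1 t.2).
  move=> /H [G [MG Gphi G0]]; exists G; split=> // [|s ks].
    by apply/funext => X; apply/funext => v; rewrite Gphi.
  by apply/funext => X; apply/funext => v; rewrite G0.
elim=> {phi} [f cs hf scs|f cs c e hf scs|F G _ [F' [MF F1 F2]] _ [G' [MG G1 G2]]].
- apply: (polarize_powers (tau := fun c (t : T) => tau c t.1 t.2) tau_lin (PM f hf)) scs => c.
  have := Pfam false k f (bb c 0) (addn0 _) hf; rewrite bb0; congr P.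
  by apply/funext => t; rewrite mulr1.
- rewrite (_ : (fun t : T => _) = fun t : T => f t.1 * (\prod_(c <- cs) tau c t.1 t.2 * sigma c
  e t.1 t.2)); last first.
    by apply/funext => t; rewrite mulrA.
  have sk : size cs = k.-1 by rewrite -scs.
  apply: (polarize_wedge (tau := fun c (t : T) => tau c t.1 t.2)
    (sigma := fun c e (t : T) => sigma c e t.1 t.2) tau_lin) (PM f hf) _ _ c e sk.
  - by move=> a x y z t; rewrite /sigma comb_lin brl sl2DE sl2ZE mulmxDl mxtraceD -scalemxAl
    mxtraceZ.
  - move=> x y t; rewrite /sigma !bracketE -[in RHS]opprB mulNmx raddfN opprK.
    by [].
  - by move=> x y z t; exact: pluecker_nilp.
  move=> c' e'; have := Pfam true k.-1 f (bb c' e'); rewrite bb0 bb1; apply => //.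
  by rewrite -scs addn1.
- exists (F' + G'); split.
  + by case: hM => _ MD _; apply: MD.
  + by move=> X v; rewrite -[F']scale1r symb_lin F1 G1 mul1r.
  + by move=> s X v ks; rewrite -[F']scale1r symb_lin F2 // G2 // mul1r addr0.
Qed.

(** The generators generate: the symbols of a covariant are removed one by one,
    from the highest order downwards. *)
Theorem covariants_inv_span : covariants Psi = inv_span generators.
Proof.
apply/seteqP; split; last exact: generators_covariants.
suff H k F : (k <= d)%N -> covariants Psi F ->
    (forall s X v, (k <= s < d)%N -> symb s F X v = 0) -> inv_span generators F.
  by move=> F cF; apply: (H d) => // s X v /andP [ds]; rewrite ltnNge ds.
have hC := inv_submodule_subspace covariants_submodule.
have hM := inv_submodule_subspace (inv_span_submodule generators).
elim: k F => [|k IH] F kd cF F0.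
  have -> : F = 0; last exact: hM.1.
  apply/funext => X; apply: (nilp_powers_span rho_lin rho_bracket rho_irr) => v s sd.
  exact: F0.
have [G [MG GF G0]] := cov_span_symb kd (symb_cov_span k cF).
rewrite -[F](subrK G); apply: (is_subspaceD hM) => //; apply: IH; first exact: ltnW.
  by apply: (is_subspaceB hC) => //; exact: generators_covariants.
move=> s X v /andP [ks sd]; rewrite addrC -scaleN1r symb_lin mulN1r.
move: ks; rewrite leq_eqVlt => /orP [/eqP <-|ks]; first by rewrite GF addNr.
by rewrite G0 // F0 ?ks // oppr0 addr0.
Qed.

End Generation.

(** * Bases *)

Section Bases.
Variables (C : fieldType) (E : lmodType C).
Implicit Types (B H : set E).

Lemma lspan_subspace B : is_subspace (lspan B).
Proof.
split=> [U [[]]//|a x y hx hy U hU].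
by case: (hU) => -[_ UD] _; apply: UD; [exact: hx|exact: hy].
Qed.

Lemma sub_lspan B : B `<=` lspan B.
Proof. by move=> x Bx U [_]; apply. Qed.

Lemma lspan_sub B (U : set E) : is_subspace U -> B `<=` U -> lspan B `<=` U.
Proof. by move=> hU BU; exact: smallest_sub. Qed.

Lemma lspan_comb B x : lspan B x -> exists2 r : seq (C * E),
  (forall p, p \in r -> B p.2) & x = \sum_(p <- r) p.1 *: p.2.
Proof.
move: x; apply: lspan_sub => [|x Bx].
  split; first by exists [::]; rewrite ?big_nil.
  move=> a _ _ [r Br ->] [r' Br' ->]; exists ([seq (a * p.1, p.2) | p <- r] ++ r').
    by move=> p; rewrite mem_cat => /orP [/mapP [q /Br Bq ->]|/Br'].
  rewrite big_cat big_map /= scaler_sumr; congr (_ + _).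
  by apply: eq_bigr => p _; rewrite scalerA.
exists [:: (1, x)]; first by move=> p; rewrite inE => /eqP ->.
by rewrite big_seq1 scale1r.
Qed.

(** A member of an independent set that is spanned by a subset is in it. *)
Lemma lin_indep_lspan B B' x : lin_indep B -> B' `<=` B -> B x -> lspan B' x -> B' x.
Proof.
move=> hB sB Bx /lspan_comb [r Br xr]; apply: contrapT => nB'x.
pose s := undup [seq p.2 | p <- r]; pose c y := \sum_(p <- r | p.2 == y) p.1.
have Bs y : y \in s -> B' y.
  by rewrite mem_undup => /mapP [p /Br Bp ->].
have xs : x = \sum_(y <- s) c y *: y.
  rewrite xr; under [RHS]eq_bigr do rewrite scaler_suml big_mkcond.
  rewrite exchange_big big_seq [RHS]big_seq; apply: eq_bigr => p pr /=.
  rewrite (bigD1_seq p.2) ?undup_uniq ?mem_undup ?map_f //= eqxx big1 ?addr0 //.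
  by move=> y yp; rewrite eq_sym (negbTE yp).
pose t := x :: s.
have ut : uniq t by rewrite /= undup_uniq andbT; apply: contra_notN nB'x => /Bs.
have := hB (size t) (fun k => nth 0 t k) (fun k => if (k : nat) == 0%N then -1 else c (nth 0 t k)).
move=> /(_ _ _ _ ord0)/= H; suff /eqP : -1 = 0 :> C by rewrite oppr_eq0 oner_eq0.
apply: H => [i j /eqP|k|].
- by rewrite nth_uniq // => /eqP /val_inj.
- case: k => [[|k] hk] //=; apply: sB; apply: Bs; exact: mem_nth.
- rewrite big_ord_recl /= scaleN1r {1}xs (big_nth 0) big_mkord.
  by rewrite addrC; apply/eqP; rewrite subr_eq0; apply/eqP.
Qed.

Lemma chain_seq (F : set (set E)) (l : seq E) : total_on F subset ->
  (forall x, x \in l -> exists2 X, F X & X x) ->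
  l = [::] \/ exists2 X, F X & forall x, x \in l -> X x.
Proof.
move=> tF; elim: l => [|x l IH] hl; first by left.
right; have [Y FY Yx] := hl x (mem_head _ _).
have [||[X FX Xl]] := IH; first by move=> y yl; apply: hl; rewrite inE yl orbT.
  by move=> ->; exists Y => // y; rewrite inE => /eqP ->.
have [XY|YX] := tF X Y FX FY.
  by exists Y => // y; rewrite inE => /orP [/eqP ->|/Xl /XY].
by exists X => // y; rewrite inE => /orP [/eqP ->|/Xl]; first exact: YX.
Qed.

(** Every set contains a basis of its span. *)
Lemma basis_sub H : exists2 B, B `<=` H & is_basis (lspan H) B.
Proof.
have [F FP tF|B [[BH hB] maxB]] := @Zorn_bigcup _ [set B | B `<=` H /\ lin_indep B].
  split; first by move=> x [X /FP [XH _] Xx]; exact: XH.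
  move=> n b c injb Fb c0 k.
  have [x /mapP [j _ ->]|l0|[X FX Xb]] := @chain_seq F [seq b j | j <- enum 'I_n] tF.
  - by have [X] := Fb j; exists X.
  - have : b k \in [seq b j | j <- enum 'I_n] by rewrite map_f ?mem_enum.
    by rewrite l0.
  - have [_ hX] := FP _ FX; apply: (hX n b c injb _ c0) => j.
    by apply: Xb; rewrite map_f // mem_enum.
exists B => //; split=> //; apply/seteqP; split.
  by apply: lspan_sub (lspan_subspace H) _ => x /BH; exact: sub_lspan.
apply: lspan_sub (lspan_subspace B) _ => h Hh; apply: contrapT => nBh.
have nBh' : ~ B h by move=> /sub_lspan.
apply: (maxB (B `|` [set h])).
  by split=> [|sub]; [exact: subsetUl|apply/nBh'/sub; right].
split=> [x [/BH //|-> //]|]; move=> n b c injb Bb c0.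
have [[k0 bk0]|nb] := pselect (exists k, b k = h); last first.
  move=> k; apply: (hB n b c injb _ c0) => j.
  by have [//|bj] := Bb j; case: nb; exists j.
case: n b c injb Bb c0 k0 bk0 => [|n] b c injb Bb c0 k0 bk0; first by have := ltn_ord k0.
have Bl j : B (b (lift k0 j)).
  have [//|] := Bb (lift k0 j); rewrite -bk0 => /injb /eqP.
  by rewrite eq_sym (negbTE (neq_lift _ _)).
have sumE : \sum_k c k *: b k = c k0 *: h + \sum_j c (lift k0 j) *: b (lift k0 j).
  rewrite (bigD1_ord k0) //= bk0; congr (_ + _).
have ck0 : c k0 = 0.
  apply: contrapT => /eqP ck; apply: nBh.
  have -> : h = - (c k0)^-1 *: \sum_j c (lift k0 j) *: b (lift k0 j).
    move: c0; rewrite sumE => /eqP; rewrite addrC addr_eq0 => /eqP ->.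
    by rewrite scalerN scaleNr opprK scalerA mulVf // scale1r.
  apply: (is_subspaceZ _ (lspan_subspace B)); apply: is_subspace_sum; first exact: lspan_subspace.
  by move=> j _; apply: (is_subspaceZ _ (lspan_subspace B)); apply: sub_lspan.
move: c0; rewrite sumE ck0 scale0r add0r => c0 k.
have [k' ->|->//] := unliftP k0 k.
apply: (hB n (fun j => b (lift k0 j)) (fun j => c (lift k0 j)) _ Bl c0) => i j.
by move=> /injb /lift_inj.
Qed.

End Bases.

(** * Orders of vanishing *)

Section OrderOfVanishing.
Variables (C : numClosedFieldType) (m : nat).
Implicit Types (X : 'I_m -> sl2 C) (v : 'cV[C]_2) (f : ('I_m -> sl2 C) -> C^o).

(** The function [phi] vanishes at the origin to order at least [k]. *)
Definition vanishes k (phi : ('I_m -> sl2 C) -> C) : Prop :=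
  forall X, exists q : {poly C}, forall z, phi (fun i => z *: X i) = z ^+ k * q.[z].

Lemma vanishes_subspace k : is_subspace [set f : ('I_m -> sl2 C) -> C^o | vanishes k f].
Proof.
split=> [X|a f g hf hg X]; first by exists 0 => z; rewrite horner0 mulr0.
have [q hq] := hf X; have [r hr] := hg X; exists (a *: q + r) => z.
by rewrite fct_lcombE hq hr hornerD hornerZ; ring.
Qed.

Lemma vanishesM k l f g : vanishes k f -> vanishes l g ->
  vanishes (k + l) (fun X => f X * g X).
Proof.
move=> hf hg X; have [q hq] := hf X; have [r hr] := hg X; exists (q * r) => z.
by rewrite hq hr hornerM exprD; ring.
Qed.

Lemma vanishes_homog k l f : (k <= l)%N -> homog_fun l f -> vanishes k f.
Proof.
move=> kl hf X; exists (f X *: 'X^(l - k)) => z.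
by rewrite (homog_fun_scale _ _ hf) hornerZ hornerXn -{1}(subnKC kl) exprD; ring.
Qed.

Lemma vanishes_poly_fun f : poly_fun f -> vanishes 0 f.
Proof.
move=> /poly_fun_homog [N [F [hF fF]]].
have -> : f = \sum_(k < N) (F k : _ -> C^o) by apply/funext => X; rewrite fct_sumE.
apply: (is_subspace_sum _ (vanishes_subspace 0)) => k _.
exact: vanishes_homog (leq0n _) (hF k).
Qed.

Lemma homog_fun1_lin f (a : C) X Y : homog_fun 1 f ->
  f (fun k => a *: X k + Y k) = a * f X + f Y.
Proof.
move=> [p /dhomogP pn hp]; rewrite !hp !mevalE mulr_sumr -big_split.
apply: eq_big_seq => mm /pn /eqP/mdeg1P [i /eqP ->] /=.
have hi (u : 'I_#|{: 'I_m * 'I_2 * 'I_2}| -> C) : \prod_j u j ^+ mnm1 i j = u i.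
  rewrite (bigD1 i) //= mnm1E eqxx expr1 big1 ?mulr1 // => j ji.
  by rewrite mnm1E eq_sym (negbTE ji).
rewrite !hi /coords; case: (enum_val i) => [[k j] l].
by rewrite sl2DE sl2ZE !mxE mulrDr mulrCA.
Qed.

(** A quaternion group acts on traceless matrices through its quotient of order
    four, without nonzero fixed vectors; hence the four translates of a matrix
    have sum zero. *)
Lemma linear_invariant_eq0 f : invariants f -> homog_fun 1 f -> f = 0.
Proof.
move=> [_ hf] h1; apply/funext => X; rewrite /=.
pose g1 : 'M[C]_2 := \matrix_(i, j) if i != j then 0 else if i == 0 then 'i else - 'i.
pose g2 : 'M[C]_2 := \matrix_(i, j) if i == j then 0 else if i == 0 then 1 else -1.
have g1E : (g1 0 0 = 'i) * (g1 0 1 = 0) * (g1 1 0 = 0) * (g1 1 1 = - 'i) by rewrite !mxE.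
have g2E : (g2 0 0 = 0) * (g2 0 1 = 1) * (g2 1 0 = -1) * (g2 1 1 = 0) by rewrite !mxE.
have hg1 : SL2 g1 by rewrite /SL2 /= det2E !g1E mulrN -expr2 sqrCi opprK mul0r subr0.
have hg2 : SL2 g2 by rewrite /SL2 /= det2E !g2E; ring.
have A1 (Y : sl2 C) : Ad g1 Y = mksl2 ((Y : 'M_2) 0 0) (- (Y : 'M_2) 0 1) (- (Y : 'M_2) 1 0).
  have [i00 i01 i10 i11] := invmx2E hg1.
  apply/sl2P/mx2P; rewrite AdE // !mulmx2E !mksl2E ?i00 ?i01 ?i10 ?i11 !g1E ?sl2_11;
    have := sqrCi C; rewrite expr2 => i2; ring: i2.
have A2 (Y : sl2 C) : Ad g2 Y = mksl2 (- (Y : 'M_2) 0 0) (- (Y : 'M_2) 1 0) (- (Y : 'M_2) 0 1).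
  have [i00 i01 i10 i11] := invmx2E hg2.
  apply/sl2P/mx2P; rewrite AdE // !mulmx2E !mksl2E ?i00 ?i01 ?i10 ?i11 !g2E ?sl2_11; ring.
have fD Y Z : f (fun k => Y k + Z k) = f Y + f Z.
  rewrite -[f Y]mul1r -homog_fun1_lin //; congr f; apply/funext => k.
  by rewrite scale1r.
have f0 : f (fun=> 0) = 0.
  by apply: (addrI (f (fun=> 0))); rewrite addr0 -fD; congr f; apply/funext => k; rewrite addr0.
have : f (fun k => (X k + Ad g1 (X k)) + (Ad g2 (X k) + Ad g1 (Ad g2 (X k)))) = f X *+ 4.
  by rewrite !fD !(hf g1) // !(hf g2) // -!mulr2n -mulrnA.
rewrite (_ : (fun _ => _) = fun=> 0).
  by rewrite f0 => /esym/eqP; rewrite mulrn_eq0 => /eqP.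
apply/funext => k; rewrite !A1 A2; apply/sl2P/mx2P;
  rewrite !sl2DE !addmxE2 !mksl2E ?mxE ?sl2_11; ring.
Qed.

(** The invariants of positive degree have no linear part. *)
Lemma vanishes_pos_invariants f : pos_invariants f -> vanishes 2 f.
Proof.
move: f; apply: (lspan_sub (vanishes_subspace 2)) => f [hf [[//|[|k]] _ hk]].
  by rewrite (linear_invariant_eq0 hf hk); exact: (vanishes_subspace 2).1.
exact: vanishes_homog hk.
Qed.

Lemma comb_zX z X c : comb (fun i => z *: X i) c = z *: comb X c.
Proof.
rewrite /comb scaler_sumr; apply: eq_bigr => i _.
by rewrite !scalerA mulrC.
Qed.

Lemma tau_scale z X v c : tau c (fun i => z *: X i) v = z * tau c X v.
Proof. by rewrite /tau comb_zX sl2ZE -scalemxAl mxtraceZ. Qed.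

Lemma sigma_scale z X v c e : sigma c e (fun i => z *: X i) v = z ^+ 2 * sigma c e X v.
Proof.
have brZ (Y Z : sl2 C) : bracket (z *: Y) (z *: Z) = z ^+ 2 *: bracket Y Z.
  apply/sl2P; rewrite sl2ZE !bracketE !sl2ZE -!scalemxAl -!scalemxAr !scalerA.
  by rewrite -scalerBr expr2.
by rewrite /sigma !comb_zX brZ sl2ZE -scalemxAl mxtraceZ.
Qed.

Lemma vanishes_tau c v : vanishes 1 (fun X => tau c X v).
Proof. by move=> X; exists (tau c X v)%:P => z; rewrite hornerC tau_scale. Qed.

Lemma vanishes_prod_tau cs v : vanishes (size cs) (fun X => \prod_(c <- cs) tau c X v).
Proof.
elim: cs => [|c cs IH].
  by move=> X; exists 1 => z; rewrite big_nil hornerC mul1r.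
have := vanishesM (vanishes_tau c v) IH; congr vanishes.
by apply/funext => X; rewrite big_cons.
Qed.

Lemma vanishes_cov_span k phi v : cov_span k phi -> vanishes k (fun X => phi X v).
Proof.
elim=> {phi} [f cs [hf _] scs|f cs c e [hf _] scs|F G _ IHF _ IHG].
- by rewrite -scs -[size cs]add0n; apply: vanishesM (vanishes_prod_tau _ _); exact:
  vanishes_poly_fun.
- rewrite -scs -addn1 -[size cs]add0n; apply: vanishesM => [|X].
    by apply: vanishesM (vanishes_prod_tau _ _); exact: vanishes_poly_fun.
  by exists (sigma c e X v *: 'X) => z; rewrite sigma_scale hornerZ hornerX; ring.
- have [_ D] := vanishes_subspace k.
  have := D 1 (fun X => F X v) (fun X => G X v) IHF IHG.
  by congr vanishes; apply/funext => X; rewrite fct_lcombE mul1r.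
Qed.

End OrderOfVanishing.

(** * Directness of the decomposition *)

Section Decomposition.
Variables (C : numClosedFieldType) (m n : nat).
Local Notation d := n.+1.
Local Notation E := (('I_m -> sl2 C) -> 'M[C]_d).
Variable rho : sl2 C -> 'M[C]_d.
Hypothesis rho_lin : forall a X Y, rho (a *: X + Y) = a *: rho X + rho Y.
Hypothesis rho_bracket : forall X Y,
  rho (bracket X Y) = rho X *m rho Y - rho Y *m rho X.
Hypothesis rho_irr : forall U : {vspace 'cV[C]_d},
  (forall X v, v \in U -> rho X *m v \in U) -> U = 0%VS \/ U = fullv.
Variable Psi : 'M[C]_2 -> 'M[C]_d.
Hypothesis Psi_unit : forall g, SL2 g -> Psi g \in unitmx.
Hypothesis Psi_rho : forall g X, SL2 g -> Psi g *m rho X *m invmx (Psi g) = rho (Ad g X).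
Hypothesis hm : (1 < m)%N.
Implicit Types (X : 'I_m -> sl2 C) (v : 'cV[C]_2) (b : 'M[C]_(m, 2)) (F G P : E).
Local Notation fam := (@fam C m n rho).
Local Notation symb := (@symb C m n rho).
Local Notation b0 := (base_index C hm).
Local Notation gens := (@generators C m n rho).

Lemma inv_scaleA (f g : ('I_m -> sl2 C) -> C^o) F :
  inv_scale f (inv_scale g F) = inv_scale g (inv_scale f F).
Proof. by apply/funext => X; rewrite /inv_scale !scalerA mulrC. Qed.

Lemma inv_scale_lin (f : ('I_m -> sl2 C) -> C^o) a F G :
  inv_scale f (a *: F + G) = a *: inv_scale f F + inv_scale f G.
Proof.
apply/funext => X; rewrite /inv_scale -[RHS]/(a *: (f X *: F X) + f X *: G X).
by rewrite -[(a *: F + G) X]/(a *: F X + G X) scalerDr !scalerA mulrC.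
Qed.

Lemma invariants_subspace : is_subspace (@invariants C m).
Proof.
split; first exact: (invariants_const m (0 : C)).
move=> a f g hf hg.
by have := invariantsD (invariantsM (invariants_const m a) hf) hg.
Qed.

Lemma pos_invariants_sub : @pos_invariants C m `<=` @invariants C m.
Proof. by apply: (lspan_sub invariants_subspace) => f []. Qed.

Lemma pos_covariants_sub : @pos_covariants C m d Psi `<=` covariants Psi.
Proof.
have hC := @covariants_submodule C m n Psi.
apply: (lspan_sub (inv_submodule_subspace hC)) => _ [f hf [F cF <-]].
by case: hC => _ _; apply => //; exact: pos_invariants_sub.
Qed.

(** An invariant is a constant plus an invariant of positive degree. *)
Lemma invariants_split f : @invariants C m f -> exists (c : C) g,
  pos_invariants g /\ forall X, f X = c + g X.
Proof.
move=> /invariants_homog [N [g [hg -> hi]]].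
have g0 X : g 0%N X = g 0%N (fun=> 0).
  rewrite -[LHS]mul1r -(expr0 0) -(homog_fun_scale _ _ (hg 0%N)).
  by congr (g _ _); apply/funext => k; rewrite scale0r.
case: N hi => [|N] hi.
  exists 0, 0; split; first exact: (lspan_subspace _).1.
  by move=> X; rewrite big_ord0 add0r.
exists (g 0%N (fun=> 0)), (\sum_(k < N) g k.+1); split; last first.
  by move=> X; rewrite big_ord_recl -(g0 X).
apply: (is_subspace_sum _ (lspan_subspace _)) => k _; apply: sub_lspan.
by split; [apply: hi; exact: (ltn_ord k)|exists k.+1].
Qed.

Lemma pos_covariants_scale f P : invariants f -> pos_covariants Psi P ->
  pos_covariants Psi (inv_scale f P).
Proof.
move=> hf; move: P; apply: lspan_sub => [|_ [g hg [F cF <-]]].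
  split=> [|a F G UF UG].
    have -> : inv_scale f 0 = 0 :> E by apply/funext => X; rewrite /inv_scale scaler0.
    exact: (lspan_subspace _).1.
  by rewrite /= inv_scale_lin; exact: (lspan_subspace _).2.
rewrite /= inv_scaleA; apply: sub_lspan; exists g => //; exists (inv_scale f F) => //.
by case: (@covariants_submodule C m n Psi) => _ _; apply.
Qed.

(** Modulo the positive covariants, a module over the invariants is spanned
    over the scalars by its generators. *)
Lemma inv_span_split (B : set E) : B `<=` covariants Psi -> forall F, inv_span B F ->
  exists P G, [/\ pos_covariants Psi P, lspan B G & F = P + G].
Proof.
move=> hB; apply: inv_span_sub => [|F BF]; last first.
  by exists 0, F; split; [exact: (lspan_subspace _).1|exact: sub_lspan|rewrite add0r].
have hL := lspan_subspace B.
have hP : is_subspace (@pos_covariants C m d Psi) := lspan_subspace _.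
have LC : lspan B `<=` covariants Psi.
  by apply: (lspan_sub (inv_submodule_subspace (@covariants_submodule C m n Psi))).
split.
- by exists 0, 0; split; [exact: hP.1|exact: hL.1|rewrite add0r].
- move=> _ _ [P [G [PP LG ->]]] [P' [G' [PP' LG' ->]]]; exists (P + P'), (G + G').
  by split; [apply: (is_subspaceD hP)|apply: (is_subspaceD hL)|rewrite addrACA].
- move=> f _ hf [P [G [PP LG ->]]]; have [c [g [hg fE]]] := invariants_split hf.
  exists (inv_scale f P + inv_scale g G), (c *: G); split.
  + apply: (is_subspaceD hP) => //; first exact: pos_covariants_scale.
    by apply: sub_lspan; exists g => //; exists G => //; exact: LC.
  + exact: (is_subspaceZ _ hL).
  + apply/funext => X; rewrite -[RHS]/((f X *: P X + g X *: G X) + c *: G X).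
    by rewrite -addrA -scalerDl [g X + _]addrC -fE -scalerDr.
Qed.

Lemma vanishes_symb_pos k P v : pos_covariants Psi P ->
  vanishes (k + 2) (fun X => symb k P X v).
Proof.
move: P; apply: lspan_sub => [|_ [f hf [F cF <-]]].
  have hV := @vanishes_subspace C m (k + 2).
  split=> [|a F G UF UG]; rewrite /=.
    have := hV.1; congr vanishes; apply/funext => X.
    by rewrite /symb mul0mx mxtrace0.
  have := hV.2 a _ _ UF UG; congr vanishes; apply/funext => X.
  by rewrite symb_lin fct_lcombE.
rewrite /= (_ : (fun _ => _) = fun X => symb k F X v * f X).
  apply: vanishesM; last exact: vanishes_pos_invariants.
  apply: (vanishes_cov_span (phi := symb k F)).
  exact: (symb_cov_span rho_lin Psi_unit Psi_rho).
by apply/funext => X; rewrite symbZ mulrC.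
Qed.

(** The summands, as spans of the families. *)
Definition summand (w : bool) s : set E := fam_span (fam w s).

Lemma symb_summand_lt (w : bool) s k F X v : (s + w < k)%N -> summand w s F -> symb k F X v = 0.
Proof.
move=> sk [r ->]; rewrite /symb fct_sumE mulmx_suml raddf_sum big1 // => p _.
rewrite -[(_ *: _) X]/(p.1 *: fam w s p.2 X) -scalemxAl.
have := symb_fam rho_lin rho_bracket rho_irr Psi_unit Psi_rho p.2 X v (ltnW sk).
by rewrite (ltn_eqF sk) /symb /= mxtraceZ => ->; rewrite mulr0.
Qed.

Lemma symb_summand_scale (w : bool) s k F X v z : summand w s F ->
  symb k F (fun i => z *: X i) v = z ^+ (s + w.*2) * symb k F X v.
Proof.
move=> [r ->]; rewrite /symb !fct_sumE !mulmx_suml !raddf_sum mulr_sumr.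
apply: eq_bigr => p _ /=.
rewrite -[(_ *: _) _]/(p.1 *: fam w s p.2 _) -[(_ *: _) X]/(p.1 *: fam w s p.2 X).
rewrite (homog_map_scale _ _ (homog_fam rho_lin rho_bracket w s p.2)).
by rewrite scalerA mulrC -scalerA -scalemxAl mxtraceZ.
Qed.

Lemma symb_gl_act g k F X v : symb k (gl_act g F) X v = symb k F (right_mul X g) v.
Proof. by []. Qed.

(** The symbol of maximal order is injective on each summand. *)
Lemma symb_summand_eq0 (w : bool) s F : (s + w < d)%N -> summand w s F ->
  (forall X v, symb (s + w) F X v = 0) -> F = 0.
Proof.
move=> sd SF F0.
pose U : set E := [set G | summand w s G /\ forall X v, symb (s + w) G X v = 0].
have hS : is_gl_submodule (summand w s) := fam_span_gl (@famM C m n rho w s).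
have hU : is_gl_submodule U.
  split; first split.
  - by split; [exact: hS.1.1|move=> X v; rewrite /symb mul0mx mxtrace0].
  - move=> a G H [SG G0] [SH H0]; split; first exact: hS.1.2.
    by move=> X v; rewrite symb_lin G0 H0 mulr0 addr0.
  - move=> g G gU [SG G0]; split; first exact: hS.2.
    by move=> X v; rewrite symb_gl_act.
have [_ _ irr] := gl_gen_fam_irreducible rho_lin rho_bracket rho_irr Psi_unit Psi_rho hm sd.
have SE : gl_gen (fam w s b0) = summand w s by exact: gl_gen_famE.
have [|U0|UT] := irr U hU.
- by rewrite SE => G [].
- by have : U F by []; rewrite U0.
have [X [v]] := @symb_base_neq0 C m n rho rho_lin rho_bracket rho_irr Psi Psi_unit Psi_rho hm w
  s sd.
have : U (fam w s b0).
  by rewrite UT SE; exists [:: (1, b0)]; rewrite big_seq1 scale1r.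
by move=> [_ ->]; rewrite eqxx.
Qed.

(** The labels of the summand with index [y]. *)
Definition yw (y : 'I_d + 'I_n) : bool := if y is inr _ then true else false.
Definition ys (y : 'I_d + 'I_n) : nat := match y with inl s => s | inr k => k end.

Lemma yord y : (ys y + yw y < d)%N.
Proof. by case: y => [s|k] /=; rewrite ?addn0 ?addn1 //; exact: (ltn_ord k). Qed.

Lemma y_inj y y' : ys y = ys y' -> yw y = yw y' -> y = y'.
Proof. by case: y y' => [s|k] [s'|k'] //= h _; congr (_ _); apply: val_inj. Qed.

(** The components [u y] are shown to vanish by downward induction on the order
    of their symbols. *)
Theorem summands_direct P (u : 'I_d + 'I_n -> E) : pos_covariants Psi P ->
  (forall y, summand (yw y) (ys y) (u y)) -> P + \sum_y u y = 0 -> forall y, u y = 0.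
Proof.
move=> hP hu sum0.
suff H j : (j <= d)%N -> forall y, (d - j <= ys y + yw y)%N -> u y = 0.
  by move=> y; apply: (H d) => //; rewrite subnn.
elim: j => [_ y|j IH jd y0 y0k]; first by rewrite subn0 leqNgt yord.
have [k0|kk0] := leqP (d - j) (ys y0 + yw y0); first by apply: IH => //; exact: ltnW.
set k := (ys y0 + yw y0)%N in y0k kk0.
have ek y : (k < ys y + yw y)%N -> u y = 0 by move=> ky; apply: IH; lia.
apply: (symb_summand_eq0 (yord y0) (hu y0)) => X v.
have [q hq] := vanishes_symb_pos k v hP X.
(* The symbol of order [k] of the relation along the ray of [X], a polynomial
   in [z]; components with symbols of order less than [k] do not contribute. *)
pose c y := symb k (u y) X v; pose e y := (ys y + (yw y).*2)%N.
pose p : {poly C} := 'X^(k + 2) * q + \sum_y c y *: 'X^(e y).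
have p0 : p = 0.
  apply: horner_inj => z; rewrite horner0 hornerD hornerM hornerXn -hq horner_sum.
  have := congr1 (fun F => symb k F (fun i => z *: X i) v) sum0.
  rewrite /symb mul0mx mxtrace0 -[(P + _) _]/(P _ + _) fct_sumE mulmxDl mxtraceD.
  rewrite mulmx_suml [\tr (\sum__ _)]raddf_sum => h; rewrite -[RHS]h; congr (_ + _).
  apply: eq_bigr => y _; rewrite hornerZ hornerXn mulrC /c.
  by rewrite -symb_summand_scale.
(* Among the components with symbols of order [k], the degree in [X] singles
   out [y0]; it is at most [k + 1], while [P] contributes from [k + 2] on. *)
have := congr1 (fun p : {poly C} => p`_(e y0)) p0.
rewrite coef0 coefD coefXnM coef_sum (_ : (e y0 < k + 2)%N); last first.
  by rewrite /e /k; case: (yw y0) => /=; lia.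
rewrite add0r (bigD1 y0) //= coefZ coefXn eqxx mulr1 big1 ?addr0 // => y yy0.
rewrite coefZ coefXn; case: eqP => [eyy|_]; last by rewrite mulr0.
rewrite mulr1 /c; have [yk|ky|yk] := ltngtP (ys y + yw y)%N k.
- exact: symb_summand_lt yk (hu y).
- by rewrite (ek y ky) /symb mul0mx mxtrace0.
- case/eqP: yy0; move: eyy yk; rewrite /e /k => h1 h2.
  have ew : (yw y : nat) = yw y0 by move: h1 h2; rewrite -!addnn; lia.
  apply: y_inj; first by move: h2; rewrite ew => /addIn.
  by move: ew; case: (yw y); case: (yw y0).
Qed.

End Decomposition.

(** * The decomposition and minimal generation *)

Section MinimalGeneration.
Variables (C : numClosedFieldType) (m n : nat).
Local Notation d := n.+1.
Local Notation E := (('I_m -> sl2 C) -> 'M[C]_d).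
Variable rho : sl2 C -> 'M[C]_d.
Hypothesis rho_lin : forall a X Y, rho (a *: X + Y) = a *: rho X + rho Y.
Hypothesis rho_bracket : forall X Y,
  rho (bracket X Y) = rho X *m rho Y - rho Y *m rho X.
Hypothesis rho_irr : forall U : {vspace 'cV[C]_d},
  (forall X v, v \in U -> rho X *m v \in U) -> U = 0%VS \/ U = fullv.
Variable Psi : 'M[C]_2 -> 'M[C]_d.
Hypothesis Psi_unit : forall g, SL2 g -> Psi g \in unitmx.
Hypothesis Psi_rho : forall g X, SL2 g -> Psi g *m rho X *m invmx (Psi g) = rho (Ad g X).
Hypothesis hm : (1 < m)%N.
Implicit Types (X : 'I_m -> sl2 C) (v : 'cV[C]_2) (b : 'M[C]_(m, 2)) (F G P : E).
Local Notation fam := (@fam C m n rho).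
Local Notation b0 := (base_index C hm).
Local Notation gens := (@generators C m n rho).
Local Notation t1 := (tmap rho (Ordinal (ltnW hm))).
Local Notation t2 := (tmap rho (Ordinal hm)).
Local Notation covs := (@covariants C m d Psi).
Local Notation pcovs := (@pos_covariants C m d Psi).
Local Notation summand := (@summand C m n rho).

Lemma fct_exprE F s X : (F ^+ s) X = F X ^+ s.
Proof. by elim: s => [|s IH] //; rewrite !exprS -IH. Qed.

Lemma tmap_base (j : 'I_2) X : tmap rho (widen_ord hm j) X = rho (comb X (col j b0)).
Proof. by rewrite col_base comb_delta. Qed.

Lemma tpow_fam s : tpow t1 s = fam false s b0.
Proof.
apply/funext => X; rewrite /tpow fct_exprE /fam /pfam /kfam mulmx1 -tmap_base.
by congr (tmap rho _ X ^+ s); apply: val_inj.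
Qed.

Lemma tcomm_fam s : tcomm t1 t2 s.+1 = fam true s b0.
Proof.
apply/funext => X; rewrite /tcomm /fam /pfam /kfam rho_bracket -!tmap_base.
rewrite (_ : widen_ord hm 0 = Ordinal (ltnW hm)); last exact: val_inj.
rewrite (_ : widen_ord hm 1 = Ordinal hm); last exact: val_inj.
by rewrite -fct_exprE.
Qed.

Lemma gen_summandE : gen_summand t1 t2 = fun y => summand (yw y) (ys y).
Proof.
apply/funext => -[s|k] /=; rewrite ?tpow_fam ?tcomm_fam; exact: gl_gen_famE.
Qed.

Lemma summand_subspace (w : bool) s : is_subspace (summand w s).
Proof. exact: fam_span_subspace. Qed.

Lemma sum_sets_subspace (I : finType) (U : I -> set E) :
  (forall i, is_subspace (U i)) -> is_subspace (sum_sets U).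
Proof.
move=> hU; split.
  by exists (fun=> 0) => [i|]; [exact: (hU i).1|rewrite big1].
move=> a _ _ [u Uu ->] [v Uv ->]; exists (fun i => a *: u i + v i).
  by move=> i; exact: (hU i).2.
by rewrite big_split scaler_sumr.
Qed.

Lemma generator_index (w : bool) s : (s + w < d)%N -> exists y : 'I_d + 'I_n, ys y = s /\ yw y = w.
Proof.
case: w => sd; last by rewrite addn0 in sd; exists (inl (Ordinal sd)).
by rewrite addn1 ltnS in sd; exists (inr (Ordinal sd)).
Qed.

Lemma sum_sets_summand : sum_sets (gen_summand t1 t2) = lspan gens.
Proof.
rewrite gen_summandE; apply/seteqP; split.
  move=> _ [u uS ->]; apply: (is_subspace_sum _ (lspan_subspace _)) => y _.
  have [r ->] := uS y; apply: (is_subspace_sum _ (lspan_subspace _)) => p _.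
  apply: (is_subspaceZ _ (lspan_subspace _)); apply: sub_lspan.
  by exists (yw y), (ys y), p.2; split=> //; exact: yord.
apply: lspan_sub; first by apply: sum_sets_subspace => y; exact: summand_subspace.
move=> _ [w [s [b [sd ->]]]]; have [y [<- <-]] := generator_index sd.
exists (fun y' => if y' == y then fam (yw y) (ys y) b else 0).
  move=> y'; case: eqP => [->|_]; last exact: (summand_subspace _ _).1.
  by exists [:: (1, b)]; rewrite big_seq1 scale1r.
by rewrite -big_mkcond big_pred1_eq.
Qed.

Lemma sum_option (V : nmodType) (I : finType) (u : option I -> V) :
  \sum_x u x = u None + \sum_i u (Some i).
Proof.
rewrite (bigD1 None) //=; congr (_ + _).
rewrite (reindex_omap Some id) => [|[x|] //].
by apply: eq_bigl => i; rewrite eqxx.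
Qed.

Lemma sum_sets_covariants : sum_sets (gen_summand t1 t2) `<=` covs.
Proof.
rewrite sum_sets_summand; apply: lspan_sub.
  exact: inv_submodule_subspace (@covariants_submodule C m n Psi).
move=> F gF; apply: (generators_covariants rho_lin rho_bracket Psi_unit Psi_rho).
exact: sub_inv_span.
Qed.

Theorem covariants_direct_sum : is_direct_sum covs (all_summands Psi t1 t2).
Proof.
split.
  apply/seteqP; split=> [F|_ [u Uu ->]].
    rewrite (covariants_inv_span m rho_lin rho_bracket rho_irr Psi_unit Psi_rho).
    have gC : gens `<=` covs.
      move=> G /sub_inv_span.
      exact: (generators_covariants rho_lin rho_bracket Psi_unit Psi_rho).
    move=> /(inv_span_split gC) [P [G [PP LG ->]]].
    move: LG; rewrite -sum_sets_summand => -[u uS ->].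
    exists (fun x => if x is Some y then u y else P); last by rewrite sum_option.
    by case=> [y|]; [exact: uS|exact: PP].
  rewrite sum_option; have hC := inv_submodule_subspace (@covariants_submodule C m n Psi).
  apply: (is_subspaceD hC); first exact: (pos_covariants_sub (Uu None)).
  by apply: sum_sets_covariants; exists (fun y => u (Some y)) => // y; exact: (Uu (Some y)).
move=> u Uu; rewrite sum_option => u0.
have uS y : summand (yw y) (ys y) (u (Some y)).
  by have := Uu (Some y); rewrite /= gen_summandE.
have uy := summands_direct rho_lin rho_bracket rho_irr Psi_unit Psi_rho hm (Uu None) uS u0.
case=> [y|]; first exact: uy.
by move: u0; rewrite [X in _ + X]big1 ?addr0 // => y _; exact: uy.
Qed.

Lemma homog_basis_exists : exists B, is_homog_basis (sum_sets (gen_summand t1 t2)) B.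
Proof.
rewrite sum_sets_summand; have [B BG hB] := basis_sub gens.
exists B; split=> // F /BG [w [s [b [_ ->]]]].
by exists (s + w.*2)%N; exact: homog_fam.
Qed.

(** If a subset of a basis generates, then it contains every element of the
    basis: modulo [D_0^+ C], which meets the sum of the summands trivially, that
    element is in the linear span of the subset. *)
Theorem summands_minimally_generate :
  minimally_generated_by Psi (sum_sets (gen_summand t1 t2)).
Proof.
split=> [|B [[indB spanB] _]]; first exact: homog_basis_exists.
have BW : B `<=` sum_sets (gen_summand t1 t2) by rewrite -spanB; exact: sub_lspan.
have BC : B `<=` covs by move=> F /BW /sum_sets_covariants.
have hI := inv_submodule_subspace (inv_span_submodule B).
split.
  apply/seteqP; split; first exact: inv_span_sub (@covariants_submodule C m n Psi) BC.
  rewrite (covariants_inv_span m rho_lin rho_bracket rho_irr Psi_unit Psi_rho).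
  apply: inv_span_sub; first exact: inv_span_submodule.
  move=> F /sub_lspan; rewrite -sum_sets_summand -spanB.
  by apply: (lspan_sub hI); exact: sub_inv_span.
move=> B' B'B spanB'; apply/seteqP; split=> // x Bx.
apply: (lin_indep_lspan indB B'B Bx).
have Cx : inv_span B' x by rewrite spanB'; exact: BC.
have B'C : B' `<=` covs by move=> y /B'B /BC.
have [P [G [PP LG xPG]]] := inv_span_split B'C Cx.
have WG : sum_sets (gen_summand t1 t2) G.
  by rewrite -spanB; apply: (lspan_sub (lspan_subspace B)) LG => y /B'B; exact: sub_lspan.
have hW : is_subspace (sum_sets (gen_summand t1 t2)).
  by rewrite sum_sets_summand; exact: lspan_subspace.
have [u uS Gx] : sum_sets (gen_summand t1 t2) (G - x).
  by apply: (is_subspaceB hW) => //; exact: BW.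
rewrite gen_summandE in uS.
have s0 : P + \sum_y u y = 0 by rewrite -Gx xPG addrA subrr.
have uy := summands_direct rho_lin rho_bracket rho_irr Psi_unit Psi_rho hm PP uS s0.
by move: Gx; rewrite big1 => [|y _]; [move/eqP; rewrite subr_eq0 => /eqP <-|exact: uy].
Qed.

Lemma fam_weight (w : bool) s : (s + w < d)%N ->
  is_irreducible_of_weight Psi (gl_gen (fam w s b0)) (if w then [:: s.+1; 1%N] else [:: s]).
Proof.
move=> sd; split.
- rewrite (gl_gen_famE rho_lin rho_bracket) => _ [r ->].
  have hC := inv_submodule_subspace (@covariants_submodule C m n Psi).
  apply: (is_subspace_sum _ hC) => p _; apply: (is_subspaceZ _ hC).
  exact: covariants_fam.
- exact: (gl_gen_fam_irreducible rho_lin rho_bracket rho_irr Psi_unit Psi_rho hm sd).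
- exact: (gl_gen_fam_weight rho_lin rho_bracket rho_irr Psi_unit Psi_rho hm sd).
Qed.

End MinimalGeneration.

Theorem theorem3p5 (R : realType) (m d : nat) (hm : (1 < m)%N) (hd : (1 < d)%N)
    (Psi : 'M[R[i]]_2 -> 'M[R[i]]_d) (rho : sl2 R[i] -> 'M[R[i]]_d)
    (hPsi : is_holomorphic_rep Psi) (hirr : is_irreducible_rep Psi)
    (hrho : is_tangent_rep Psi rho) :
  let t1 := tmap rho (Ordinal (ltnW hm)) in
  let t2 := tmap rho (Ordinal hm) in
  [/\ is_direct_sum (covariants Psi) (all_summands Psi t1 t2),
      minimally_generated_by Psi (sum_sets (gen_summand t1 t2)),
      forall s : nat, (s <= d.-1)%N ->
        is_irreducible_of_weight Psi (gl_gen (tpow t1 s)) [:: s] &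
      forall s : nat, (1 <= s <= d.-1)%N ->
        is_irreducible_of_weight Psi (gl_gen (tcomm t1 t2 s)) [:: s; 1%N]].
Proof.
case: d hd Psi rho hPsi hirr hrho => // n hd Psi rho hPsi hirr hrho t1 t2.
have rho_lin := tangent_lin hrho.
have rho_bracket := tangent_bracket hPsi hrho.
have rho_irr := complex_tangent_irreducible hPsi hrho hirr.
have Psi_unit := Psi_unitmx hPsi.
have Psi_rho := tangent_Ad hPsi hrho.
split.
- exact: (covariants_direct_sum rho_lin rho_bracket rho_irr Psi_unit Psi_rho hm).
- exact: (summands_minimally_generate rho_lin rho_bracket rho_irr Psi_unit Psi_rho hm).
- move=> s sn; rewrite tpow_fam.
  apply: (fam_weight rho_lin rho_bracket rho_irr Psi_unit Psi_rho hm (w := false)).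
  by rewrite addn0.
- case=> [//|s] sn; rewrite (tcomm_fam rho_bracket).
  apply: (fam_weight rho_lin rho_bracket rho_irr Psi_unit Psi_rho hm (w := true)).
  by rewrite addn1.
Qed.
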